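(* Let $A(t)=(a_{jk}(t))$, $B(t)$, $C(t)$ be complex-valued continuous $2\times2$ matrix functions on $[t_0;+\infty)$ with $B=B^*$, $C=C^*$. Assume: 1') $B(t)\ge0$ (nonnegative definite) for $t\ge t_0$, and its nonnegative definite square root $\sqrt{B(t)}$ is continuously differentiable on $[t_0;+\infty)$; 2') there is a continuous $2\times2$ matrix function $F(t)$ on $[t_0;+\infty)$ satisfying $$\sqrt{B(t)}\,F(t)\bigl[A(t)\sqrt{B(t)}-\sqrt{B(t)}\,'\bigr]=A(t)\sqrt{B(t)}-\sqrt{B(t)}\,',\qquad t\ge t_0;$$ define $P(t)=F(t)\bigl[A(t)\sqrt{B(t)}-\sqrt{B(t)}\,'\bigr]=(p_{jk}(t))_{j,k=1}^2$ and $Q(t)=\sqrt{B(t)}\,C(t)\sqrt{B(t)}=(q_{jk}(t))_{j,k=1}^2$; 3') $p_{12}(t)$ and $p_{21}(t)$ are continuously differentiable on $[t_0;+\infty)$; 4') for $j=1,2$ there exist strictly increasing sequences $\xi_{j,0}=t_0<\xi_{j,1}<\dots<\xi_{j,m}<\dots$ with $\xi_{j,m}\to+\infty$ such that for all $m=0,1,2,\dots$ and all $t\in[\xi_{j,m};\xi_{j,m+1})$ $$\int_{\xi_{j,m}}^{t}\exp\Bigl\{\int_{\xi_{j,m}}^{\tau}\bigl[2\,\mathrm{Re}\,p_{jj}(s)-\widetilde{I}_{j+2}(\xi_{j,m};s)\bigr]ds\Bigr\}\widetilde{\chi}_{j+2}(\tau)\,d\tau\le0,$$ where, for $t\ge t_0$,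 $t\ge\xi\ge t_0$, $$\widetilde{\mathfrak{M}}(t)=\max_{\tau\in[t_0;t]}\Bigl|\exp\Bigl\{-\int_\tau^t\bigl(\overline{p}_{11}(s)+p_{22}(s)\bigr)ds\Bigr\}\bigl(p_{12}(\tau)-\overline{p}_{21}(\tau)\bigr)\Bigr|,$$ $$\widetilde{\chi}_3(t)=\biggl[\widetilde{\mathfrak{M}}(t)+\int_{t_0}^t\Bigl|\exp\Bigl\{-\int_\tau^t\bigl(\overline{p}_{11}(s)+p_{22}(s)\bigr)ds\Bigr\}\bigl[\overline{p}_{21}\,'(\tau)+\overline{p}_{21}(\tau)(\overline{p}_{11}(\tau)+p_{22}(\tau))+q_{12}(\tau)\bigr]\Bigr|d\tau\biggr]^2-|p_{21}(t)|^2-q_{11}(t),$$ $$\widetilde{\chi}_4(t)=\biggl[\widetilde{\mathfrak{M}}(t)+\int_{t_0}^t\Bigl|\exp\Bigl\{-\int_\tau^t\bigl(\overline{p}_{11}(s)+p_{22}(s)\bigr)ds\Bigr\}\bigl[p_{12}\,'(\tau)+p_{12}(\tau)(\overline{p}_{11}(\tau)+p_{22}(\tau))+q_{12}(\tau)\bigr]\Bigr|d\tau\biggr]^2-|p_{12}(t)|^2-q_{22}(t),$$ $$\widetilde{I}_{j+2}(\xi;t)=\int_\xi^t\exp\Bigl\{-\int_\tau^t2\,\mathrm{Re}\,p_{jj}(s)\,ds\Bigr\}\widetilde{\chi}_{j+2}(\tau)\,d\tau,\quad j=1,2.$$ Then the Hamiltonian system $\phi'=A(t)\phi+B(t)\psi,\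 \psi'=C(t)\phi-A^*(t)\psi$, $t\ge t_0$, is non oscillatory.
   Context: For the system $\phi'=A(t)\phi+B(t)\psi,\ \psi'=C(t)\phi-A^*(t)\psi$ consider the matrix system $\Phi'=A(t)\Phi+B(t)\Psi,\ \Psi'=C(t)\Phi-A^*(t)\Psi$ with $2\times2$ matrix unknowns. A solution $(\Phi,\Psi)$ is conjoined if $\Phi^*\Psi=\Psi^*\Phi$ on $[t_0;+\infty)$, and oscillatory if $\det\Phi(t)$ has arbitrarily large zeros. The Hamiltonian system is oscillatory if all conjoined solutions of the matrix system are oscillatory, and non oscillatory otherwise. $\sqrt{B(t)}\,'$ denotes the derivative of $\sqrt{B(t)}$; overline denotes complex conjugation. *)

(* Defs.v *)
From Stdlib Require Import Reals.
From Coquelicot Require Import Coquelicot.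

Open Scope R_scope.

Record M2 := mkM2 { e11 : C; e12 : C; e21 : C; e22 : C }.

Definition M2add (X Y : M2) : M2 :=
  mkM2 (Cplus (e11 X) (e11 Y)) (Cplus (e12 X) (e12 Y))
       (Cplus (e21 X) (e21 Y)) (Cplus (e22 X) (e22 Y)).
Definition M2sub (X Y : M2) : M2 :=
  mkM2 (Cminus (e11 X) (e11 Y)) (Cminus (e12 X) (e12 Y))
       (Cminus (e21 X) (e21 Y)) (Cminus (e22 X) (e22 Y)).
Definition M2mul (X Y : M2) : M2 :=
  mkM2 (Cplus (Cmult (e11 X) (e11 Y)) (Cmult (e12 X) (e21 Y)))
       (Cplus (Cmult (e11 X) (e12 Y)) (Cmult (e12 X) (e22 Y)))
       (Cplus (Cmult (e21 X) (e11 Y)) (Cmult (e22 X) (e21 Y)))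
       (Cplus (Cmult (e21 X) (e12 Y)) (Cmult (e22 X) (e22 Y))).
Definition M2adj (X : M2) : M2 :=
  mkM2 (Cconj (e11 X)) (Cconj (e21 X)) (Cconj (e12 X)) (Cconj (e22 X)).
Definition M2det (X : M2) : C :=
  Cminus (Cmult (e11 X) (e22 X)) (Cmult (e12 X) (e21 X)).

Definition M2psd (X : M2) : Prop :=
  M2adj X = X /\
  forall v1 v2 : C,
    0 <= Re (Cplus (Cmult (Cconj v1) (Cplus (Cmult (e11 X) v1) (Cmult (e12 X) v2)))
                   (Cmult (Cconj v2) (Cplus (Cmult (e21 X) v1) (Cmult (e22 X) v2)))).

Definition cont_on (t0 : R) (f : R -> C) : Prop :=
  forall t, t0 <= t ->
    filterlim f (within (fun s => t0 <= s) (locally t)) (locally (f t)).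

Definition deriv_on (t0 : R) (f f' : R -> C) : Prop :=
  forall t, t0 <= t ->
    filterlim (fun s => Cmult (Cminus (f s) (f t)) (RtoC (/ (s - t))))
      (within (fun s => t0 <= s /\ s <> t) (locally t)) (locally (f' t)).

Definition M2cont_on (t0 : R) (X : R -> M2) : Prop :=
  cont_on t0 (fun t => e11 (X t)) /\ cont_on t0 (fun t => e12 (X t)) /\
  cont_on t0 (fun t => e21 (X t)) /\ cont_on t0 (fun t => e22 (X t)).

Definition M2deriv_on (t0 : R) (X X' : R -> M2) : Prop :=
  deriv_on t0 (fun t => e11 (X t)) (fun t => e11 (X' t)) /\
  deriv_on t0 (fun t => e12 (X t)) (fun t => e12 (X' t)) /\
  deriv_on t0 (fun t => e21 (X t)) (fun t => e21 (X' t)) /\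
  deriv_on t0 (fun t => e22 (X t)) (fun t => e22 (X' t)).

Definition CInt (f : R -> C) (a b : R) : C := @RInt C_R_CompleteNormedModule f a b.
Definition cexp (z : C) : C := (exp (Re z) * cos (Im z), exp (Re z) * sin (Im z)).

Definition is_matrix_solution (t0 : R) (A B Cm : R -> M2) (Phi Psi : R -> M2) : Prop :=
  exists dPhi dPsi : R -> M2,
    M2deriv_on t0 Phi dPhi /\ M2deriv_on t0 Psi dPsi /\
    forall t, t0 <= t ->
      dPhi t = M2add (M2mul (A t) (Phi t)) (M2mul (B t) (Psi t)) /\
      dPsi t = M2sub (M2mul (Cm t) (Phi t)) (M2mul (M2adj (A t)) (Psi t)).

Definition conjoined (t0 : R) (Phi Psi : R -> M2) : Prop :=
  forall t, t0 <= t -> M2mul (M2adj (Phi t)) (Psi t) = M2mul (M2adj (Psi t)) (Phi t).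

Definition oscillatory_solution (t0 : R) (Phi : R -> M2) : Prop :=
  forall T : R, exists t, T <= t /\ t0 <= t /\ M2det (Phi t) = RtoC 0.

Definition ham_oscillatory (t0 : R) (A B Cm : R -> M2) : Prop :=
  forall Phi Psi, is_matrix_solution t0 A B Cm Phi Psi -> conjoined t0 Phi Psi ->
    oscillatory_solution t0 Phi.

Definition ham_nonoscillatory (t0 : R) (A B Cm : R -> M2) : Prop :=
  ~ ham_oscillatory t0 A B Cm.

Definition Pmat (A S dS F : R -> M2) (t : R) : M2 :=
  M2mul (F t) (M2sub (M2mul (A t) (S t)) (dS t)).
Definition Qmat (S Cm : R -> M2) (t : R) : M2 :=
  M2mul (S t) (M2mul (Cm t) (S t)).

Definition Ekern (p11 p22 : R -> C) (tau t : R) : C :=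
  cexp (Copp (CInt (fun s => Cplus (Cconj (p11 s)) (p22 s)) tau t)).

Definition Mfrak (t0 : R) (p11 p12 p21 p22 : R -> C) (t : R) : R :=
  real (Lub_Rbar (fun x => exists tau, t0 <= tau <= t /\
      x = Cmod (Cmult (Ekern p11 p22 tau t) (Cminus (p12 tau) (Cconj (p21 tau)))))).

Definition chi3 (t0 : R) (p11 p12 p21 p22 dp21 q11 q12 : R -> C) (t : R) : R :=
  (Mfrak t0 p11 p12 p21 p22 t +
   RInt (fun tau => Cmod (Cmult (Ekern p11 p22 tau t)
          (Cplus (Cplus (Cconj (dp21 tau))
                        (Cmult (Cconj (p21 tau)) (Cplus (Cconj (p11 tau)) (p22 tau))))
                 (q12 tau)))) t0 t) ^ 2
  - (Cmod (p21 t)) ^ 2 - Re (q11 t).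

Definition chi4 (t0 : R) (p11 p12 p21 p22 dp12 q12 q22 : R -> C) (t : R) : R :=
  (Mfrak t0 p11 p12 p21 p22 t +
   RInt (fun tau => Cmod (Cmult (Ekern p11 p22 tau t)
          (Cplus (Cplus (dp12 tau)
                        (Cmult (p12 tau) (Cplus (Cconj (p11 tau)) (p22 tau))))
                 (q12 tau)))) t0 t) ^ 2
  - (Cmod (p12 t)) ^ 2 - Re (q22 t).

Definition Itil (pjj : R -> C) (chi : R -> R) (xi t : R) : R :=
  RInt (fun tau => exp (- RInt (fun s => 2 * Re (pjj s)) tau t) * chi tau) xi t.

Definition cond4 (t0 : R) (pjj : R -> C) (chi : R -> R) : Prop :=
  exists xi : nat -> R,
    xi 0%nat = t0 /\ (forall m, xi m < xi (S m)) /\ is_lim_seq xi p_infty /\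
    forall (m : nat) (t : R), xi m <= t < xi (S m) ->
      RInt (fun tau =>
              exp (RInt (fun s => 2 * Re (pjj s) - Itil pjj chi (xi m) s) (xi m) tau)
              * chi tau) (xi m) t <= 0.

(* Main.v *)
Require Import Defs.
From Stdlib Require Import Reals Lra Lia Classical.
From Coquelicot Require Import Coquelicot.

(* With [Z = S Y S], where [Y = Psi Phi^-1] and [S] is the square root of [B], the Riccati equation of the system becomes
   [Z' + Z^2 + P* Z + Z P - Q = 0], which makes sense also where [B] is singular.  In its diagonal entries the coupling
   with [z12] is [|z12 + conj p21|^2] resp. [|z12 + p12|^2].  Starting from [z12 = - conj p21], the linear equation for
   [z12] bounds these moduli by the expressions squared in [chi3], [chi4] as long as [z11, z22 >= 0], and the sign
   condition on [chi3], [chi4] keeps [z11, z22] positive; hence a Hermitian solution [Z] exists on the whole half-line.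

   The initial value of [Z] need not be of the form [S Y S] when [S] is singular.  Since [S' = A S - S P], the rank of
   [S] is constant.  If it is one, [cof S] spans the kernel direction of [S], [d = tr (cof S Z)] keeps its sign
   eventually, and the Schur complement [(det Z / d) S] (or [Z] itself, if [d = 0] eventually) is a solution of the same
   equation which factors through [S]. *)

(** * Global solutions of Lipschitz systems *)

(** The equation for [Z] comes from [Y' = C - A* Y - Y A - Y B Y]: the factorization
    [A S - S' = S P] and its adjoint give [S' = A S - S P = S A* - P* S], because [S'] is Hermitian,
    and every [A] cancels in the derivative of [S Y S]. The starting value of [z12] is dictated by
    the shape of chi. With [d = p12 - conj p21], the coupling terms [z12 + conj p21] and [z12 + p12]
    begin at [0] and [d], and their equations carry the forcing [- z11 d] resp. [z22 d]. The damping
    [z11 + z22] dominates both, at the cost of a weighted maximum of [|d|], which is [Mfrak]. The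
    estimates are circular: the bounds on [z12] need [z11, z22 >= 0], and this sign needs the bounds
    on [z12]. Instead of continuing a local solution for as long as they hold, the nonlinear terms
    are truncated so that the system is globally Lipschitz; the bounds are proved for the truncated
    system, and they show that on the half-line no truncation ever acts. Hence an existence theorem
    for globally Lipschitz systems is enough. *)

Lemma nondecreasing_of_deriv (f df : R -> R) (a b : R) :
  a <= b -> (forall t, a <= t <= b -> is_derive f t (df t)) ->
  (forall t, a <= t <= b -> 0 <= df t) -> f a <= f b.
Proof.
  intros Hab Hd Hp.
  destruct (MVT_gen f a b df) as [c [Hc He]].
  - intros x Hx; rewrite Rmin_left, Rmax_right in Hx by lra; apply Hd; lra.
  - intros x Hx; rewrite Rmin_left, Rmax_right in Hx by lra.
    apply continuity_pt_filterlim, (ex_derive_continuous f); eexists; apply Hd; lra.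
  - rewrite Rmin_left, Rmax_right in Hc by lra.
    assert (0 <= df c) by (apply Hp; lra). nra.
Qed.

Lemma ex_RInt_cont (f : R -> R) (a b : R) : (forall t, continuous f t) -> ex_RInt f a b.
Proof. intros H; apply (ex_RInt_continuous (V := R_CompleteNormedModule)); auto. Qed.

Lemma derive_RInt_cont (f : R -> R) (a t : R) :
  (forall s, continuous f s) -> is_derive (fun s => RInt f a s) t (f t).
Proof.
  intros H; apply (is_derive_RInt f (fun s => RInt f a s) a t); [|apply H].
  apply filter_forall; intros s; apply (RInt_correct (V := R_CompleteNormedModule)).
  now apply ex_RInt_cont.
Qed.

Lemma continuous_of_derive (f : R -> R) (t l : R) : is_derive f t l -> continuous f t.
Proof. intros H; apply (ex_derive_continuous f); now exists l. Qed.

Lemma RInt_minus_cont (f g : R -> R) (a b : R) :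
  (forall t, continuous f t) -> (forall t, continuous g t) ->
  RInt (fun t => f t - g t) a b = RInt f a b - RInt g a b.
Proof. intros; apply (RInt_minus (V := R_CompleteNormedModule)); now apply ex_RInt_cont. Qed.

(** The weight [exp (2 K |t - t1|)] integrates to itself over [2 K], up to a constant of favourable
    sign, so one integration of a [K]-Lipschitz bound gains the factor 1/2 however long the interval
    is. Arguing by monotonicity of majorant plus or minus integral avoids a division by [K]. *)
Lemma RInt_exp_bound (u : R -> R) (K c t1 t : R) :
  0 <= c -> (forall s, continuous u s) ->
  (forall s, Rabs (s - t1) <= Rabs (t - t1) ->
     Rabs (u s) <= K * c * exp (2 * K * Rabs (s - t1))) ->
  Rabs (RInt u t1 t) <= c / 2 * exp (2 * K * Rabs (t - t1)).
Proof.
  intros Hc Hu Hb.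
  assert (D : forall s, is_derive (fun s => RInt u t1 s) s (u s)) by (intro; now apply derive_RInt_cont).
  assert (E0 : RInt u t1 t1 = 0) by apply (RInt_point (V := R_CompleteNormedModule)).
  assert (X : forall e, e = 1 \/ e = -1 ->
    0 <= c / 2 * exp (2 * K * Rabs (t - t1)) + e * RInt u t1 t).
  { intros e He. destruct (Rle_dec t1 t) as [Ht|Ht].
    - rewrite (Rabs_pos_eq (t - t1)) in * by lra.
      assert (Hm := nondecreasing_of_deriv
        (fun s => c / 2 * exp (2 * K * (s - t1)) + e * RInt u t1 s)
        (fun s => c / 2 * (2 * K * exp (2 * K * (s - t1))) + e * u s) t1 t Ht).
      simpl in Hm. rewrite E0, Rminus_diag, Rmult_0_r, exp_0 in Hm.
      cut (c / 2 * 1 + e * 0 <= c / 2 * exp (2 * K * (t - t1)) + e * RInt u t1 t); [lra|].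
      apply Hm.
      + intros s _.
        apply (is_derive_plus (fun s => c / 2 * exp (2 * K * (s - t1))) (fun s => e * RInt u t1 s)).
        * auto_derive; trivial. unfold Rminus; field.
        * apply is_derive_scal, D.
      + intros s Hs. specialize (Hb s). rewrite Rabs_pos_eq in Hb by lra.
        assert (B := Hb ltac:(lra)). apply Rabs_le_between in B. destruct He; subst; lra.
    - rewrite (Rabs_left1 (t - t1)) in * by lra.
      assert (Hm := nondecreasing_of_deriv
        (fun s => - (c / 2 * exp (2 * K * (t1 - s)) + e * RInt u t1 s))
        (fun s => - (c / 2 * (- (2 * K) * exp (2 * K * (t1 - s))) + e * u s)) t t1 ltac:(lra)).
      simpl in Hm. rewrite E0, Rminus_diag, Rmult_0_r, exp_0 in Hm.
      replace (- (t - t1)) with (t1 - t) by ring.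
      cut (- (c / 2 * exp (2 * K * (t1 - t)) + e * RInt u t1 t) <= - (c / 2 * 1 + e * 0)); [lra|].
      apply Hm.
      + intros s _.
        apply (is_derive_opp (fun s => c / 2 * exp (2 * K * (t1 - s)) + e * RInt u t1 s)).
        apply (is_derive_plus (fun s => c / 2 * exp (2 * K * (t1 - s))) (fun s => e * RInt u t1 s)).
        * auto_derive; trivial. unfold Rminus; field.
        * apply is_derive_scal, D.
      + intros s Hs. specialize (Hb s). rewrite Rabs_left1 in Hb by lra.
        replace (- (s - t1)) with (t1 - s) in Hb by ring.
        assert (B := Hb ltac:(lra)). apply Rabs_le_between in B. destruct He; subst; lra. }
  apply Rabs_le. generalize (X 1 (or_introl eq_refl)) (X (-1) (or_intror eq_refl)). lra.
Qed.

Lemma geometric_limit (u : nat -> R) (a : R) :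
  (forall n, Rabs (u (S n) - u n) <= a * (/ 2) ^ n) ->
  forall n, Rabs (u n - real (Lim_seq u)) <= 2 * a * (/ 2) ^ n.
Proof.
  intros H.
  (* The subtracted tail makes the right-hand side telescope, which is what the induction on [k]
     needs. *)
  assert (H1 : forall k n, Rabs (u (n + k)%nat - u n) <= 2 * a * (/ 2) ^ n - 2 * a * (/ 2) ^ (n + k)).
  { induction k; intros n.
    - rewrite Nat.add_0_r, Rminus_diag, Rabs_R0. lra.
    - replace (n + S k)%nat with (S (n + k)) by lia.
      replace (u (S (n + k)) - u n) with ((u (S (n + k)) - u (n + k)%nat) + (u (n + k)%nat - u n)) by ring.
      eapply Rle_trans; [apply Rabs_triang|].
      specialize (IHk n). specialize (H (n + k)%nat). simpl. lra. }
  assert (Ha : 0 <= a). { specialize (H O). generalize (Rabs_pos (u 1%nat - u O)). simpl in H. lra. }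
  assert (P : forall n, 0 < (/ 2) ^ n) by (intros; apply pow_lt; lra).
  assert (H2 : forall n k, Rabs (u (n + k)%nat - u n) <= 2 * a * (/ 2) ^ n).
  { intros n k. specialize (H1 k n). specialize (P (n + k)%nat). nra. }
  assert (G : is_lim_seq (fun n => 4 * a * (/ 2) ^ n) 0).
  { replace (Finite 0) with (Rbar_mult (4 * a) 0) by (simpl; f_equal; ring).
    apply is_lim_seq_scal_l, is_lim_seq_geom. rewrite Rabs_pos_eq; lra. }
  assert (E : ex_finite_lim_seq u).
  { apply ex_lim_seq_cauchy_corr. intros eps.
    apply is_lim_seq_spec in G. destruct (G eps) as [N HN].
    exists N. intros n m Hn Hm. specialize (HN N (le_n _)).
    rewrite Rminus_0_r in HN. apply Rabs_lt_between in HN.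
    generalize (H2 N (n - N)%nat) (H2 N (m - N)%nat).
    replace (N + (n - N))%nat with n by lia. replace (N + (m - N))%nat with m by lia.
    intros A B. replace (u n - u m) with ((u n - u N) + - (u m - u N)) by ring.
    eapply Rle_lt_trans; [apply Rabs_triang|]. rewrite Rabs_Ropp. lra. }
  intros n. destruct E as [l Hl]. rewrite (is_lim_seq_unique _ _ Hl). simpl.
  assert (Hl' : is_lim_seq (fun k => Rabs (u n - u (k + n)%nat)) (Rabs (u n - l))).
  { apply (is_lim_seq_abs _ (u n - l)). apply is_lim_seq_minus'; [apply is_lim_seq_const|].
    now apply (is_lim_seq_incr_n u n). }
  apply (is_lim_seq_le _ (fun _ => 2 * a * (/ 2) ^ n) (Rabs (u n - l)) (2 * a * (/ 2) ^ n)) in Hl'; trivial.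
  - intros k. rewrite Rabs_minus_sym, Nat.add_comm. apply H2.
  - apply is_lim_seq_const.
Qed.

Lemma continuous_eps (f : R -> R) (t : R) :
  continuous f t <-> forall eps, 0 < eps -> exists d, 0 < d /\ forall s, Rabs (s - t) < d -> Rabs (f s - f t) < eps.
Proof.
  split.
  - intros H eps He.
    destruct (proj1 (filterlim_locally _ _) H (mkposreal eps He)) as [d Hd].
    exists d; split; [apply cond_pos|]. intros s Hs. apply (Hd s), Hs.
  - intros H. apply filterlim_locally. intros eps.
    destruct (H eps (cond_pos eps)) as [d [Hd Hs]].
    exists (mkposreal d Hd). intros s Hb. apply Hs, Hb.
Qed.

Lemma RInt_minus_bound (f g : R -> R) (a b e : R) :
  (forall t, continuous f t) -> (forall t, continuous g t) ->
  (forall s, Rabs (s - a) <= Rabs (b - a) -> Rabs (f s - g s) <= e) ->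
  Rabs (RInt f a b - RInt g a b) <= Rabs (b - a) * e.
Proof.
  intros Hf Hg H.
  assert (Z : forall a b, a <= b -> (forall s, a <= s <= b -> Rabs (f s - g s) <= e) ->
     Rabs (RInt f a b - RInt g a b) <= (b - a) * e).
  { clear a b H. intros a b Hab H.
    apply (norm_RInt_le_const (V := R_NormedModule) (fun s => f s - g s) a b).
    - exact Hab.
    - exact H.
    - apply (is_RInt_minus (V := R_NormedModule));
      apply (RInt_correct (V := R_CompleteNormedModule)), ex_RInt_cont; trivial. }
  destruct (Rle_dec a b).
  - rewrite (Rabs_pos_eq (b - a)) in * by lra. apply Z; [lra|]. intros s Hs. apply H. rewrite Rabs_pos_eq; lra.
  - rewrite (Rabs_left1 (b - a)) in * by lra.
    assert (S : forall h : R -> R, (forall t, continuous h t) -> RInt h a b = - RInt h b a).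
    { intros h Hh. symmetry. apply (opp_RInt_swap (V := R_CompleteNormedModule)), ex_RInt_cont, Hh. }
    rewrite !S by trivial.
    replace (- RInt f b a - - RInt g b a) with (- (RInt f b a - RInt g b a)) by ring. rewrite Rabs_Ropp.
    replace (- (b - a)) with (a - b) by ring. apply Z; [lra|]. intros s Hs. apply H. rewrite Rabs_left1; lra.
Qed.

Section Picard.
Variables (I : Type) (f : I -> R -> (I -> R) -> R) (t1 : R) (x1 : I -> R).
(** Continuity is asked only along continuous curves, so no topology on [I -> R] is needed. The
    Lipschitz constant may grow with time but not with the state, which excludes blow-up; the bounds
    are uniform in the index because [I] may be infinite. *)
Hypothesis f_cont : forall x : R -> I -> R, (forall i t, continuous (fun s => x s i) t) ->
  forall i t, continuous (fun s => f i s (x s)) t.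
Hypothesis f_lip : forall T, exists K, forall i t x y d, Rabs (t - t1) <= T ->
  (forall j, Rabs (x j - y j) <= d) -> Rabs (f i t x - f i t y) <= K * d.
Hypothesis f_bnd : forall T, exists M, forall i t, Rabs (t - t1) <= T -> Rabs (f i t x1) <= M.

Fixpoint picard_iter (n : nat) : R -> I -> R :=
  match n with
  | O => fun _ => x1
  | S n => fun t i => x1 i + RInt (fun s => f i s (picard_iter n s)) t1 t
  end.

Lemma picard_iter_continuous (n : nat) (i : I) (t : R) : continuous (fun s => picard_iter n s i) t.
Proof.
  revert i t; induction n; intros i t; simpl.
  - apply continuous_const.
  - apply (continuous_plus (fun _ => x1 i)); [apply continuous_const|].
    eapply continuous_of_derive, derive_RInt_cont. intros s; now apply f_cont.
Qed.

Lemma picard_iter_geometric (T : R) : exists B, forall n i t, Rabs (t - t1) <= T ->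
  Rabs (picard_iter (S n) t i - picard_iter n t i) <= B * (/ 2) ^ n.
Proof.
  destruct (f_lip T) as [K0 HK0]. destruct (f_bnd T) as [M0 HM0].
  pose (K := Rabs K0). pose (M := Rabs M0).
  assert (HK : 0 <= K) by apply Rabs_pos. assert (HM : 0 <= M) by apply Rabs_pos.
  (* [M * T] bounds the first increment, and the exponential is the largest value of the weight on
     the interval. *)
  exists (M * T * exp (2 * K * T)). intros n i t Ht.
  assert (HT : 0 <= T) by (generalize (Rabs_pos (t - t1)); lra).
  assert (Hc : 0 <= M * T) by nra.
  cut (Rabs (picard_iter (S n) t i - picard_iter n t i) <= M * T * (/ 2) ^ n * exp (2 * K * Rabs (t - t1))).
  { intros H. eapply Rle_trans; [apply H|].
    rewrite (Rmult_assoc (M * T) (exp _)), (Rmult_comm (exp _)), <- Rmult_assoc.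
    apply Rmult_le_compat_l.
    - apply Rmult_le_pos; [nra|]. apply pow_le; lra.
    - destruct (Req_dec (2 * K * Rabs (t - t1)) (2 * K * T)) as [E|E]; [rewrite E; lra|].
      left; apply exp_increasing. nra. }
  revert i t Ht; induction n; intros i t Ht.
  - simpl. assert (U : forall p q : R, p + q - p = q) by (intros; ring). rewrite U; clear U.
    rewrite <- (Rminus_0_r (RInt _ _ _)).
    assert (Z : RInt (fun _ : R => 0) t1 t = 0)
      by (rewrite (RInt_const (V := R_CompleteNormedModule)); apply Rmult_0_r).
    rewrite <- Z at 1.
    eapply Rle_trans; [apply (RInt_minus_bound _ _ _ _ M)|].
    + intros s. apply (f_cont (fun _ => x1)). intros; apply continuous_const.
    + intros; apply continuous_const.
    + intros s Hs. rewrite Rminus_0_r. eapply Rle_trans; [apply HM0; lra|apply Rle_abs].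
    + assert (1 <= exp (2 * K * Rabs (t - t1))).
      { rewrite <- exp_0. destruct (Req_dec 0 (2 * K * Rabs (t - t1))) as [<-|E]; [lra|].
        left; apply exp_increasing. generalize (Rabs_pos (t - t1)). intros; nra. }
      rewrite Rmult_1_r.
      apply Rle_trans with (M * T); [rewrite Rmult_comm; apply Rmult_le_compat_l; trivial|nra].
  - change (picard_iter (S (S n)) t i) with (x1 i + RInt (fun s => f i s (picard_iter (S n) s)) t1 t).
    change (picard_iter (S n) t i) with (x1 i + RInt (fun s => f i s (picard_iter n s)) t1 t).
    assert (Cn : forall n s, continuous (fun s => f i s (picard_iter n s)) s)
      by (intros; apply f_cont; intros; apply picard_iter_continuous).
    assert (U : forall p q r : R, p + q - (p + r) = q - r) by (intros; ring). rewrite U; clear U.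
    rewrite <- RInt_minus_cont by (intros; apply Cn).
    replace (M * T * (/ 2) ^ S n) with ((M * T * (/ 2) ^ n) / 2) by (simpl; field).
    apply RInt_exp_bound.
    + apply Rmult_le_pos; [nra|]. apply pow_le; lra.
    + intros s. apply (continuous_minus (V := R_NormedModule)); apply Cn.
    + intros s Hs. eapply Rle_trans.
      * apply (HK0 i s _ _ (M * T * (/ 2) ^ n * exp (2 * K * Rabs (s - t1)))); [lra|].
        intros j. apply IHn. lra.
      * rewrite (Rmult_assoc K). apply Rmult_le_compat_r; [|apply Rle_abs].
        apply Rmult_le_pos; [|left; apply exp_pos]. apply Rmult_le_pos; [nra|]. apply pow_le; lra.
Qed.

Lemma pow_half_small (B eps : R) : 0 < eps -> exists n, B * (/ 2) ^ n < eps.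
Proof.
  intros He.
  assert (G : is_lim_seq (fun n => B * (/ 2) ^ n) 0).
  { replace (Finite 0) with (Rbar_mult B 0) by (simpl; f_equal; ring).
    apply is_lim_seq_scal_l, is_lim_seq_geom. rewrite Rabs_pos_eq; lra. }
  apply is_lim_seq_spec in G. destruct (G (mkposreal eps He)) as [N HN].
  exists N. specialize (HN N (le_n _)). rewrite Rminus_0_r in HN. apply Rabs_lt_between in HN. apply HN.
Qed.

Theorem picard_global : exists x : R -> I -> R, (forall i, x t1 i = x1 i) /\
  forall i t, is_derive (fun s => x s i) t (f i t (x t)).
Proof.
  (* [Lim_seq] is total; that it is a genuine limit, locally uniformly in time, is the content of
     [Hx]. *)
  pose (x := fun t i => real (Lim_seq (fun n => picard_iter n t i))).
  assert (Hx : forall T, exists B, forall n i t, Rabs (t - t1) <= T ->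
     Rabs (picard_iter n t i - x t i) <= B * (/ 2) ^ n).
  { intros T. destruct (picard_iter_geometric T) as [B HB]. exists (2 * B).
    intros n i t Ht. unfold x. apply (geometric_limit (fun n => picard_iter n t i)). intros k. now apply HB. }
  assert (Cx : forall i t, continuous (fun s => x s i) t).
  { intros i t. apply continuous_eps. intros eps He.
    destruct (Hx (Rabs (t - t1) + 1)) as [B HB].
    destruct (pow_half_small B (eps / 3) ltac:(lra)) as [n Hn].
    destruct (proj1 (continuous_eps _ _) (picard_iter_continuous n i t) (eps / 3) ltac:(lra)) as [d [Hd Hs]].
    exists (Rmin d 1). split; [apply Rmin_pos; lra|]. intros s Hst.
    assert (Rabs (s - t) < d) by (eapply Rlt_le_trans; [apply Hst|apply Rmin_l]).
    assert (Rabs (s - t) < 1) by (eapply Rlt_le_trans; [apply Hst|apply Rmin_r]).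
    assert (A1 := Hs s H).
    assert (A2 := HB n i t ltac:(lra)).
    assert (A3 : Rabs (picard_iter n s i - x s i) <= B * (/ 2) ^ n).
    { apply HB. replace (s - t1) with ((s - t) + (t - t1)) by ring.
      eapply Rle_trans; [apply Rabs_triang|]. lra. }
    apply Rabs_def2 in A1. apply Rabs_le_between in A2. apply Rabs_le_between in A3.
    apply Rabs_def1; lra. }
  assert (Cf : forall i t, continuous (fun s => f i s (x s)) t) by (now apply f_cont).
  assert (E : forall t i, x t i = x1 i + RInt (fun s => f i s (x s)) t1 t).
  { intros t i.
    destruct (Hx (Rabs (t - t1))) as [B HB]. destruct (f_lip (Rabs (t - t1))) as [K HK].
    apply Rminus_diag_uniq.
    apply Rabs_eq_0, Rle_antisym; [|apply Rabs_pos]. apply le_epsilon. intros eps He. rewrite Rplus_0_l.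
    (* The two summands are the distance from the limit to iterate [n + 1], and the error of the
       integral when the limit is replaced by iterate [n]. *)
    destruct (pow_half_small (B * (/2) + Rabs (t - t1) * (K * B)) eps He) as [n Hn].
    assert (A1 := HB (S n) i t (Rle_refl _)).
    assert (A2 : Rabs (RInt (fun s => f i s (picard_iter n s)) t1 t - RInt (fun s => f i s (x s)) t1 t)
                 <= Rabs (t - t1) * (K * (B * (/ 2) ^ n))).
    { apply RInt_minus_bound; trivial.
      - intros s; apply f_cont; intros; apply picard_iter_continuous.
      - intros s Hs. apply HK; trivial. intros j. now apply HB. }
    simpl in A1. apply Rabs_le_between in A1. apply Rabs_le_between in A2.
    apply Rabs_le. split; lra. }
  exists x. split.
  - intros i. rewrite E, (RInt_point (V := R_CompleteNormedModule)). apply Rplus_0_r.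
  - intros i t. apply (is_derive_ext (fun s => x1 i + RInt (fun s => f i s (x s)) t1 s)).
    + intros s. symmetry. apply E.
    + replace (f i t (x t)) with (plus 0 (f i t (x t))) by apply Rplus_0_l.
      apply (is_derive_plus (fun _ => x1 i)); [apply (is_derive_const (V := R_NormedModule))|].
      apply (derive_RInt_cont (fun s => f i s (x s))), Cf.
Qed.

End Picard.

(** * Complex-valued functions and systems *)

(** Real and imaginary parts are kept apart, so that real monotonicity arguments and real integrals
    apply to each of them. *)
Definition Ccont (f : R -> C) (t : R) : Prop :=
  continuous (fun s => Re (f s)) t /\ continuous (fun s => Im (f s)) t.
Definition Cder (f : R -> C) (t : R) (l : C) : Prop :=
  is_derive (fun s => Re (f s)) t (Re l) /\ is_derive (fun s => Im (f s)) t (Im l).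

Lemma C_ext (z w : C) : Re z = Re w -> Im z = Im w -> z = w.
Proof. destruct z, w; simpl; intros; now subst. Qed.

Lemma is_derive_Rplus (f g : R -> R) t a b :
  is_derive f t a -> is_derive g t b -> is_derive (fun s => f s + g s) t (a + b).
Proof. exact (is_derive_plus f g t a b). Qed.
Lemma is_derive_Rminus (f g : R -> R) t a b :
  is_derive f t a -> is_derive g t b -> is_derive (fun s => f s - g s) t (a - b).
Proof. exact (is_derive_minus f g t a b). Qed.
Lemma is_derive_Ropp (f : R -> R) t a : is_derive f t a -> is_derive (fun s => - f s) t (- a).
Proof. exact (is_derive_opp f t a). Qed.
Lemma is_derive_Rmult (f g : R -> R) t a b :
  is_derive f t a -> is_derive g t b -> is_derive (fun s => f s * g s) t (a * g t + f t * b).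
Proof. intros; apply (is_derive_mult f g); trivial. intros; apply Rmult_comm. Qed.
Lemma is_derive_Rconst (c t : R) : is_derive (fun _ => c) t 0.
Proof. exact (is_derive_const (V := R_NormedModule) c t). Qed.
Lemma is_derive_Rexp (f : R -> R) t a : is_derive f t a -> is_derive (fun s => exp (f s)) t (a * exp (f t)).
Proof. intros H. apply (is_derive_comp exp f t (exp (f t)) a); [apply is_derive_exp|exact H]. Qed.
Lemma is_derive_eq (f : R -> R) t a b : is_derive f t a -> a = b -> is_derive f t b.
Proof. now intros H <-. Qed.

Lemma cont_Rplus (f g : R -> R) t : continuous f t -> continuous g t -> continuous (fun s => f s + g s) t.
Proof. exact (continuous_plus (V := R_NormedModule) f g t). Qed.
Lemma cont_Rminus (f g : R -> R) t : continuous f t -> continuous g t -> continuous (fun s => f s - g s) t.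
Proof. exact (continuous_minus (V := R_NormedModule) f g t). Qed.
Lemma cont_Ropp (f : R -> R) t : continuous f t -> continuous (fun s => - f s) t.
Proof. exact (continuous_opp (V := R_NormedModule) f t). Qed.
Lemma cont_Rmult (f g : R -> R) t : continuous f t -> continuous g t -> continuous (fun s => f s * g s) t.
Proof. exact (continuous_mult (K := R_AbsRing) f g t). Qed.
Lemma cont_Rconst (c t : R) : continuous (fun _ => c) t.
Proof. apply continuous_const. Qed.
Lemma cont_Rcomp (g f : R -> R) t : continuous f t -> continuous g (f t) -> continuous (fun s => g (f s)) t.
Proof. exact (continuous_comp f g t). Qed.
Lemma cont_Rexp (f : R -> R) t : continuous f t -> continuous (fun s => exp (f s)) t.
Proof. intros H; apply (cont_Rcomp exp); trivial. apply continuous_of_derive with (exp (f t)), is_derive_exp. Qed.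
Lemma cont_Rabs (f : R -> R) t : continuous f t -> continuous (fun s => Rabs (f s)) t.
Proof. intros H; apply (cont_Rcomp Rabs); trivial. apply continuous_Rabs. Qed.
Lemma Rmax_abs (a b : R) : Rmax a b = (a + b + Rabs (a - b)) * / 2.
Proof. unfold Rmax; destruct (Rle_dec a b); [rewrite Rabs_left1 by lra|rewrite Rabs_pos_eq by lra]; field. Qed.
Lemma Rmin_abs (a b : R) : Rmin a b = (a + b - Rabs (a - b)) * / 2.
Proof. unfold Rmin; destruct (Rle_dec a b); [rewrite Rabs_left1 by lra|rewrite Rabs_pos_eq by lra]; field. Qed.
Lemma cont_ext (f g : R -> R) t : (forall s, f s = g s) -> continuous f t -> continuous g t.
Proof. exact (fun E => continuous_ext f g t E). Qed.
Lemma cont_Rmax (f g : R -> R) t : continuous f t -> continuous g t -> continuous (fun s => Rmax (f s) (g s)) t.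
Proof.
  intros; apply cont_ext with (fun s => (f s + g s + Rabs (f s - g s)) * / 2); [intros; now rewrite Rmax_abs|].
  auto using cont_Rmult, cont_Rplus, cont_Rminus, cont_Rabs, cont_Rconst.
Qed.
Lemma cont_Rmin (f g : R -> R) t : continuous f t -> continuous g t -> continuous (fun s => Rmin (f s) (g s)) t.
Proof.
  intros; apply cont_ext with (fun s => (f s + g s - Rabs (f s - g s)) * / 2); [intros; now rewrite Rmin_abs|].
  auto using cont_Rmult, cont_Rplus, cont_Rminus, cont_Rabs, cont_Rconst.
Qed.
Lemma cont_Rinv (f : R -> R) t : continuous f t -> f t <> 0 -> continuous (fun s => / f s) t.
Proof. intros H H0. now apply (continuous_Rinv_comp f t). Qed.
Lemma cont_Rsqrt (f : R -> R) t : continuous f t -> continuous (fun s => sqrt (f s)) t.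
Proof. intros H. apply (cont_Rcomp sqrt); trivial. apply continuous_sqrt. Qed.

Create HintDb cont.
#[global] Hint Resolve cont_Rmult cont_Rplus cont_Rminus cont_Ropp cont_Rabs cont_Rconst cont_Rmax cont_Rmin
  cont_Rexp cont_Rsqrt : cont.

Lemma Ccont_plus f g t : Ccont f t -> Ccont g t -> Ccont (fun s => Cplus (f s) (g s)) t.
Proof. intros [] []; split; simpl; auto with cont. Qed.
Lemma Ccont_minus f g t : Ccont f t -> Ccont g t -> Ccont (fun s => Cminus (f s) (g s)) t.
Proof. intros [] []; split; simpl; auto with cont. Qed.
Lemma Ccont_opp f t : Ccont f t -> Ccont (fun s => Copp (f s)) t.
Proof. intros []; split; simpl; auto with cont. Qed.
Lemma Ccont_mult f g t : Ccont f t -> Ccont g t -> Ccont (fun s => Cmult (f s) (g s)) t.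
Proof. intros [] []; split; simpl; auto 6 with cont. Qed.
Lemma Ccont_conj f t : Ccont f t -> Ccont (fun s => Cconj (f s)) t.
Proof. intros []; split; simpl; auto with cont. Qed.
Lemma Ccont_const c t : Ccont (fun _ => c) t.
Proof. split; apply cont_Rconst. Qed.
Lemma Ccont_RtoC f t : continuous f t -> Ccont (fun s => RtoC (f s)) t.
Proof. split; simpl; auto with cont. Qed.
Lemma cont_Re f t : Ccont f t -> continuous (fun s => Re (f s)) t.
Proof. now intros []. Qed.
Lemma cont_Im f t : Ccont f t -> continuous (fun s => Im (f s)) t.
Proof. now intros []. Qed.
Lemma Cmod_sqrt (z : C) : Cmod z = sqrt (Re z * Re z + Im z * Im z).
Proof. unfold Cmod, Re, Im. f_equal. ring. Qed.
Lemma cont_Cmod f t : Ccont f t -> continuous (fun s => Cmod (f s)) t.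
Proof.
  intros []. apply cont_ext with (fun s => sqrt (Re (f s) * Re (f s) + Im (f s) * Im (f s))).
  - intros; now rewrite Cmod_sqrt.
  - auto with cont.
Qed.
#[global] Hint Resolve Ccont_plus Ccont_minus Ccont_opp Ccont_mult Ccont_conj Ccont_const Ccont_RtoC cont_Re cont_Im cont_Cmod : cont.

Lemma Cder_eq f t a b : Cder f t a -> a = b -> Cder f t b.
Proof. now intros H <-. Qed.
Lemma Cder_plus f g t a b : Cder f t a -> Cder g t b -> Cder (fun s => Cplus (f s) (g s)) t (Cplus a b).
Proof. intros [] []; split; simpl; now apply is_derive_Rplus. Qed.
Lemma Cder_minus f g t a b : Cder f t a -> Cder g t b -> Cder (fun s => Cminus (f s) (g s)) t (Cminus a b).
Proof. intros [] []; split; simpl; now apply is_derive_Rminus. Qed.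
Lemma Cder_opp f t a : Cder f t a -> Cder (fun s => Copp (f s)) t (Copp a).
Proof. intros []; split; simpl; now apply is_derive_Ropp. Qed.
Lemma Cder_conj f t a : Cder f t a -> Cder (fun s => Cconj (f s)) t (Cconj a).
Proof. intros []; split; simpl; trivial; now apply is_derive_Ropp. Qed.
Lemma Cder_const c t : Cder (fun _ => c) t (RtoC 0).
Proof. split; apply is_derive_Rconst. Qed.
Lemma Cder_RtoC f t a : is_derive f t a -> Cder (fun s => RtoC (f s)) t (RtoC a).
Proof. split; simpl; trivial. apply is_derive_Rconst. Qed.
Lemma Cder_mult f g t a b : Cder f t a -> Cder g t b ->
  Cder (fun s => Cmult (f s) (g s)) t (Cplus (Cmult a (g t)) (Cmult (f t) b)).
Proof.
  intros [F1 F2] [G1 G2]; split; simpl.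
  - eapply is_derive_eq; [exact (is_derive_Rminus _ _ _ _ _ (is_derive_Rmult _ _ _ _ _ F1 G1) (is_derive_Rmult _ _ _ _ _ F2 G2))|].
    match goal with |- @eq _ ?a ?b => change (@eq R a b) end. cbv beta; unfold Re, Im; ring.
  - eapply is_derive_eq; [exact (is_derive_Rplus _ _ _ _ _ (is_derive_Rmult _ _ _ _ _ F1 G2) (is_derive_Rmult _ _ _ _ _ F2 G1))|].
    match goal with |- @eq _ ?a ?b => change (@eq R a b) end. cbv beta; unfold Re, Im; ring.
Qed.
Lemma Ccont_of_der f t a : Cder f t a -> Ccont f t.
Proof. intros []; split; eapply continuous_of_derive; eassumption. Qed.

Lemma cont_bounded (f : R -> R) (T : R) : (forall t, continuous f t) ->
  exists M, forall t, Rabs t <= T -> Rabs (f t) <= M.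
Proof.
  intros Hf. destruct (Rle_dec 0 T) as [HT|HT].
  2:{ exists 0. intros t Ht. generalize (Rabs_pos t). lra. }
  destruct (continuity_ab_maj (fun t => Rabs (f t)) (- T) T ltac:(lra)) as [m [Hm _]].
  - intros c _. apply continuity_pt_filterlim. apply (cont_Rabs f), Hf.
  - exists (Rabs (f m)). intros t Ht. apply Hm. now apply Rabs_le_between.
Qed.
Lemma Ccont_bounded (f : R -> C) (T : R) : (forall t, Ccont f t) ->
  exists M, forall t, Rabs t <= T -> Cmod (f t) <= M.
Proof.
  intros Hf. destruct (cont_bounded (fun t => Cmod (f t)) T (fun t => cont_Cmod f t (Hf t))) as [M HM].
  exists M. intros t Ht. eapply Rle_trans; [apply Rle_abs|now apply HM].
Qed.

Lemma im_le_Cmod (z : C) : Rabs (Im z) <= Cmod z.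
Proof. rewrite <- sqrt_Rsqr_abs, Cmod_sqrt. apply sqrt_le_1_alt. unfold Rsqr. nra. Qed.
Lemma Cmod_le_parts (z : C) : Cmod z <= Rabs (Re z) + Rabs (Im z).
Proof.
  rewrite Cmod_sqrt, <- (sqrt_square (Rabs (Re z) + Rabs (Im z))).
  - apply sqrt_le_1_alt. generalize (Rabs_pos (Re z)) (Rabs_pos (Im z)).
    rewrite <- (Rsqr_def (Re z)), <- (Rsqr_def (Im z)), (Rsqr_abs (Re z)), (Rsqr_abs (Im z)). unfold Rsqr. nra.
  - generalize (Rabs_pos (Re z)) (Rabs_pos (Im z)); lra.
Qed.

(** Global in the state, local in time: the form required by Picard iteration. A product of unknowns
    is not of this kind, but a product of bounded factors is ([Lip_mult]); the truncations of the
    Riccati equation are made to fit this. *)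
Definition Lip (g : R -> (nat -> C) -> C) : Prop :=
  (forall x, (forall i t, Ccont (fun s => x s i) t) -> forall t, Ccont (fun s => g s (x s)) t) /\
  (forall T, exists K, 0 <= K /\ forall t x y d, Rabs t <= T -> (forall j, Cmod (Cminus (x j) (y j)) <= d) ->
      Cmod (Cminus (g t x) (g t y)) <= K * d).
Definition Bdd (g : R -> (nat -> C) -> C) : Prop :=
  forall T, exists K, 0 <= K /\ forall t x, Rabs t <= T -> Cmod (g t x) <= K.

Lemma dist_nonneg (x y : nat -> C) d : (forall j, Cmod (Cminus (x j) (y j)) <= d) -> 0 <= d.
Proof. intros H; eapply Rle_trans; [apply Cmod_ge_0|apply (H O)]. Qed.

Lemma Lip_coef c : (forall t, Ccont c t) -> Lip (fun t _ => c t).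
Proof.
  intros Hc; split; [intros; apply Hc|]. intros T; exists 0; split; [lra|].
  intros t x y d _ _. replace (Cminus (c t) (c t)) with (RtoC 0) by ring. rewrite Cmod_0. lra.
Qed.
Lemma Lip_proj i : Lip (fun _ x => x i).
Proof. split; [auto|]. intros T; exists 1; split; [lra|]. intros t x y d _ H. rewrite Rmult_1_l; apply H. Qed.
Lemma Lip_plus g h : Lip g -> Lip h -> Lip (fun t x => Cplus (g t x) (h t x)).
Proof.
  intros [G1 G2] [H1 H2]; split; [auto with cont|].
  intros T. destruct (G2 T) as [K1 [P1 L1]], (H2 T) as [K2 [P2 L2]]. exists (K1 + K2); split; [lra|].
  intros t x y d Ht Hd.
  replace (Cminus _ _) with (Cplus (Cminus (g t x) (g t y)) (Cminus (h t x) (h t y))) by ring.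
  eapply Rle_trans; [apply Cmod_triangle|]. generalize (L1 t x y d Ht Hd) (L2 t x y d Ht Hd). lra.
Qed.
Lemma Lip_opp g : Lip g -> Lip (fun t x => Copp (g t x)).
Proof.
  intros [G1 G2]; split; [auto with cont|].
  intros T. destruct (G2 T) as [K1 [P1 L1]]. exists K1; split; [lra|].
  intros t x y d Ht Hd. replace (Cminus _ _) with (Copp (Cminus (g t x) (g t y))) by ring.
  rewrite Cmod_opp. auto.
Qed.
Lemma Lip_minus g h : Lip g -> Lip h -> Lip (fun t x => Cminus (g t x) (h t x)).
Proof. intros; apply Lip_plus; auto using Lip_opp. Qed.
Lemma Lip_scal c g : (forall t, Ccont c t) -> Lip g -> Lip (fun t x => Cmult (c t) (g t x)).
Proof.
  intros Hc [G1 G2]; split; [auto with cont|].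
  intros T. destruct (G2 T) as [K1 [P1 L1]], (Ccont_bounded c T Hc) as [M HM].
  exists (Rabs M * K1); split; [apply Rmult_le_pos; trivial; apply Rabs_pos|].
  intros t x y d Ht Hd. replace (Cminus _ _) with (Cmult (c t) (Cminus (g t x) (g t y))) by ring.
  rewrite Cmod_mult, Rmult_assoc. apply Rmult_le_compat; auto using Cmod_ge_0.
  eapply Rle_trans; [now apply HM|apply Rle_abs].
Qed.
Lemma Lip_ext g h : (forall t x, g t x = h t x) -> Lip g -> Lip h.
Proof.
  intros E [G1 G2]; split.
  - intros x Hx t. destruct (G1 x Hx t) as [A B].
    split; [refine (cont_ext _ _ _ _ A)|refine (cont_ext _ _ _ _ B)]; intros; simpl; now rewrite E.
  - intros T. destruct (G2 T) as [K [P L]]. exists K; split; trivial. intros. rewrite <- !E. auto.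
Qed.
Lemma Lip_scal_r c g : (forall t, Ccont c t) -> Lip g -> Lip (fun t x => Cmult (g t x) (c t)).
Proof. intros Hc Hg. apply Lip_ext with (2 := Lip_scal c g Hc Hg). intros; apply Cmult_comm. Qed.
Lemma Lip_mult g h : Lip g -> Lip h -> Bdd g -> Bdd h -> Lip (fun t x => Cmult (g t x) (h t x)).
Proof.
  intros [G1 G2] [H1 H2] Bg Bh; split; [auto with cont|].
  intros T. destruct (G2 T) as [K1 [P1 L1]], (H2 T) as [K2 [P2 L2]], (Bg T) as [M1 [Q1 B1]], (Bh T) as [M2 [Q2 B2]].
  exists (M1 * K2 + M2 * K1); split; [nra|].
  intros t x y d Ht Hd. assert (D := dist_nonneg _ _ _ Hd).
  replace (Cminus _ _) with (Cplus (Cmult (g t x) (Cminus (h t x) (h t y))) (Cmult (h t y) (Cminus (g t x) (g t y)))) by ring.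
  eapply Rle_trans; [apply Cmod_triangle|]. rewrite !Cmod_mult.
  rewrite Rmult_plus_distr_r, !Rmult_assoc.
  apply Rplus_le_compat; apply Rmult_le_compat; auto using Cmod_ge_0.
Qed.
Lemma Bdd_plus g h : Bdd g -> Bdd h -> Bdd (fun t x => Cplus (g t x) (h t x)).
Proof.
  intros Bg Bh T. destruct (Bg T) as [M1 [Q1 B1]], (Bh T) as [M2 [Q2 B2]]. exists (M1 + M2); split; [nra|].
  intros. eapply Rle_trans; [apply Cmod_triangle|]. apply Rplus_le_compat; auto.
Qed.

(** States live in [nat -> C] with only the first [n] coordinates active. This turns one bound per
    coordinate into a bound uniform in the index, as the iteration demands. *)
Lemma uniform_bound (P : nat -> R -> Prop) (n : nat) :
  (forall i a b, a <= b -> P i a -> P i b) -> (forall i, exists a, 0 <= a /\ P i a) ->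
  (forall i, (n <= i)%nat -> P i 0) -> exists a, 0 <= a /\ forall i, P i a.
Proof.
  intros Hm He Hn.
  assert (X : forall m, exists a, 0 <= a /\ forall i, (i < m)%nat -> P i a).
  { induction m as [|m [a [Ha IH]]]; [exists 0; split; [lra|lia]|].
    destruct (He m) as [b [Hb Pb]]. exists (a + b); split; [lra|]. intros i Hi.
    destruct (Nat.eq_dec i m) as [->|]; [apply Hm with b; trivial; lra|].
    apply Hm with a; [lra|]. apply IH; lia. }
  destruct (X n) as [a [Ha H]]. exists a; split; trivial. intros i.
  destruct (Nat.lt_ge_cases i n); [auto|]. apply Hm with 0; auto.
Qed.

Definition system (n : nat) (f : nat -> R -> (nat -> C) -> C) : Prop :=
  (forall i, Lip (f i)) /\ (forall i t x, (n <= i)%nat -> f i t x = RtoC 0).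

Lemma system_lip n f T : system n f ->
  exists K, 0 <= K /\ forall i t x y d, Rabs t <= T -> (forall j, Cmod (Cminus (x j) (y j)) <= d) ->
      Cmod (Cminus (f i t x) (f i t y)) <= K * d.
Proof.
  intros [H0 Hn].
  apply (uniform_bound (fun i K => forall t x y d, Rabs t <= T -> (forall j, Cmod (Cminus (x j) (y j)) <= d) ->
      Cmod (Cminus (f i t x) (f i t y)) <= K * d) n).
  - intros i a b Hab Ha t x y d Ht Hd. eapply Rle_trans; [now apply Ha|].
    apply Rmult_le_compat_r; trivial. eapply dist_nonneg; eassumption.
  - intros i. apply H0.
  - intros i Hi t x y d Ht Hd. rewrite !Hn by trivial.
    replace (Cminus 0 0) with (RtoC 0) by ring. rewrite Cmod_0; lra.
Qed.

Theorem C_ode n f t1 x1 : system n f -> exists x : R -> nat -> C,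
  (forall i, x t1 i = x1 i) /\ forall i t, Cder (fun s => x s i) t (f i t (x t)).
Proof.
  intros Hf.
  (* Each complex coordinate becomes two real ones, indexed by a boolean; recombining them costs the
     factor 2 in the Lipschitz constant. *)
  pose (cx := fun (y : nat * bool -> R) (j : nat) => (y (j, true), y (j, false)) : C).
  pose (pt := fun (b : bool) (z : C) => if b then Re z else Im z).
  assert (Hpt : forall b z, Rabs (pt b z) <= Cmod z) by (intros []; [apply re_le_Cmod|apply im_le_Cmod]).
  assert (Hpm : forall b z w, pt b (Cminus z w) = pt b z - pt b w) by (now intros []).
  destruct (picard_global (nat * bool) (fun i t y => pt (snd i) (f (fst i) t (cx y))) t1
    (fun i => pt (snd i) (x1 (fst i)))) as [y [Hy Dy]].
  - intros x Hx [i b] t. destruct (proj1 (proj1 Hf i) (fun s => cx (x s))) with t as [A B].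
    + intros j s; split; apply Hx.
    + destruct b; assumption.
  - intros T. destruct (system_lip n f (T + Rabs t1) Hf) as [K [HK H]]. exists (K * 2).
    intros [i b] t u v d Ht Hd. simpl. rewrite <- Hpm.
    eapply Rle_trans; [apply Hpt|]. rewrite Rmult_assoc. apply H.
    + replace t with ((t - t1) + t1) by ring. eapply Rle_trans; [apply Rabs_triang|lra].
    + intros j. eapply Rle_trans; [apply Cmod_le_parts|]. generalize (Hd (j, true)) (Hd (j, false)). simpl.
      unfold Rminus. lra.
  - intros T.
    destruct (uniform_bound (fun i M => forall b t, Rabs (t - t1) <= T -> Rabs (pt b (f i t (cx (fun i => pt (snd i) (x1 (fst i)))))) <= M) n)
      as [M [HM H]].
    + intros i a b Hab Ha c t Ht. eapply Rle_trans; [now apply Ha|lra].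
    + intros i. destruct (Ccont_bounded (fun t => f i t (cx (fun i => pt (snd i) (x1 (fst i))))) (T + Rabs t1)) as [M HM].
      * apply (proj1 (proj1 Hf i) (fun s => cx (fun i => pt (snd i) (x1 (fst i))))). intros; apply Ccont_const.
      * exists (Rabs M); split; [apply Rabs_pos|]. intros b t Ht.
        eapply Rle_trans; [apply Hpt|]. eapply Rle_trans; [|apply Rle_abs]. apply HM.
        replace t with ((t - t1) + t1) by ring. eapply Rle_trans; [apply Rabs_triang|lra].
    + intros i Hi b t Ht. rewrite (proj2 Hf) by trivial. destruct b; simpl; rewrite Rabs_R0; lra.
    + exists M. intros [i b] t Ht. apply H, Ht.
  - exists (fun t => cx (y t)). split.
    + intros i. unfold cx. rewrite !Hy. simpl. now destruct (x1 i).
    + intros i t. split; [apply (Dy (i, true) t)|apply (Dy (i, false) t)].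
Qed.

Lemma exp_bound_of_deriv (w dw : R -> R) (K c a T : R) :
  0 <= c -> a <= T -> w a = 0 -> (forall t, a <= t <= T -> is_derive w t (dw t)) ->
  (forall t, a <= t <= T -> Rabs (dw t) <= K * c * exp (2 * K * (t - a))) ->
  Rabs (w T) <= c / 2 * exp (2 * K * (T - a)).
Proof.
  intros Hc HaT Hw Hd Hb.
  assert (X : forall e, e = 1 \/ e = -1 -> 0 <= c / 2 * exp (2 * K * (T - a)) + e * w T).
  { intros e He.
    assert (Hm := nondecreasing_of_deriv
        (fun s => c / 2 * exp (2 * K * (s - a)) + e * w s)
        (fun s => c / 2 * (2 * K * exp (2 * K * (s - a))) + e * dw s) a T HaT).
    simpl in Hm. rewrite Hw, Rminus_diag, Rmult_0_r, exp_0 in Hm.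
    cut (c / 2 * 1 + e * 0 <= c / 2 * exp (2 * K * (T - a)) + e * w T); [lra|].
    apply Hm.
    - intros s Hs. apply is_derive_Rplus.
      + auto_derive; trivial. unfold Rminus; field.
      + apply is_derive_scal, Hd, Hs.
    - intros s Hs. specialize (Hb s Hs). apply Rabs_le_between in Hb. destruct He; subst; lra. }
  apply Rabs_le. generalize (X 1 (or_introl eq_refl)) (X (-1) (or_intror eq_refl)). lra.
Qed.

(** Each use of the Lipschitz estimate halves the bound on the difference in the weighted norm, so
    it lies below [B / 2^m] times the weight for every [m]. Only times after [t1] enter, since the
    functions compared below satisfy their equations only there. *)
Theorem C_ode_unique n f t1 (x y : R -> nat -> C) : system n f ->
  (forall i, x t1 i = y t1 i) ->
  (forall i t, t1 <= t -> Cder (fun s => x s i) t (f i t (x t))) ->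
  (forall i t, t1 <= t -> Cder (fun s => y s i) t (f i t (y t))) ->
  forall i t, t1 <= t -> x t i = y t i.
Proof.
  intros Hf H0 Dx Dy i0 T HT.
  destruct (system_lip n f (Rabs t1 + Rabs T) Hf) as [K [HK HL]].
  set (w := fun i t => Cminus (x t i) (y t i)).
  assert (Dw : forall i t, t1 <= t -> Cder (w i) t (Cminus (f i t (x t)) (f i t (y t)))).
  { intros. apply Cder_minus; auto. }
  assert (Hr : forall t, t1 <= t <= T -> Rabs t <= Rabs t1 + Rabs T).
  { intros t Ht. unfold Rabs; repeat destruct Rcase_abs; lra. }
  assert (HB : exists B, 0 <= B /\ forall i t, t1 <= t <= T -> Cmod (w i t) <= B).
  { apply (uniform_bound (fun i B => forall t, t1 <= t <= T -> Cmod (w i t) <= B) n).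
    - intros i a b Hab Ha t Ht. eapply Rle_trans; [now apply Ha|trivial].
    - intros i. destruct (continuity_ab_maj (fun t => Cmod (w i t)) t1 T HT) as [m [Hm _]].
      + intros c Hc. apply continuity_pt_filterlim. apply (cont_Cmod (w i)).
        eapply Ccont_of_der, Dw. lra.
      + exists (Cmod (w i m)). split; [apply Cmod_ge_0|auto].
    - intros i Hi t Ht.
      (* Inactive coordinates must be bounded too, because the Lipschitz estimate refers to all
         indices; there the difference has derivative zero. *)
      assert (E : w i t = RtoC 0).
      { assert (Z : forall s, t1 <= s <= t -> Cder (w i) s (RtoC 0)).
        { intros s Hs. eapply Cder_eq; [apply Dw; lra|]. rewrite !(proj2 Hf) by trivial. ring. }
        assert (W0 : w i t1 = RtoC 0) by (unfold w; rewrite H0; ring).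
        apply C_ext; apply Rabs_eq_0, Rle_antisym, Rabs_pos.
        - replace 0 with (0 / 2 * exp (2 * 0 * (t - t1))) by field.
          apply (exp_bound_of_deriv (fun s => Re (w i s)) (fun _ => 0)); try lra.
          + now rewrite W0.
          + intros; now apply (Z t0).
          + intros. rewrite Rabs_R0. lra.
        - replace 0 with (0 / 2 * exp (2 * 0 * (t - t1))) by field.
          apply (exp_bound_of_deriv (fun s => Im (w i s)) (fun _ => 0)); try lra.
          + now rewrite W0.
          + intros; now apply (Z t0).
          + intros. rewrite Rabs_R0. lra. }
      rewrite E, Cmod_0. lra. }
  destruct HB as [B [HB HwB]].
  (* Twice [K], because real and imaginary parts are bounded separately and then added. *)
  set (L := 2 * K).
  assert (X : forall m i t, t1 <= t <= T ->
     Rabs (Re (w i t)) <= B * (/ 2) ^ m * exp (2 * L * (t - t1)) /\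
     Rabs (Im (w i t)) <= B * (/ 2) ^ m * exp (2 * L * (t - t1))).
  { induction m; intros i t Ht.
    - assert (1 <= exp (2 * L * (t - t1))).
      { rewrite <- exp_0. destruct (Req_dec 0 (2 * L * (t - t1))) as [<-|E]; [lra|].
        left; apply exp_increasing. unfold L in *; nra. }
      assert (A := HwB i t Ht).
      generalize (re_le_Cmod (w i t)) (im_le_Cmod (w i t)). simpl. split; nra.
    - replace (B * (/ 2) ^ S m) with ((B * (/ 2) ^ m) / 2) by (simpl; field).
      assert (P : 0 <= B * (/ 2) ^ m) by (apply Rmult_le_pos; trivial; apply pow_le; lra).
      assert (W0 : w i t1 = RtoC 0) by (unfold w; rewrite H0; ring).
      assert (Q : forall s, t1 <= s <= t -> Cmod (Cminus (f i s (x s)) (f i s (y s))) <=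
                 L * (B * (/ 2) ^ m) * exp (2 * L * (s - t1))).
      { intros s Hs. replace (L * (B * (/ 2) ^ m) * exp (2 * L * (s - t1))) with
         (K * (2 * (B * (/ 2) ^ m * exp (2 * L * (s - t1))))) by (unfold L; ring).
        apply HL; [apply Hr; lra|]. intros j. eapply Rle_trans; [apply Cmod_le_parts|].
        destruct (IHm j s ltac:(lra)). unfold w in *. lra. }
      split.
      + apply (exp_bound_of_deriv (fun s => Re (w i s)) (fun s => Re (Cminus (f i s (x s)) (f i s (y s))))); try tauto.
        * now rewrite W0.
        * intros s Hs. apply Dw; lra.
        * intros s Hs. eapply Rle_trans; [apply re_le_Cmod|auto].
      + apply (exp_bound_of_deriv (fun s => Im (w i s)) (fun s => Im (Cminus (f i s (x s)) (f i s (y s))))); try tauto.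
        * now rewrite W0.
        * intros s Hs. apply Dw; lra.
        * intros s Hs. eapply Rle_trans; [apply im_le_Cmod|auto]. }
  assert (Z : w i0 T = RtoC 0).
  { apply Cmod_eq_0, Rle_antisym; [|apply Cmod_ge_0]. apply le_epsilon. intros eps He. rewrite Rplus_0_l.
    destruct (pow_half_small (2 * B * exp (2 * L * (T - t1))) eps He) as [m Hm].
    destruct (X m i0 T ltac:(lra)). eapply Rle_trans; [apply Cmod_le_parts|]. lra. }
  unfold w in Z. replace (x T i0) with (Cplus (Cminus (x T i0) (y T i0)) (y T i0)) by ring. rewrite Z. ring.
Qed.

(** * Matrix-valued functions and systems *)

Definition M2zero : M2 := mkM2 0 0 0 0.
Definition M2one : M2 := mkM2 1 0 0 1.
Definition M2scal (c : C) (X : M2) : M2 :=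
  mkM2 (Cmult c (e11 X)) (Cmult c (e12 X)) (Cmult c (e21 X)) (Cmult c (e22 X)).
Definition M2opp (X : M2) : M2 := mkM2 (Copp (e11 X)) (Copp (e12 X)) (Copp (e21 X)) (Copp (e22 X)).
Definition M2tr (X : M2) : C := Cplus (e11 X) (e22 X).
(** The adjugate: its product with [X], on either side, is [M2det X] times the identity. *)
Definition M2cof (X : M2) : M2 := mkM2 (e22 X) (Copp (e12 X)) (Copp (e21 X)) (e11 X).

Lemma M2_ext (X Y : M2) : e11 X = e11 Y -> e12 X = e12 Y -> e21 X = e21 Y -> e22 X = e22 Y -> X = Y.
Proof. destruct X, Y; simpl; congruence. Qed.

Lemma Cconj_RtoC (r : R) : Cconj (RtoC r) = RtoC r.
Proof. apply C_ext; simpl; ring. Qed.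

Ltac msplit := split; [|split; [|split]].
Ltac m2unfold := cbv [M2zero M2one M2scal M2opp M2tr M2cof M2add M2sub M2mul M2adj M2det e11 e12 e21 e22].
Ltac cconj := rewrite ?Cplus_conj, ?Cminus_conj, ?Copp_conj, ?Cmult_conj, ?Cconj_conj, ?Cconj_RtoC;
  repeat (progress rewrite ?Cplus_conj, ?Cminus_conj, ?Copp_conj, ?Cmult_conj, ?Cconj_conj, ?Cconj_RtoC).
Ltac m2destruct := repeat match goal with X : M2 |- _ => destruct X end.
Ltac m2 := intros; m2destruct; m2unfold; cconj; try (apply M2_ext); cbv [e11 e12 e21 e22]; ring.

Lemma M2mul_assoc X Y Z : M2mul (M2mul X Y) Z = M2mul X (M2mul Y Z).
Proof. m2. Qed.
Lemma M2mul_addl X Y Z : M2mul (M2add X Y) Z = M2add (M2mul X Z) (M2mul Y Z).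
Proof. m2. Qed.
Lemma M2mul_addr X Y Z : M2mul Z (M2add X Y) = M2add (M2mul Z X) (M2mul Z Y).
Proof. m2. Qed.
Lemma M2adj_mul X Y : M2adj (M2mul X Y) = M2mul (M2adj Y) (M2adj X).
Proof. m2. Qed.
Lemma M2adj_add X Y : M2adj (M2add X Y) = M2add (M2adj X) (M2adj Y).
Proof. m2. Qed.
Lemma M2adj_sub X Y : M2adj (M2sub X Y) = M2sub (M2adj X) (M2adj Y).
Proof. m2. Qed.
Lemma M2adj_opp X : M2adj (M2opp X) = M2opp (M2adj X).
Proof. m2. Qed.
Lemma M2adj_adj X : M2adj (M2adj X) = X.
Proof. m2. Qed.
Lemma M2adj_zero : M2adj M2zero = M2zero.
Proof. m2. Qed.
Lemma M2sub_zero X Y : M2sub X Y = M2zero -> X = Y.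
Proof.
  intros H. replace X with (M2add (M2sub X Y) Y) by m2. rewrite H. m2.
Qed.
Definition Mcont (X : R -> M2) (t : R) : Prop :=
  Ccont (fun s => e11 (X s)) t /\ Ccont (fun s => e12 (X s)) t /\
  Ccont (fun s => e21 (X s)) t /\ Ccont (fun s => e22 (X s)) t.
Definition Mder (X : R -> M2) (t : R) (D : M2) : Prop :=
  Cder (fun s => e11 (X s)) t (e11 D) /\ Cder (fun s => e12 (X s)) t (e12 D) /\
  Cder (fun s => e21 (X s)) t (e21 D) /\ Cder (fun s => e22 (X s)) t (e22 D).

Ltac mcont := unfold Mcont; m2unfold; intuition auto 10 with cont.

Lemma Mcont_add X Y t : Mcont X t -> Mcont Y t -> Mcont (fun s => M2add (X s) (Y s)) t.
Proof. mcont. Qed.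
Lemma Mcont_sub X Y t : Mcont X t -> Mcont Y t -> Mcont (fun s => M2sub (X s) (Y s)) t.
Proof. mcont. Qed.
Lemma Mcont_mul X Y t : Mcont X t -> Mcont Y t -> Mcont (fun s => M2mul (X s) (Y s)) t.
Proof. mcont. Qed.
Lemma Mcont_adj X t : Mcont X t -> Mcont (fun s => M2adj (X s)) t.
Proof. mcont. Qed.
Lemma Mcont_opp X t : Mcont X t -> Mcont (fun s => M2opp (X s)) t.
Proof. mcont. Qed.
Lemma Mcont_const X t : Mcont (fun _ => X) t.
Proof. mcont. Qed.
Lemma Mcont_of_der X t D : Mder X t D -> Mcont X t.
Proof. intros [A [B [E F]]]; msplit; eapply Ccont_of_der; eassumption. Qed.
#[global] Hint Resolve Mcont_add Mcont_sub Mcont_mul Mcont_adj Mcont_opp Mcont_const : cont.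

Lemma Mder_eq X t D D' : Mder X t D -> D = D' -> Mder X t D'.
Proof. now intros H <-. Qed.
Lemma Mder_sub X Y t D E : Mder X t D -> Mder Y t E -> Mder (fun s => M2sub (X s) (Y s)) t (M2sub D E).
Proof. intros [? [? [? ?]]] [? [? [? ?]]]; msplit; now apply Cder_minus. Qed.
Lemma Mder_adj X t D : Mder X t D -> Mder (fun s => M2adj (X s)) t (M2adj D).
Proof. intros [? [? [? ?]]]; msplit; now apply Cder_conj. Qed.
Lemma Mder_const X t : Mder (fun _ => X) t M2zero.
Proof. msplit; apply Cder_const. Qed.
Lemma Mder_mul X Y t D E : Mder X t D -> Mder Y t E ->
  Mder (fun s => M2mul (X s) (Y s)) t (M2add (M2mul D (Y t)) (M2mul (X t) E)).
Proof.
  intros [? [? [? ?]]] [? [? [? ?]]].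
  msplit; (eapply Cder_eq; [apply Cder_plus; apply Cder_mult; eassumption|]); m2unfold; destruct D, E, (X t), (Y t); ring.
Qed.
Lemma Mder_det X t D : Mder X t D -> Cder (fun s => M2det (X s)) t (M2tr (M2mul (M2cof (X t)) D)).
Proof.
  intros [? [? [? ?]]].
  eapply Cder_eq; [apply Cder_minus; apply Cder_mult; eassumption|]. m2unfold; destruct D, (X t); ring.
Qed.
Lemma Mder_tr X t D : Mder X t D -> Cder (fun s => M2tr (X s)) t (M2tr D).
Proof. intros [? [? [? ?]]]. now apply Cder_plus. Qed.
Lemma Mder_cof X t D : Mder X t D -> Mder (fun s => M2cof (X s)) t (M2cof D).
Proof. intros [? [? [? ?]]]. msplit; try assumption; now apply Cder_opp. Qed.
Lemma Mder_scal c X t a D : Cder c t a -> Mder X t D ->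
  Mder (fun s => M2scal (c s) (X s)) t (M2add (M2scal a (X t)) (M2scal (c t) D)).
Proof. intros ? [? [? [? ?]]]. msplit; now apply Cder_mult. Qed.

Definition LipM (G : R -> (nat -> C) -> M2) : Prop :=
  Lip (fun t x => e11 (G t x)) /\ Lip (fun t x => e12 (G t x)) /\
  Lip (fun t x => e21 (G t x)) /\ Lip (fun t x => e22 (G t x)).
Definition blk (k : nat) (x : nat -> C) : M2 := mkM2 (x k) (x (S k)) (x (S (S k))) (x (S (S (S k)))).

Lemma LipM_blk k : LipM (fun _ => blk k).
Proof. msplit; cbv [blk e11 e12 e21 e22]; apply Lip_proj. Qed.
Lemma LipM_coef M : (forall t, Mcont M t) -> LipM (fun t _ => M t).
Proof.
  intros H; msplit; apply (Lip_coef (fun t => _ (M t))); intros t; apply (H t).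
Qed.
Lemma LipM_add G H : LipM G -> LipM H -> LipM (fun t x => M2add (G t x) (H t x)).
Proof. intros [? [? [? ?]]] [? [? [? ?]]]. msplit; now apply Lip_plus. Qed.
Lemma LipM_sub G H : LipM G -> LipM H -> LipM (fun t x => M2sub (G t x) (H t x)).
Proof. intros [? [? [? ?]]] [? [? [? ?]]]. msplit; now apply Lip_minus. Qed.
Lemma LipM_opp G : LipM G -> LipM (fun t x => M2opp (G t x)).
Proof. intros [? [? [? ?]]]. msplit; now apply Lip_opp. Qed.
Lemma LipM_mul_l M G : (forall t, Mcont M t) -> LipM G -> LipM (fun t x => M2mul (M t) (G t x)).
Proof.
  intros HM [? [? [? ?]]]. msplit; apply Lip_plus; (apply Lip_scal; [intros t; apply (HM t)|trivial]).
Qed.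
Lemma LipM_mul_r M G : (forall t, Mcont M t) -> LipM G -> LipM (fun t x => M2mul (G t x) (M t)).
Proof.
  intros HM [? [? [? ?]]]. msplit; apply Lip_plus; (apply Lip_scal_r; [intros t; apply (HM t)|trivial]).
Qed.
#[global] Hint Resolve LipM_blk LipM_coef LipM_add LipM_sub LipM_opp LipM_mul_l LipM_mul_r : cont.

Definition pack (X Y : M2) (i : nat) : C :=
  match i with
  | 0 => e11 X | 1 => e12 X | 2 => e21 X | 3 => e22 X
  | 4 => e11 Y | 5 => e12 Y | 6 => e21 Y | 7 => e22 Y
  | _ => RtoC 0%R
  end%nat.

Lemma pack_blk X Y : blk 0 (pack X Y) = X /\ blk 4 (pack X Y) = Y.
Proof. destruct X, Y; split; reflexivity. Qed.

Definition LipM2 (F : R -> M2 -> M2 -> M2) : Prop := LipM (fun t x => F t (blk 0 x) (blk 4 x)).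

Lemma pack_system (F G : R -> M2 -> M2 -> M2) : LipM2 F -> LipM2 G ->
  system 8 (fun i t x => pack (F t (blk 0 x) (blk 4 x)) (G t (blk 0 x) (blk 4 x)) i).
Proof.
  intros [? [? [? ?]]] [? [? [? ?]]]. split.
  - intros i. do 8 (destruct i as [|i]; [assumption|]). exact (Lip_coef (fun _ => RtoC 0) (fun t => Ccont_const _ t)).
  - intros i t x Hi. do 8 (destruct i as [|i]; [lia|]). reflexivity.
Qed.

Theorem M2_ode (F G : R -> M2 -> M2 -> M2) (t1 : R) (X1 Y1 : M2) : LipM2 F -> LipM2 G ->
  exists X Y : R -> M2, X t1 = X1 /\ Y t1 = Y1 /\
    (forall t, Mder X t (F t (X t) (Y t))) /\ (forall t, Mder Y t (G t (X t) (Y t))).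
Proof.
  intros HF HG. destruct (C_ode 8 _ t1 (pack X1 Y1) (pack_system F G HF HG)) as [x [H0 Hd]].
  exists (fun t => blk 0 (x t)), (fun t => blk 4 (x t)). msplit.
  - unfold blk. rewrite !H0. now destruct X1.
  - unfold blk. rewrite !H0. now destruct Y1.
  - intros t. msplit; [apply (Hd 0%nat t)|apply (Hd 1%nat t)|apply (Hd 2%nat t)|apply (Hd 3%nat t)].
  - intros t. msplit; [apply (Hd 4%nat t)|apply (Hd 5%nat t)|apply (Hd 6%nat t)|apply (Hd 7%nat t)].
Qed.

Lemma M2_ode_single (F : R -> M2 -> M2) (t1 : R) (X1 : M2) : LipM (fun t x => F t (blk 0 x)) ->
  exists X : R -> M2, X t1 = X1 /\ forall t, Mder X t (F t (X t)).
Proof.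
  intros HF. destruct (M2_ode (fun t X _ => F t X) (fun _ _ _ => M2zero) t1 X1 M2zero) as [X [Y [H0 [_ [H _]]]]].
  - exact HF.
  - apply (LipM_coef (fun _ => M2zero)). auto with cont.
  - now exists X.
Qed.

(** The standard tool for matrix identities along solutions below: both sides solve the same
    equation and agree at [t1]. *)
Lemma M2_ode_unique (F : R -> M2 -> M2) (t1 : R) (X Y : R -> M2) : LipM (fun t x => F t (blk 0 x)) ->
  X t1 = Y t1 -> (forall t, t1 <= t -> Mder X t (F t (X t))) -> (forall t, t1 <= t -> Mder Y t (F t (Y t))) ->
  forall t, t1 <= t -> X t = Y t.
Proof.
  intros HF H0 DX DY.
  assert (HG : LipM2 (fun _ _ _ => M2zero)) by (apply (LipM_coef (fun _ => M2zero)); auto with cont).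
  assert (E := C_ode_unique 8 _ t1 (fun t => pack (X t) M2zero) (fun t => pack (Y t) M2zero)
     (pack_system (fun t X _ => F t X) (fun _ _ _ => M2zero) HF HG)).
  simpl in E.
  assert (P : forall Z : R -> M2, (forall t, t1 <= t -> Mder Z t (F t (Z t))) -> forall i t, t1 <= t ->
    Cder (fun s => pack (Z s) M2zero i) t (pack (F t (blk 0 (pack (Z t) M2zero))) M2zero i)).
  { intros Z HZ i t Ht. rewrite (proj1 (pack_blk _ _)). destruct (HZ t Ht) as [? [? [? ?]]].
    do 4 (destruct i as [|i]; [assumption|]).
    do 4 (destruct i as [|i]; [exact (Cder_const (RtoC 0) t)|]). exact (Cder_const (RtoC 0) t). }
  intros t Ht. specialize (E (fun i => f_equal (fun Z => pack Z M2zero i) H0) (P X DX) (P Y DY)).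
  apply M2_ext; [apply (E 0%nat t Ht)|apply (E 1%nat t Ht)|apply (E 2%nat t Ht)|apply (E 3%nat t Ht)].
Qed.

Lemma C_linear_ode_zero (m x : R -> C) (t1 : R) : (forall t, Ccont m t) -> x t1 = RtoC 0 ->
  (forall t, t1 <= t -> Cder x t (Cmult (m t) (x t))) -> forall t, t1 <= t -> x t = RtoC 0.
Proof.
  intros Hm H0 Hd t Ht.
  assert (E := C_ode_unique 1 (fun i t x => match i with O => Cmult (m t) (x O) | _ => RtoC 0 end) t1
    (fun t i => match i with O => x t | _ => RtoC 0 end) (fun _ _ => RtoC 0)).
  apply (E) with (i := O); trivial.
  - split.
    + intros [|i]; [apply Lip_scal; trivial; apply (Lip_proj O)|exact (Lip_coef (fun _ => RtoC 0) (fun t => Ccont_const _ t))].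
    + intros [|i] s y Hi; [lia|reflexivity].
  - now intros [|i].
  - intros [|i] s Hs; [now apply Hd|exact (Cder_const (RtoC 0) s)].
  - intros [|i] s Hs; [|exact (Cder_const (RtoC 0) s)]. eapply Cder_eq; [apply Cder_const|]. ring.
Qed.

(** The product of [x] with the solution of [y' = - m y], [y t1 = 1], is constant and equal to
    [x t1], so [x] cannot reach zero. *)
Lemma C_linear_ode_nonzero (m x : R -> C) (t1 : R) : (forall t, Ccont m t) -> x t1 <> RtoC 0 ->
  (forall t, t1 <= t -> Cder x t (Cmult (m t) (x t))) -> forall t, t1 <= t -> x t <> RtoC 0.
Proof.
  intros Hm H0 Hd t Ht.
  destruct (C_ode 1 (fun i t x => match i with O => Cmult (Copp (m t)) (x O) | _ => RtoC 0 end) t1 (fun _ => RtoC 1))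
    as [y [Y0 Dy]].
  { split.
    + intros [|i]; [apply (Lip_scal (fun t => Copp (m t))); auto with cont; apply (Lip_proj O)|exact (Lip_coef (fun _ => RtoC 0) (fun t => Ccont_const _ t))].
    + intros [|i] s y Hi; [lia|reflexivity]. }
  assert (D : forall s, t1 <= s -> Cder (fun s => Cminus (Cmult (y s O) (x s)) (x t1)) s
     (Cmult (RtoC 0) (Cminus (Cmult (y s O) (x s)) (x t1)))).
  { intros s Hs. eapply Cder_eq; [apply Cder_minus; [apply Cder_mult; [apply (Dy O)|apply Hd, Hs]|apply Cder_const]|].
    simpl. ring. }
  assert (D0 : Cminus (Cmult (y t1 O) (x t1)) (x t1) = RtoC 0) by (rewrite Y0; ring).
  assert (E := C_linear_ode_zero (fun _ => RtoC 0) _ t1 (fun t => Ccont_const _ t) D0 D t Ht).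
  simpl in E. intros X0. rewrite X0 in E. apply H0.
  replace (x t1) with (Cminus (Cmult (y t O) (RtoC 0)) (Cminus (Cmult (y t O) 0) (x t1))) by ring.
  rewrite E. ring.
Qed.

(** * From the Riccati equation to a conjoined solution *)

(** Freezing the value to the left of [a] turns a coefficient controlled only on a half-line into
    one admissible for the existence theorem on all of [R]. *)
Lemma clamp_continuous (f : R -> R) (a : R) : (forall t, a <= t -> continuous f t) ->
  forall t, continuous (fun s => f (Rmax a s)) t.
Proof.
  intros H t. apply (cont_Rcomp f (Rmax a)); [|apply H, Rmax_l].
  apply (cont_Rmax (fun _ => a) (fun s => s)); [apply cont_Rconst|apply continuous_id].
Qed.
Lemma clamp_Ccont (f : R -> C) (a : R) : (forall t, a <= t -> Ccont f t) ->
  forall t, Ccont (fun s => f (Rmax a s)) t.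
Proof.
  intros H t. exact (conj (clamp_continuous (fun s => Re (f s)) a (fun s Hs => proj1 (H s Hs)) t)
    (clamp_continuous (fun s => Im (f s)) a (fun s Hs => proj2 (H s Hs)) t)).
Qed.
Lemma clamp_Mcont (X : R -> M2) (a : R) : (forall t, a <= t -> Mcont X t) ->
  forall t, Mcont (fun s => X (Rmax a s)) t.
Proof.
  intros H t. msplit.
  - exact (clamp_Ccont (fun s => e11 (X s)) a (fun s Hs => proj1 (H s Hs)) t).
  - exact (clamp_Ccont (fun s => e12 (X s)) a (fun s Hs => proj1 (proj2 (H s Hs))) t).
  - exact (clamp_Ccont (fun s => e21 (X s)) a (fun s Hs => proj1 (proj2 (proj2 (H s Hs)))) t).
  - exact (clamp_Ccont (fun s => e22 (X s)) a (fun s Hs => proj2 (proj2 (proj2 (H s Hs)))) t).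
Qed.

Lemma deriv_zero_const (f : R -> R) (a b : R) : a <= b -> (forall t, a <= t <= b -> is_derive f t 0) -> f a = f b.
Proof.
  intros Hab H. apply Rle_antisym.
  - apply (nondecreasing_of_deriv f (fun _ => 0)); trivial; intros; lra.
  - apply Ropp_le_cancel. apply (nondecreasing_of_deriv (fun s => - f s) (fun _ => 0)); trivial; [|intros; lra].
    intros t Ht. eapply is_derive_eq; [now apply is_derive_Ropp, H|lra].
Qed.
Lemma Cder_zero_const (f : R -> C) (a b : R) : a <= b -> (forall t, a <= t <= b -> Cder f t 0) -> f a = f b.
Proof.
  intros Hab H. apply C_ext; [apply (deriv_zero_const (fun s => Re (f s)))|apply (deriv_zero_const (fun s => Im (f s)))];
  trivial; intros; now apply H.
Qed.
Lemma Mder_zero_const (X : R -> M2) (a b : R) : a <= b -> (forall t, a <= t <= b -> Mder X t M2zero) -> X a = X b.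
Proof.
  intros Hab H. apply M2_ext; [apply (Cder_zero_const (fun s => e11 (X s)))|apply (Cder_zero_const (fun s => e12 (X s)))
    |apply (Cder_zero_const (fun s => e21 (X s)))|apply (Cder_zero_const (fun s => e22 (X s)))];
  trivial; intros; now apply H.
Qed.

Definition ric (P Q Z : M2) : M2 :=
  M2add (M2opp (M2add (M2add (M2mul Z Z) (M2mul (M2adj P) Z)) (M2mul Z P))) Q.

Ltac madj := rewrite ?M2adj_add, ?M2adj_sub, ?M2adj_opp, ?M2adj_mul, ?M2adj_adj;
  repeat (progress rewrite ?M2adj_add, ?M2adj_sub, ?M2adj_opp, ?M2adj_mul, ?M2adj_adj).

(* With [L = S Y] the matrix Riccati equation for [Y] splits into two linear ones, once [Z = S Y S] is known;
   both are solvable globally, which recovers [Y] even where [S] is singular. *)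
Theorem conjoined_of_riccati (t0 t1 : R) (A Cm P S Z : R -> M2) (Y1 : M2) :
  t0 <= t1 ->
  (forall t, Mcont A t) -> (forall t, Mcont Cm t) -> (forall t, Mcont P t) -> (forall t, Mcont S t) ->
  (forall t, t0 <= t -> M2adj (Cm t) = Cm t) -> (forall t, t0 <= t -> M2adj (S t) = S t) ->
  (forall t, t0 <= t -> Mder S t (M2sub (M2mul (A t) (S t)) (M2mul (S t) (P t)))) ->
  (forall t, t0 <= t -> M2sub (M2mul (A t) (S t)) (M2mul (S t) (P t)) =
     M2sub (M2mul (S t) (M2adj (A t))) (M2mul (M2adj (P t)) (S t))) ->
  (forall t, t1 <= t -> M2adj (Z t) = Z t) ->
  (forall t, t1 <= t -> Mder Z t (ric (P t) (M2mul (S t) (M2mul (Cm t) (S t))) (Z t))) ->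
  M2adj Y1 = Y1 -> Z t1 = M2mul (S t1) (M2mul Y1 (S t1)) ->
  exists Phi Psi : R -> M2,
    (forall t, Mder Phi t (M2add (M2mul (A t) (Phi t)) (M2mul (M2mul (S t) (S t)) (Psi t)))) /\
    (forall t, Mder Psi t (M2sub (M2mul (Cm t) (Phi t)) (M2mul (M2adj (A t)) (Psi t)))) /\
    (forall t, t0 <= t -> M2mul (M2adj (Phi t)) (Psi t) = M2mul (M2adj (Psi t)) (Phi t)) /\
    (forall t, t1 <= t -> M2det (Phi t) <> RtoC 0).
Proof.
  intros H01 cA cC cP cS hC hS dS dS' hZ dZ hY1 Z1.
  set (Zc := fun t => Z (Rmax t1 t)).
  assert (cZ : forall t, Mcont Zc t).
  { apply clamp_Mcont. intros t Ht. eapply Mcont_of_der, dZ, Ht. }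
  assert (eZ : forall t, t1 <= t -> Zc t = Z t) by (intros t Ht; unfold Zc; now rewrite Rmax_right).
  (* This is the equation of [L = S Y]: with [S' = S A* - P* S] the terms in [S A* Y] cancel, and
     the quadratic term [S Y S S Y] is [Z L], linear in [L]. *)
  destruct (M2_ode_single (fun t X => M2add (M2sub (M2opp (M2mul (M2add (M2adj (P t)) (Zc t)) X)) (M2mul X (A t)))
     (M2mul (S t) (Cm t))) t1 (M2mul (S t1) Y1)) as [L [L1 dL]].
  { auto 12 with cont. }
  assert (cL : forall t, Mcont L t) by (intros t; eapply Mcont_of_der, dL).
  assert (LS : forall t, t1 <= t -> M2mul (L t) (S t) = Z t).
  { apply (M2_ode_unique (fun t X => M2add (M2sub (M2opp (M2mul (M2add (M2adj (P t)) (Zc t)) X)) (M2mul X (P t)))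
       (M2mul (S t) (M2mul (Cm t) (S t))))).
    - auto 12 with cont.
    - rewrite L1, Z1. m2.
    - intros t Ht. eapply Mder_eq; [apply Mder_mul; [apply dL|apply dS; lra]|].
      generalize (A t) (Cm t) (P t) (S t) (Zc t) (L t). m2.
    - intros t Ht. eapply Mder_eq; [now apply dZ|]. rewrite eZ by trivial.
      unfold ric. generalize (Cm t) (P t) (S t) (Z t). m2. }
  (* The Riccati equation of [Y], with [Y B Y] replaced by the known matrix [L* L]. *)
  destruct (M2_ode_single (fun t X => M2add (M2sub (M2opp (M2mul (M2adj (A t)) X)) (M2mul X (A t)))
     (M2sub (Cm t) (M2mul (M2adj (L t)) (L t)))) t1 Y1) as [Y [Y1e dY]].
  { auto 12 with cont. }
  assert (cY : forall t, Mcont Y t) by (intros t; eapply Mcont_of_der, dY).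
  assert (hY : forall t, t1 <= t -> M2adj (Y t) = Y t).
  { apply (M2_ode_unique (fun t X => M2add (M2sub (M2opp (M2mul (M2adj (A t)) X)) (M2mul X (A t)))
     (M2sub (Cm t) (M2mul (M2adj (L t)) (L t))))).
    - auto 12 with cont.
    - now rewrite Y1e.
    - intros t Ht. eapply Mder_eq; [apply Mder_adj, dY|]. madj. rewrite hC by lra.
      generalize (Cm t) (A t) (L t) (Y t). m2.
    - intros; apply dY. }
  assert (SY : forall t, t1 <= t -> M2mul (S t) (Y t) = L t).
  { apply (M2_ode_unique (fun t X => M2add (M2sub (M2opp (M2mul (M2adj (P t)) X)) (M2mul X (A t)))
     (M2sub (M2mul (S t) (Cm t)) (M2mul (Zc t) (L t))))).
    - auto 12 with cont.
    - now rewrite L1, Y1e.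
    - intros t Ht. eapply Mder_eq; [apply Mder_mul; [apply dS; lra|apply dY]|].
      rewrite dS', eZ by lra. rewrite <- hZ, <- LS by trivial. madj. rewrite (hS t) by lra.
      generalize (A t) (Cm t) (P t) (S t) (L t) (Y t). m2.
    - intros t Ht. eapply Mder_eq; [apply dL|].
      generalize (A t) (Cm t) (P t) (S t) (L t) (Zc t). m2. }
  destruct (M2_ode (fun t X Y => M2add (M2mul (A t) X) (M2mul (M2mul (S t) (S t)) Y))
    (fun t X Y => M2sub (M2mul (Cm t) X) (M2mul (M2adj (A t)) Y)) t1 M2one Y1) as [Phi [Psi [Phi1 [Psi1 [dPhi dPsi]]]]].
  { unfold LipM2. auto 12 with cont. }
  { unfold LipM2. auto 12 with cont. }
  (* The defect [Psi - Y Phi] solves a homogeneous linear equation and vanishes at [t1], where [Phi]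
     is the identity and [Psi] is [Y1]. *)
  assert (E : forall t, t1 <= t -> M2sub (Psi t) (M2mul (Y t) (Phi t)) = M2zero).
  { apply (M2_ode_unique (fun t X => M2opp (M2mul (M2add (M2adj (A t)) (M2mul (Y t) (M2mul (S t) (S t)))) X)) t1
      (fun t => M2sub (Psi t) (M2mul (Y t) (Phi t))) (fun _ => M2zero)).
    - auto 12 with cont.
    - rewrite Phi1, Psi1, Y1e. m2.
    - intros t Ht. eapply Mder_eq; [apply Mder_sub; [apply dPsi|apply Mder_mul; [apply dY|apply dPhi]]|].
      rewrite <- SY by trivial. madj. rewrite hY, hS by lra.
      generalize (A t) (Cm t) (S t) (Y t) (Phi t) (Psi t). m2.
    - intros t Ht. eapply Mder_eq; [apply Mder_const|]. generalize (M2add (M2adj (A t)) (M2mul (Y t) (M2mul (S t) (S t)))). m2. }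
  exists Phi, Psi. split; [exact dPhi|split; [exact dPsi|split]].
  (* [W] is constant, so its vanishing at [t1] carries over both forward and back to [t0], as
     conjoinedness on the whole half-line requires. *)
  - set (W := fun t => M2sub (M2mul (M2adj (Phi t)) (Psi t)) (M2mul (M2adj (Psi t)) (Phi t))).
    assert (dW : forall t, t0 <= t -> Mder W t M2zero).
    { intros t Ht. eapply Mder_eq;
        [exact (Mder_sub _ _ t _ _ (Mder_mul _ _ t _ _ (Mder_adj _ t _ (dPhi t)) (dPsi t))
                                   (Mder_mul _ _ t _ _ (Mder_adj _ t _ (dPsi t)) (dPhi t)))|].
      madj. rewrite hS, hC by trivial. generalize (A t) (Cm t) (S t) (Phi t) (Psi t). m2. }
    assert (W1 : W t1 = M2zero).
    { unfold W. rewrite Phi1, Psi1, hY1. m2. }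
    intros t Ht. apply M2sub_zero. change (W t = M2zero). rewrite <- W1.
    destruct (Rle_dec t t1).
    + apply Mder_zero_const; trivial. intros; apply dW; lra.
    + symmetry. apply Mder_zero_const; [lra|]. intros; apply dW; lra.
  (* Liouville's formula for [Phi' = (A + B Y) Phi], valid after [t1]. *)
  - apply (C_linear_ode_nonzero (fun t => M2tr (M2add (A t) (M2mul (M2mul (S t) (S t)) (Y t))))).
    + intros t. generalize (cA t) (cS t) (cY t). mcont.
    + rewrite Phi1. m2unfold. intros X. apply (f_equal Re) in X. simpl in X. lra.
    + intros t Ht. eapply Cder_eq; [apply (Mder_det Phi), dPhi|].
      rewrite (M2sub_zero _ _ (E t Ht)). generalize (A t) (S t) (Y t) (Phi t). m2.
Qed.

(** * Singular square roots *)

Ltac req := match goal with |- @eq _ ?a ?b => change (@eq R a b) end; cbv beta.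

Lemma C_real (z : C) : Cconj z = z -> z = RtoC (Re z).
Proof. intros H. apply C_ext; simpl; trivial. apply (f_equal Im) in H. simpl in H. unfold Im in *. lra. Qed.
Lemma M2tr_mulC X Y : M2tr (M2mul X Y) = M2tr (M2mul Y X).
Proof. m2. Qed.
Lemma M2tr_adj X : M2tr (M2adj X) = Cconj (M2tr X).
Proof. m2. Qed.
Lemma M2det_adj X : M2det (M2adj X) = Cconj (M2det X).
Proof. m2. Qed.
Lemma M2cof_adj X : M2adj (M2cof X) = M2cof (M2adj X).
Proof. m2. Qed.
Lemma M2adj_scal c X : M2adj (M2scal c X) = M2scal (Cconj c) (M2adj X).
Proof. m2. Qed.
Lemma M2_cayley X : M2mul X X = M2sub (M2scal (M2tr X) X) (M2scal (M2det X) M2one).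
Proof. m2. Qed.
(** Cayley-Hamilton for [S X] with one factor [X] cancelled. For singular [S] it says that [S X S]
    is a scalar multiple of [S], which reduces the rank-one case to scalar equations. *)
Lemma M2_sandwich S X : M2mul S (M2mul X S) = M2sub (M2scal (M2tr (M2mul S X)) S) (M2scal (M2det S) (M2cof X)).
Proof. m2. Qed.

Lemma M2_cayley0 S : M2det S = RtoC 0 -> M2mul S S = M2scal (M2tr S) S.
Proof. intros H. rewrite M2_cayley, H. m2. Qed.
Lemma M2_sandwich0 S X : M2det S = RtoC 0 -> M2mul S (M2mul X S) = M2scal (M2tr (M2mul S X)) S.
Proof. intros H. rewrite M2_sandwich, H. m2. Qed.

Lemma M2_inverse X : M2det X <> RtoC 0 ->
  M2mul X (M2scal (Cinv (M2det X)) (M2cof X)) = M2one /\ M2mul (M2scal (Cinv (M2det X)) (M2cof X)) X = M2one.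
Proof.
  intros H.
  assert (E : Cmult (Cinv (M2det X)) (M2det X) = 1) by (rewrite Cmult_comm; now apply Cinv_r).
  split; (transitivity (M2scal (Cmult (Cinv (M2det X)) (M2det X)) M2one); [|rewrite E; m2]);
  generalize (Cinv (M2det X)); clear; m2.
Qed.

Lemma det_ric_deriv P S Z q :
  M2tr (M2mul (M2cof Z) (ric P (M2scal q S) Z)) =
  Cplus (Cmult (M2det Z) (Copp (Cplus (M2tr Z) (Cplus (M2tr P) (Cconj (M2tr P))))))
        (Cmult q (M2tr (M2mul (M2cof S) Z))).
Proof. unfold ric. m2. Qed.

(** The same scalar [tr Z + 2 Re tr P] damps both [det Z] ([det_ric_deriv]) and [d = tr (cof S Z)].
    It therefore cancels in the quotient [det Z / d], which is left with a closed scalar Riccati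
    equation. *)
Lemma cof_ric_deriv P S Z r q : M2det S = RtoC 0 ->
  Cplus (M2tr (M2mul (M2cof (M2add (M2opp (M2add (M2mul (M2adj P) S) (M2mul S P))) (M2scal r S))) Z))
        (M2tr (M2mul (M2cof S) (ric P (M2scal q S) Z))) =
  Cplus (Cmult (Cminus r (Cplus (M2tr Z) (Cplus (M2tr P) (Cconj (M2tr P))))) (M2tr (M2mul (M2cof S) Z)))
        (Cmult (M2det Z) (M2tr S)).
Proof.
  intros H.
  transitivity (Cplus (Cplus (Cmult (Cminus r (Cplus (M2tr Z) (Cplus (M2tr P) (Cconj (M2tr P))))) (M2tr (M2mul (M2cof S) Z)))
        (Cmult (M2det Z) (M2tr S))) (Cmult (Cmult 2 q) (M2det S))).
  - clear H. unfold ric. m2.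
  - rewrite H. ring.
Qed.

(** The left side is the squared Frobenius norm of [Z cof S]. So the part of the derivative of [d]
    not proportional to [d] itself has a sign, and its vanishing forces [Z] to annihilate the range
    of [cof S]. *)
Lemma gram_trace S Z : M2det S = RtoC 0 -> M2adj S = S -> M2adj Z = Z ->
  M2tr (M2mul (M2adj (M2mul Z (M2cof S))) (M2mul Z (M2cof S))) =
  Cmult (M2tr S) (Cminus (Cmult (M2tr Z) (M2tr (M2mul (M2cof S) Z))) (Cmult (M2det Z) (M2tr S))).
Proof.
  intros H hS hZ. rewrite M2adj_mul, M2cof_adj, hS, hZ.
  transitivity (Cminus (Cmult (M2tr S) (Cminus (Cmult (M2tr Z) (M2tr (M2mul (M2cof S) Z))) (Cmult (M2det Z) (M2tr S))))
    (Cmult (M2det S) (M2tr (M2mul Z Z)))).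
  - clear H hS hZ. m2.
  - rewrite H. ring.
Qed.

Lemma gram_trace_nonneg X : 0 <= Re (M2tr (M2mul (M2adj X) X)) /\
  (Re (M2tr (M2mul (M2adj X) X)) = 0 -> X = M2zero).
Proof.
  destruct X as [[a a'] [b b'] [c c'] [d d']]. m2unfold. simpl.
  split; [nra|]. intros H.
  assert (a = 0 /\ a' = 0 /\ b = 0 /\ b' = 0 /\ c = 0 /\ c' = 0 /\ d = 0 /\ d' = 0) as [-> [-> [-> [-> [-> [-> [-> ->]]]]]]].
  { repeat split; nra. }
  reflexivity.
Qed.

Lemma herm_nilpotent_zero S : M2adj S = S -> M2det S = RtoC 0 -> M2tr S = RtoC 0 -> S = M2zero.
Proof.
  intros hS H0 H1. apply gram_trace_nonneg. rewrite hS, M2_cayley0, H1 by trivial. m2unfold. simpl. ring.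
Qed.

Section Reduction.
Variables (t0 : R) (A Cm P S Z : R -> M2).
Hypothesis cA : forall t, Mcont A t.
Hypothesis cP : forall t, Mcont P t.
Hypothesis cS : forall t, Mcont S t.
Hypothesis hC : forall t, t0 <= t -> M2adj (Cm t) = Cm t.
Hypothesis hS : forall t, t0 <= t -> M2adj (S t) = S t.
Hypothesis dS : forall t, t0 <= t -> Mder S t (M2sub (M2mul (A t) (S t)) (M2mul (S t) (P t))).
Hypothesis dS' : forall t, t0 <= t -> M2sub (M2mul (A t) (S t)) (M2mul (S t) (P t)) =
     M2sub (M2mul (S t) (M2adj (A t))) (M2mul (M2adj (P t)) (S t)).
Hypothesis hZ : forall t, t0 <= t -> M2adj (Z t) = Z t.
Hypothesis dZ : forall t, t0 <= t -> Mder Z t (ric (P t) (M2mul (S t) (M2mul (Cm t) (S t))) (Z t)).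

(** The data that [conjoined_of_riccati] needs at [t1]: a Hermitian solution whose initial value
    factors through [S]. *)
Definition reduced (t1 : R) : Prop := t0 <= t1 /\ exists (W : R -> M2) (Y1 : M2),
  (forall t, t1 <= t -> M2adj (W t) = W t) /\
  (forall t, t1 <= t -> Mder W t (ric (P t) (M2mul (S t) (M2mul (Cm t) (S t))) (W t))) /\
  M2adj Y1 = Y1 /\ W t1 = M2mul (S t1) (M2mul Y1 (S t1)).

Lemma reduced_invertible : M2det (S t0) <> RtoC 0 -> reduced t0.
Proof.
  intros Hd. split; [lra|]. set (V := M2scal (Cinv (M2det (S t0))) (M2cof (S t0))).
  assert (hd : Cconj (M2det (S t0)) = M2det (S t0)) by (rewrite <- M2det_adj, hS; trivial; lra).
  assert (hV : M2adj V = V).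
  { unfold V. rewrite M2adj_scal, M2cof_adj, hS, Cinv_conj, hd by (trivial; lra). reflexivity. }
  destruct (M2_inverse (S t0) Hd) as [SV VS]. fold V in SV, VS.
  exists Z, (M2mul V (M2mul (Z t0) V)). split; [exact hZ|split; [exact dZ|split]].
  - rewrite !M2adj_mul, hV, hZ by lra. apply M2mul_assoc.
  - transitivity (M2mul (M2mul (S t0) V) (M2mul (Z t0) (M2mul V (S t0)))); [rewrite SV, VS; m2|].
    generalize (S t0) V (Z t0). m2.
Qed.

Lemma reduced_null t1 : t0 <= t1 -> S t1 = M2zero -> reduced t1.
Proof.
  intros H1 HS.
  assert (S0 : forall t, t1 <= t -> S t = M2zero).
  { apply (M2_ode_unique (fun t X => M2sub (M2mul (A t) X) (M2mul X (P t))) t1 S (fun _ => M2zero)); trivial.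
    - auto 12 with cont.
    - intros t Ht. apply dS; lra.
    - intros t Ht. eapply Mder_eq; [apply Mder_const|]. generalize (A t) (P t). m2. }
  split; trivial. exists (fun _ => M2zero), M2zero. split; [|split; [|split]].
  - intros; apply M2adj_zero.
  - intros t Ht. eapply Mder_eq; [apply Mder_const|]. rewrite S0 by trivial. unfold ric.
    generalize (Cm t) (P t). m2.
  - apply M2adj_zero.
  - generalize (S t1). m2.
Qed.

(** * Square roots of rank one *)

Hypothesis detS : forall t, t0 <= t -> M2det (S t) = RtoC 0.
Hypothesis trS : forall t, t0 <= t -> 0 < Re (M2tr (S t)).

Let sg t := Re (M2tr (S t)).
(** [r] is the scalar with [(A + adj P) S = r S], which exists by [rank1_dS], and [q] the one with
    [S Cm S = q S]. *)
Let r t := Re (M2tr (M2mul (M2add (A t) (M2adj (P t))) (S t))) / sg t.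
Let q t := Re (M2tr (M2mul (S t) (Cm t))).
Let tau t := Re (M2tr (Z t)).
Let rho t := Re (M2tr (P t)) + Re (M2tr (P t)).
Let d t := Re (M2tr (M2mul (M2cof (S t)) (Z t))).
Let D t := Re (M2det (Z t)).

Lemma rank1_sg t : t0 <= t -> M2tr (S t) = RtoC (sg t).
Proof. intros Ht. apply C_real. rewrite <- M2tr_adj, hS; trivial. Qed.
Lemma rank1_q t : t0 <= t -> M2mul (S t) (M2mul (Cm t) (S t)) = M2scal (RtoC (q t)) (S t).
Proof.
  intros Ht. rewrite M2_sandwich0 by auto. f_equal. apply C_real.
  rewrite <- M2tr_adj, M2adj_mul, hS, hC by trivial. apply M2tr_mulC.
Qed.
Lemma rank1_tau t : t0 <= t -> M2tr (Z t) = RtoC (tau t).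
Proof. intros Ht. apply C_real. rewrite <- M2tr_adj, hZ; trivial. Qed.
Lemma rank1_d t : t0 <= t -> M2tr (M2mul (M2cof (S t)) (Z t)) = RtoC (d t).
Proof.
  intros Ht. apply C_real. rewrite <- M2tr_adj, M2adj_mul, M2cof_adj, hS, hZ by trivial. apply M2tr_mulC.
Qed.
Lemma rank1_D t : t0 <= t -> M2det (Z t) = RtoC (D t).
Proof. intros Ht. apply C_real. rewrite <- M2det_adj, hZ; trivial. Qed.
Lemma rank1_rho t : Cplus (M2tr (P t)) (Cconj (M2tr (P t))) = RtoC (rho t).
Proof. unfold rho. generalize (M2tr (P t)). intros [x y]. apply C_ext; simpl; ring. Qed.

(** With [M = A + adj P], Hermiticity of [S'] gives [M S = S adj M]. Hence [tr S] times [M S] equals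
    [M S S = S adj M S], a multiple of [S] by the sandwich identity; dividing by [tr S] shows
    [M S = r S]. *)
Lemma rank1_dS t : t0 <= t -> M2sub (M2mul (A t) (S t)) (M2mul (S t) (P t)) =
  M2add (M2opp (M2add (M2mul (M2adj (P t)) (S t)) (M2mul (S t) (P t)))) (M2scal (RtoC (r t)) (S t)).
Proof.
  intros Ht. set (M := M2add (A t) (M2adj (P t))).
  assert (E : M2mul M (S t) = M2mul (S t) (M2adj M)).
  { unfold M. rewrite M2adj_add, M2adj_adj, M2mul_addl, M2mul_addr.
    transitivity (M2add (M2sub (M2mul (A t) (S t)) (M2mul (S t) (P t)))
      (M2add (M2mul (S t) (P t)) (M2mul (M2adj (P t)) (S t)))).
    - generalize (A t) (S t) (P t). m2.
    - rewrite dS' by trivial. generalize (A t) (S t) (P t). m2. }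
  assert (E2 : M2scal (RtoC (sg t)) (M2mul M (S t)) = M2scal (M2tr (M2mul M (S t))) (S t)).
  { rewrite <- rank1_sg by trivial.
    transitivity (M2mul M (M2mul (S t) (S t))).
    - rewrite M2_cayley0 by auto. generalize (M2tr (S t)). generalize M (S t). m2.
    - rewrite <- M2mul_assoc, E, M2mul_assoc. apply M2_sandwich0. auto. }
  assert (E3 : M2tr (M2mul M (S t)) = RtoC (sg t * r t)).
  { transitivity (RtoC (Re (M2tr (M2mul M (S t))))).
    - apply C_real. rewrite <- M2tr_adj, M2adj_mul, hS, E by trivial. reflexivity.
    - f_equal. unfold r. fold M. field. apply Rgt_not_eq, trS, Ht. }
  assert (E4 : M2mul M (S t) = M2scal (RtoC (r t)) (S t)).
  { transitivity (M2scal (RtoC (/ sg t)) (M2scal (RtoC (sg t)) (M2mul M (S t)))).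
    - assert (X : Cmult (RtoC (/ sg t)) (RtoC (sg t)) = 1).
      { rewrite <- RtoC_mult. f_equal. field. apply Rgt_not_eq, trS, Ht. }
      transitivity (M2scal (Cmult (RtoC (/ sg t)) (RtoC (sg t))) (M2mul M (S t))).
      + rewrite X. generalize (M2mul M (S t)). m2.
      + generalize (M2mul M (S t)). m2.
    - rewrite E2, E3.
      transitivity (M2scal (Cmult (RtoC (/ sg t)) (RtoC (sg t * r t))) (S t)); [generalize (S t); m2|].
      f_equal. rewrite <- RtoC_mult. f_equal. field. apply Rgt_not_eq, trS, Ht. }
  rewrite <- E4. unfold M. generalize (A t) (S t) (P t). m2.
Qed.

Lemma rank1_d_deriv t : t0 <= t -> is_derive d t ((r t - (tau t + rho t)) * d t + D t * sg t).
Proof.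
  intros Ht.
  assert (X := dS t Ht). rewrite rank1_dS in X by trivial.
  assert (Y := dZ t Ht). rewrite rank1_q in Y by trivial.
  assert (E := Mder_tr _ _ _ (Mder_mul _ _ _ _ _ (Mder_cof _ _ _ X) Y)).
  apply proj1 in E. eapply is_derive_eq; [exact E|].
  assert (T : forall U V, M2tr (M2add U V) = Cplus (M2tr U) (M2tr V)) by m2.
  rewrite T, cof_ric_deriv by auto.
  rewrite rank1_tau, rank1_rho, rank1_d, rank1_D, rank1_sg by trivial. simpl. ring.
Qed.
Lemma rank1_D_deriv t : t0 <= t -> is_derive D t (- D t * (tau t + rho t) + q t * d t).
Proof.
  intros Ht.
  assert (Y := dZ t Ht). rewrite rank1_q in Y by trivial.
  assert (E := Mder_det _ _ _ Y). apply proj1 in E. eapply is_derive_eq; [exact E|].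
  rewrite det_ric_deriv, rank1_tau, rank1_rho, rank1_d, rank1_D by trivial. simpl. ring.
Qed.

Lemma rank1_gram t : t0 <= t -> 0 <= tau t * d t - D t * sg t /\
  (tau t * d t - D t * sg t = 0 -> M2mul (Z t) (M2cof (S t)) = M2zero).
Proof.
  intros Ht. assert (G := gram_trace (S t) (Z t) (detS t Ht) (hS t Ht) (hZ t Ht)).
  rewrite rank1_tau, rank1_d, rank1_D, rank1_sg in G by trivial.
  destruct (gram_trace_nonneg (M2mul (Z t) (M2cof (S t)))) as [N0 N1].
  rewrite G in N0, N1. simpl in N0, N1. assert (T := trS t Ht). fold (sg t) in T. split; [nra|].
  intros E. apply N1. nra.
Qed.

(* Schur complement of [Z] on the line spanned by the range of [S]. *)
Lemma reduced_schur t1 : t0 <= t1 -> (forall t, t1 <= t -> d t <> 0) -> reduced t1.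
Proof.
  intros H1 Hd. split; trivial.
  set (c := fun t => D t / d t).
  (* For rank one [S S S = sg^2 S], hence the factor [1 / sg^2] in the witness for [Y1]. *)
  exists (fun t => M2scal (RtoC (c t)) (S t)), (M2scal (RtoC (c t1 / (sg t1 * sg t1))) (S t1)).
  split; [|split; [|split]].
  - intros t Ht. rewrite M2adj_scal, Cconj_RtoC, hS by lra. reflexivity.
  - intros t Ht.
    assert (dc : is_derive c t (q t - c t * r t - c t * c t * sg t)).
    { unfold c. eapply is_derive_eq.
      - apply is_derive_div; [apply rank1_D_deriv; lra|apply rank1_d_deriv; lra|apply Hd, Ht].
      - req. field. apply Hd, Ht. }
    eapply Mder_eq; [apply Mder_scal; [apply (Cder_RtoC c), dc|apply dS; lra]|].
    rewrite rank1_dS, rank1_q by lra. unfold ric.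
    assert (SS := M2_cayley0 (S t) (detS t ltac:(lra))). rewrite rank1_sg in SS by lra.
    transitivity (M2add (M2opp (M2add (M2add (M2scal (Cmult (RtoC (c t)) (RtoC (c t))) (M2scal (RtoC (sg t)) (S t)))
       (M2mul (M2adj (P t)) (M2scal (c t) (S t)))) (M2mul (M2scal (c t) (S t)) (P t)))) (M2scal (q t) (S t))).
    + rewrite !RtoC_minus, !RtoC_mult. generalize (S t) (P t). m2.
    + rewrite <- SS. generalize (S t) (P t). m2.
  - rewrite M2adj_scal, Cconj_RtoC, hS by lra. reflexivity.
  - assert (SS := M2_cayley0 (S t1) (detS t1 ltac:(lra))). rewrite rank1_sg in SS by lra.
    transitivity (M2scal (RtoC (c t1 / (sg t1 * sg t1))) (M2mul (S t1) (M2mul (S t1) (S t1)))).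
    + rewrite SS.
      transitivity (M2scal (Cmult (RtoC (c t1 / (sg t1 * sg t1))) (RtoC (sg t1))) (M2mul (S t1) (S t1))).
      * rewrite SS.
        transitivity (M2scal (Cmult (Cmult (RtoC (c t1 / (sg t1 * sg t1))) (RtoC (sg t1))) (RtoC (sg t1))) (S t1)).
        -- f_equal. rewrite <- !RtoC_mult. f_equal. field. apply Rgt_not_eq, trS, H1.
        -- generalize (S t1). m2.
      * generalize (S t1). m2.
    + generalize (S t1). m2.
Qed.

(** Since [cof S = tr S - S], the assumption reads [Z S = sg Z]; with its adjoint, [S Z S = sg^2 Z],
    so [Z] itself factors through [S]. *)
Lemma reduced_degenerate t1 : t0 <= t1 -> (forall t, t1 <= t -> M2mul (Z t) (M2cof (S t)) = M2zero) -> reduced t1.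
Proof.
  intros H1 HZ. split; trivial.
  exists Z, (M2scal (RtoC (/ (sg t1 * sg t1))) (Z t1)).
  split; [intros; apply hZ; lra|split; [intros; apply dZ; lra|split]].
  - rewrite M2adj_scal, Cconj_RtoC, hZ by lra. reflexivity.
  - assert (ZS : M2mul (Z t1) (S t1) = M2scal (RtoC (sg t1)) (Z t1)).
    { rewrite <- rank1_sg by trivial.
      transitivity (M2sub (M2scal (M2tr (S t1)) (Z t1)) (M2mul (Z t1) (M2cof (S t1)))); [generalize (Z t1) (S t1); m2|].
      rewrite HZ by lra. generalize (M2tr (S t1)) (Z t1). m2. }
    assert (SZ : M2mul (S t1) (Z t1) = M2scal (RtoC (sg t1)) (Z t1)).
    { apply (f_equal M2adj) in ZS. rewrite M2adj_mul, M2adj_scal, Cconj_RtoC, hS, hZ in ZS by trivial. exact ZS. }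
    transitivity (M2scal (RtoC (/ (sg t1 * sg t1))) (M2mul (S t1) (M2mul (Z t1) (S t1)))); [|generalize (S t1) (Z t1); m2].
    rewrite ZS.
    transitivity (M2scal (Cmult (RtoC (/ (sg t1 * sg t1))) (RtoC (sg t1))) (M2mul (S t1) (Z t1))); [|generalize (S t1) (Z t1); m2].
    rewrite SZ.
    transitivity (M2scal (Cmult (Cmult (RtoC (/ (sg t1 * sg t1))) (RtoC (sg t1))) (RtoC (sg t1))) (Z t1)); [|generalize (S t1) (Z t1); m2].
    rewrite <- !RtoC_mult.
    replace (/ (sg t1 * sg t1) * sg t1 * sg t1) with 1 by (field; apply Rgt_not_eq, trS, H1).
    generalize (Z t1). m2.
Qed.

(** By the Gram inequality, [d] times the integrating factor for [r - rho] is nonincreasing. The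
    positive constant [k] suffices for the two consequences wanted: a negative [d] stays negative,
    and a nonnegative [d] that reaches zero stays zero. *)
Lemma rank1_d_decreasing a b : t0 <= a <= b -> exists k, 0 < k /\ d b <= k * d a.
Proof.
  intros Hab.
  (* The clamp is needed because [r] divides by [tr S], which is known to be positive only from [t0]
     on. *)
  set (g := fun t => r (Rmax t0 t) - rho (Rmax t0 t)).
  assert (cg' : forall t, t0 <= t -> continuous (fun t => r t - rho t) t).
  { intros t Ht.
    assert (c1 : forall X : R -> M2, Mcont X t -> continuous (fun s => Re (M2tr (X s))) t).
    { intros X [? [? [? ?]]]. unfold M2tr. auto with cont. }
    apply cont_Rminus; [apply cont_Rmult; [|apply cont_Rinv]|apply cont_Rplus].
    - apply (c1 (fun t => M2mul (M2add (A t) (M2adj (P t))) (S t))). auto with cont.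
    - apply (c1 S), cS.
    - apply Rgt_not_eq, trS, Ht.
    - apply (c1 P), cP.
    - apply (c1 P), cP. }
  assert (cg : forall t, continuous g t) by exact (clamp_continuous (fun t => r t - rho t) t0 cg').
  set (G := fun t => RInt g a t).
  assert (dG : forall t, is_derive G t (g t)) by (intros; now apply derive_RInt_cont).
  assert (G0 : G a = 0) by apply (RInt_point (V := R_CompleteNormedModule)).
  assert (M := nondecreasing_of_deriv (fun t => - (d t * exp (- G t)))
     (fun t => (tau t * d t - D t * sg t) * exp (- G t)) a b ltac:(lra)).
  simpl in M. rewrite G0, Ropp_0, exp_0 in M.
  exists (exp (G b)). split; [apply exp_pos|].
  assert (K : - (d a * 1) <= - (d b * exp (- G b))).
  { apply M.
    - intros t Ht. eapply is_derive_eq.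
      + apply is_derive_Ropp, is_derive_Rmult; [apply rank1_d_deriv; lra|].
        apply is_derive_Rexp, is_derive_Ropp, dG.
      + req. unfold g. rewrite Rmax_right by lra. ring.
    - intros t Ht. apply Rmult_le_pos; [apply (rank1_gram t); lra|left; apply exp_pos]. }
  assert (Ee : exp (- G b) * exp (G b) = 1) by (rewrite <- exp_plus, Rplus_opp_l; apply exp_0).
  replace (d b) with ((d b * exp (- G b)) * exp (G b)) by (rewrite Rmult_assoc, Ee; apply Rmult_1_r).
  rewrite (Rmult_comm (exp (G b))). apply Rmult_le_compat_r; [left; apply exp_pos|].
  rewrite Rmult_1_r in K. now apply Ropp_le_cancel.
Qed.

Lemma reduced_rank1 : exists t1, reduced t1.
Proof.
  destruct (classic (exists t1, t0 <= t1 /\ d t1 < 0)) as [[t1 [H1 Hd]]|Hn].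
  { exists t1. apply reduced_schur; trivial. intros t Ht.
    destruct (rank1_d_decreasing t1 t ltac:(lra)) as [k [Hk E]]. nra. }
  assert (dpos : forall t, t0 <= t -> 0 <= d t).
  { intros t Ht. apply Rnot_lt_le. intros H. apply Hn. now exists t. }
  destruct (classic (exists t1, t0 <= t1 /\ d t1 = 0)) as [[t1 [H1 Hd]]|Hp].
  - assert (d0 : forall t, t1 <= t -> d t = 0).
    { intros t Ht. destruct (rank1_d_decreasing t1 t ltac:(lra)) as [k [Hk E]].
      generalize (dpos t ltac:(lra)). rewrite Hd in E. lra. }
    (* Moving on by 1 leaves a two-sided neighbourhood on which [d = 0]; there [d' = 0] gives
       [D sg = 0], the equality case of the Gram inequality. *)
    exists (t1 + 1). apply reduced_degenerate; [lra|]. intros t Ht.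
    apply rank1_gram; [lra|].
    assert (E := rank1_d_deriv t ltac:(lra)). apply is_derive_unique in E.
    rewrite (Derive_ext_loc d (fun _ => 0)) in E.
    + rewrite Derive_const in E. rewrite (d0 t) in * by lra. lra.
    + exists (mkposreal 1 Rlt_0_1). intros s Hs. apply d0.
      apply Rabs_def2 in Hs. simpl in Hs. unfold minus, plus, opp in Hs; simpl in Hs. lra.
  - exists t0. apply reduced_schur; [lra|]. intros t Ht E. apply Hp. now exists t.
Qed.
End Reduction.

Theorem riccati_reduction (t0 : R) (A Cm P S Z : R -> M2) :
  (forall t, Mcont A t) -> (forall t, Mcont P t) -> (forall t, Mcont S t) ->
  (forall t, t0 <= t -> M2adj (Cm t) = Cm t) -> (forall t, t0 <= t -> M2adj (S t) = S t) ->
  (forall t, t0 <= t -> 0 <= Re (M2tr (S t))) ->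
  (forall t, t0 <= t -> Mder S t (M2sub (M2mul (A t) (S t)) (M2mul (S t) (P t)))) ->
  (forall t, t0 <= t -> M2sub (M2mul (A t) (S t)) (M2mul (S t) (P t)) =
     M2sub (M2mul (S t) (M2adj (A t))) (M2mul (M2adj (P t)) (S t))) ->
  (forall t, t0 <= t -> M2adj (Z t) = Z t) ->
  (forall t, t0 <= t -> Mder Z t (ric (P t) (M2mul (S t) (M2mul (Cm t) (S t))) (Z t))) ->
  exists t1, reduced t0 Cm P S t1.
Proof.
  intros cA cP cS hC hS pS dS dS' hZ dZ.
  destruct (classic (M2det (S t0) = RtoC 0)) as [H0|H0].
  2:{ exists t0. now apply reduced_invertible with Z. }
  (* [S' = A S - S P] gives [(det S)' = (tr A - tr P) det S], so singularity at [t0] persists. *)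
  assert (detS : forall t, t0 <= t -> M2det (S t) = RtoC 0).
  { apply (C_linear_ode_zero (fun t => Cminus (M2tr (A t)) (M2tr (P t)))); trivial.
    - intros t. generalize (cA t) (cP t). mcont.
    - intros t Ht. eapply Cder_eq; [apply (Mder_det S), dS, Ht|]. generalize (A t) (P t) (S t). m2. }
  (* A singular Hermitian matrix of trace zero is zero. If this never happens, nonnegativity makes
     the trace positive throughout and the rank is one. *)
  destruct (classic (exists T, t0 <= T /\ Re (M2tr (S T)) = 0)) as [[T [HT ST]]|Hp].
  - exists T. apply reduced_null with A; trivial. apply herm_nilpotent_zero; auto.
    rewrite <- ST. apply C_real. rewrite <- M2tr_adj, hS; trivial.
  - apply reduced_rank1 with A Z; trivial.
    intros t Ht. destruct (pS t Ht) as [|E]; trivial. exfalso. apply Hp. now exists t.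
Qed.

(** * Scalar Riccati inequalities *)

Lemma limit_le_left (f : R -> R) (a b c : R) : a < b -> continuous f b ->
  (forall t, a <= t < b -> f t <= c) -> f b <= c.
Proof.
  intros Hab Hf H. apply Rnot_lt_le. intros Hc.
  destruct (proj1 (continuous_eps f b) Hf (f b - c) ltac:(lra)) as [d [Hd Hs]].
  set (s := Rmax a (b - d / 2)).
  assert (a <= s < b) by (unfold s, Rmax; destruct Rle_dec; lra).
  assert (K : Rabs (s - b) < d).
  { rewrite Rabs_left by lra. unfold s, Rmax; destruct Rle_dec; lra. }
  specialize (Hs s K). apply Rabs_def2 in Hs. specialize (H s ltac:(lra)). lra.
Qed.

(** Real induction: the supremum of the initial segments on which [u] is positive is attained by the
    step hypothesis and passed by continuity. *)
Lemma positive_induction (u : R -> R) (a b : R) : (forall t, continuous u t) -> 0 < u a ->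
  (forall t, a < t <= b -> (forall s, a <= s < t -> 0 < u s) -> 0 < u t) ->
  forall t, a <= t <= b -> 0 < u t.
Proof.
  intros Hu Ha Hi t0 Ht0.
  set (E := fun t => a <= t <= b /\ forall s, a <= s <= t -> 0 < u s).
  destruct (completeness E) as [m [Hub Hlub]].
  - exists b. intros t [Ht _]. lra.
  - exists a. split; [lra|]. intros s Hs. now replace s with a by lra.
  - assert (am : a <= m). { apply Hub. split; [lra|]. intros s Hs. now replace s with a by lra. }
    assert (mb : m <= b). { apply Hlub. intros t [Ht _]. lra. }
    assert (Hlt : forall s, a <= s < m -> 0 < u s).
    { intros s Hs. apply NNPP. intros Hn. assert (m <= s); [|lra].
      apply Hlub. intros t [Ht HE]. apply Rnot_lt_le. intros Hst. apply Hn, HE. lra. }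
    assert (um : 0 < u m).
    { destruct (Req_dec m a) as [->|]; trivial. apply Hi; [lra|exact Hlt]. }
    destruct (proj1 (continuous_eps u m) (Hu m) (u m) um) as [d [Hd Hs]].
    assert (Hle : forall s, a <= s < m + d -> 0 < u s).
    { intros s Hsd. destruct (Rlt_dec s m); [apply Hlt; lra|].
      assert (K : Rabs (s - m) < d) by (rewrite Rabs_pos_eq; lra).
      specialize (Hs s K). apply Rabs_def2 in Hs. lra. }
    destruct (Rlt_dec t0 (m + d)); [apply Hle; lra|].
    assert (m + d / 2 <= m); [|lra]. apply Hub. split; [lra|]. intros s Hs'. apply Hle. lra.
Qed.

Lemma cont_RInt (f : R -> R) (a t : R) : (forall s, continuous f s) -> continuous (fun s => RInt f a s) t.
Proof. intros H. eapply continuous_of_derive, derive_RInt_cont, H. Qed.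
#[global] Hint Resolve cont_RInt : cont.

Lemma RInt_cont_point (f : R -> R) (a : R) : RInt f a a = 0.
Proof. apply (RInt_point (V := R_CompleteNormedModule)). Qed.

Lemma RInt_cont_Chasles (f : R -> R) (a b c : R) : (forall t, continuous f t) ->
  RInt f b c = RInt f a c - RInt f a b.
Proof.
  intros H. assert (E : RInt f a b + RInt f b c = RInt f a c).
  { apply (RInt_Chasles (V := R_CompleteNormedModule)); now apply ex_RInt_cont. }
  lra.
Qed.

Lemma RInt_cont_scal (f : R -> R) (k a b : R) : (forall t, continuous f t) ->
  RInt (fun t => k * f t) a b = k * RInt f a b.
Proof. intros H. apply (RInt_scal (V := R_CompleteNormedModule)). now apply ex_RInt_cont. Qed.

Section ScalarRiccati.
Variables (g h : R -> R) (xi xi' : R).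
Hypothesis cg : forall t, continuous g t.
Hypothesis ch : forall t, continuous h t.

(** [- I] solves [y' + g y + h = 0] with [y xi = 0], the Riccati equation without its square. *)
Let I (t : R) : R := RInt (fun tau => exp (- RInt g tau t) * h tau) xi t.
Let G (t : R) : R := RInt g xi t.

(** Here [t] occurs in the integrand as well as in the upper limit; splitting the kernel moves it
    out, so that the integral can be differentiated. *)
Lemma damped_integral_eq t : I t = exp (- G t) * RInt (fun tau => exp (G tau) * h tau) xi t.
Proof.
  assert (cG : forall t, continuous G t) by (intros; now apply cont_RInt).
  unfold I. rewrite <- RInt_cont_scal by auto with cont.
  apply (RInt_ext (V := R_CompleteNormedModule)). intros tau _.
  rewrite (RInt_cont_Chasles g xi tau t) by trivial. fold (G t) (G tau).
  replace (- (G t - G tau)) with (- G t + G tau) by ring. rewrite exp_plus. apply Rmult_assoc.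
Qed.

Lemma damped_integral_deriv t : is_derive I t (- g t * I t + h t).
Proof.
  assert (cG : forall t, continuous G t) by (intros; now apply cont_RInt).
  eapply is_derive_ext; [intros s; symmetry; apply damped_integral_eq|].
  rewrite damped_integral_eq.
  eapply is_derive_eq.
  - apply is_derive_Rmult.
    + apply is_derive_Rexp, is_derive_Ropp. apply (derive_RInt_cont g); trivial.
    + apply (derive_RInt_cont (fun tau => exp (G tau) * h tau)). auto with cont.
  - req. fold (G t).
    assert (E : exp (- G t) * exp (G t) = 1) by (rewrite <- exp_plus, Rplus_opp_l; apply exp_0).
    transitivity (- g t * (exp (- G t) * RInt (fun tau => exp (G tau) * h tau) xi t) + exp (- G t) * exp (G t) * h t);
      [ring|rewrite E; ring].
Qed.

Hypothesis lt_xi : xi < xi'.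
Hypothesis H_nonpos : forall t, xi <= t < xi' ->
  RInt (fun tau => exp (RInt (fun s => g s - I s) xi tau) * h tau) xi t <= 0.

(* The linear system for [y = v / u], [y' + y^2 + g y + h = 0], [y xi = 0].
   As long as [u > 0], [y <= - I], so [w = u exp (int I)] decreases, and
   [v exp G + H w] increases because its derivative is [H w']. *)
Lemma linearization_nonneg : exists u v : R -> R,
  (forall t, is_derive u t (v t)) /\ (forall t, is_derive v t (- g t * v t - h t * u t)) /\
  u xi = 1 /\ v xi = 0 /\ forall t, xi <= t <= xi' -> 0 < u t /\ 0 <= v t.
Proof.
  destruct (C_ode 2 (fun i t x => match i with
    | O => x 1%nat
    | 1%nat => Cminus (Cmult (RtoC (- g t)) (x 1%nat)) (Cmult (RtoC (h t)) (x O))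
    | _ => RtoC 0 end) xi (fun i => match i with O => RtoC 1 | _ => RtoC 0 end)) as [x [x0 dx]].
  { split.
    - intros [|[|i]].
      + apply (Lip_proj 1).
      + apply Lip_minus; [apply (Lip_scal (fun t => RtoC (- g t)))|apply (Lip_scal (fun t => RtoC (h t)))];
        auto with cont; [apply (Lip_proj 1)|apply (Lip_proj 0)].
      + exact (Lip_coef (fun _ => RtoC 0) (fun t => Ccont_const _ t)).
    - intros [|[|i]] t y Hi; [lia|lia|reflexivity]. }
  set (u := fun t => Re (x t O)). set (v := fun t => Re (x t 1%nat)).
  assert (du : forall t, is_derive u t (v t)) by (intros t; exact (proj1 (dx O t))).
  assert (dv : forall t, is_derive v t (- g t * v t - h t * u t)).
  { intros t. eapply is_derive_eq; [exact (proj1 (dx 1%nat t))|]. simpl. unfold u, v, Re. ring. }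
  assert (u0 : u xi = 1) by (unfold u; now rewrite x0).
  assert (v0 : v xi = 0) by (unfold v; now rewrite x0).
  exists u, v. split; [exact du|split; [exact dv|split; [exact u0|split; [exact v0|]]]].
  assert (cI : forall t, continuous I t) by (intros; eapply continuous_of_derive, damped_integral_deriv).
  set (J := fun t => RInt I xi t).
  assert (dJ : forall t, is_derive J t (I t)) by (intros; now apply derive_RInt_cont).
  assert (dG : forall t, is_derive G t (g t)) by (intros; now apply derive_RInt_cont).
  assert (cJ : forall t, continuous J t) by (intros; eapply continuous_of_derive, dJ).
  assert (cG : forall t, continuous G t) by (intros; eapply continuous_of_derive, dG).
  set (H := fun t => RInt (fun tau => exp (G tau - J tau) * h tau) xi t).
  assert (dH : forall t, is_derive H t (exp (G t - J t) * h t)).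
  { intros t. apply (derive_RInt_cont (fun tau => exp (G tau - J tau) * h tau)). auto with cont. }
  assert (EH : forall t, xi <= t < xi' -> H t <= 0).
  { intros t Ht. eapply Rle_trans; [|apply (H_nonpos t Ht)]. right.
    apply (RInt_ext (V := R_CompleteNormedModule)). intros s _. f_equal. f_equal.
    unfold G, J. symmetry. apply (RInt_minus_cont g I); trivial. }
  (* The sign condition is given on a half-open interval; continuity adds the right endpoint, from
     which the next interval starts. *)
  assert (Hle : forall t, xi <= t <= xi' -> H t <= 0).
  { intros t Ht. destruct (Req_dec t xi') as [->|]; [|apply EH; lra].
    apply limit_le_left with xi; trivial. eapply continuous_of_derive, dH. }
  assert (I0 : I xi = 0) by exact (RInt_cont_point (fun tau => exp (- RInt g tau xi) * h tau) xi).
  assert (H0 : H xi = 0) by exact (RInt_cont_point (fun tau => exp (G tau - J tau) * h tau) xi).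
  assert (Step : forall t, xi <= t <= xi' -> (forall s, xi <= s <= t -> 0 < u s) -> 0 <= v t).
  { intros t Ht Hu.
    assert (Hx : forall s, xi <= s <= t -> v s + I s * u s <= 0).
    { intros s Hs.
      assert (M := nondecreasing_of_deriv (fun s => - (exp (G s - J s) * (v s + I s * u s)))
        (fun s => exp (G s - J s) * (I s * I s * u s)) xi s ltac:(lra)).
      simpl in M. rewrite v0, u0, I0 in M.
      assert (N : - (exp (G xi - J xi) * (0 + 0 * 1)) <= - (exp (G s - J s) * (v s + I s * u s))).
      { apply M.
        - intros r _. eapply is_derive_eq.
          + apply is_derive_Ropp, is_derive_Rmult.
            * apply is_derive_Rexp, is_derive_Rminus; [apply dG|apply dJ].
            * apply is_derive_Rplus; [apply dv|apply is_derive_Rmult; [apply damped_integral_deriv|apply du]].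
          + req. ring.
        - intros r Hr. apply Rmult_le_pos; [left; apply exp_pos|].
          apply Rmult_le_pos; [apply Rle_0_sqr|left; apply Hu; lra]. }
      generalize (exp_pos (G s - J s)). intros. nra. }
    assert (M := nondecreasing_of_deriv (fun s => v s * exp (G s) + H s * (exp (J s) * u s))
      (fun s => H s * (exp (J s) * (v s + I s * u s))) xi t ltac:(lra)).
    simpl in M. rewrite v0, u0, H0 in M.
    assert (N : 0 * exp (G xi) + 0 * (exp (J xi) * 1) <= v t * exp (G t) + H t * (exp (J t) * u t)).
    { apply M.
      - intros r _. eapply is_derive_eq.
        + apply is_derive_Rplus; apply is_derive_Rmult; [apply dv|apply is_derive_Rexp, dG|apply dH|].
          apply is_derive_Rmult; [apply is_derive_Rexp, dJ|apply du].
        + req. replace (G r) with (G r - J r + J r) at 1 2 by ring. rewrite exp_plus. ring.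
      - intros r Hr. assert (B := Hle r ltac:(lra)). assert (X := Hx r Hr).
        assert (Y := exp_pos (J r)). assert (exp (J r) * (v r + I r * u r) <= 0) by nra. nra. }
    assert (B := Hle t ltac:(lra)). assert (X := Hu t ltac:(lra)).
    assert (Y := exp_pos (J t)). assert (Y' := exp_pos (G t)).
    assert (0 < exp (J t) * u t) by nra. nra. }
  (* While [u] is positive, [u' = v >= 0]; so [u] never falls below its initial value 1. *)
  assert (Up : forall t, xi <= t <= xi' -> 0 < u t).
  { apply positive_induction; [intros; eapply continuous_of_derive, du|rewrite u0; lra|].
    intros t Ht Hu. apply Ropp_lt_cancel. rewrite Ropp_0.
    apply Rle_lt_trans with (- u xi); [|rewrite u0; lra].
    apply (limit_le_left (fun s => - u s) xi); [lra|apply cont_Ropp; eapply continuous_of_derive, du|].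
    intros s Hs. apply Ropp_le_contravar.
    apply (nondecreasing_of_deriv u v); [lra|intros; apply du|].
    intros r Hr. apply Step; [lra|]. intros q Hq. apply Hu. lra. }
  intros t Ht. split; [now apply Up|]. apply Step; trivial. intros s Hs. apply Up. lra.
Qed.

(** Comparison with [y = v / u >= 0]: the quantity [z u - v] satisfies
    [(z u - v)' + (z + g) (z u - v) >= 0] and starts at [z xi > 0], so [z u > v >= 0]. *)
Lemma riccati_positive (z dz : R -> R) :
  (forall t, is_derive z t (dz t)) -> 0 < z xi ->
  (forall t, xi <= t <= xi' -> - (z t * z t) - g t * z t - h t <= dz t) ->
  forall t, xi <= t <= xi' -> 0 < z t.
Proof.
  intros dz_ z0 Hz t Ht.
  destruct linearization_nonneg as [u [v [du [dv [u0 [v0 uv]]]]]].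
  assert (cz : forall t, continuous z t) by (intros; eapply continuous_of_derive, dz_).
  set (K := fun t => RInt (fun s => z s + g s) xi t).
  assert (dK : forall t, is_derive K t (z t + g t)).
  { intros s. apply (derive_RInt_cont (fun s => z s + g s)). auto with cont. }
  assert (M := nondecreasing_of_deriv (fun s => exp (K s) * (z s * u s - v s))
    (fun s => exp (K s) * (u s * (dz s - (- (z s * z s) - g s * z s - h s)))) xi t ltac:(lra)).
  simpl in M. rewrite u0, v0 in M.
  assert (N : exp (K xi) * (z xi * 1 - 0) <= exp (K t) * (z t * u t - v t)).
  { apply M.
    - intros r _. eapply is_derive_eq.
      + apply is_derive_Rmult; [apply is_derive_Rexp, dK|].
        apply is_derive_Rminus; [apply is_derive_Rmult; [apply dz_|apply du]|apply dv].
      + req. ring.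
    - intros r Hr. apply Rmult_le_pos; [left; apply exp_pos|].
      destruct (uv r ltac:(lra)). assert (X := Hz r ltac:(lra)). apply Rmult_le_pos; lra. }
  destruct (uv t Ht) as [Hu Hv].
  assert (Y := exp_pos (K t)). assert (Y' := exp_pos (K xi)).
  assert (0 < exp (K xi) * (z xi * 1 - 0)) by nra.
  assert (0 < z t * u t - v t) by nra. nra.
Qed.
End ScalarRiccati.

(** The comparison solution restarts from zero at each [xi m]. Positivity at the closed right end of
    one interval is exactly the initial condition for the next, and the [xi m] exhaust the
    half-line. *)
Theorem cond4_positive (t0 : R) (p : R -> C) (chi z dz : R -> R) :
  (forall t, Ccont p t) -> (forall t, continuous chi t) -> cond4 t0 p chi ->
  (forall t, is_derive z t (dz t)) -> 0 < z t0 ->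
  (forall t, t0 <= t -> - (z t * z t) - 2 * Re (p t) * z t - chi t <= dz t) ->
  forall t, t0 <= t -> 0 < z t.
Proof.
  intros cp cchi [xi [xi0 [xiS [xiL Hxi]]]] dz_ z0 Hz.
  assert (cg : forall t, continuous (fun s => 2 * Re (p s)) t) by auto with cont.
  assert (xi_t0 : forall m, t0 <= xi m).
  { induction m; [lra|]. specialize (xiS m). lra. }
  assert (A : forall m, 0 < z (xi m) -> forall t, xi m <= t <= xi (S m) -> 0 < z t).
  { intros m Hm. apply (riccati_positive (fun s => 2 * Re (p s)) chi (xi m) (xi (S m))) with (dz := dz); trivial.
    - exact (Hxi m).
    - intros s Hs. apply Hz. specialize (xi_t0 m). lra. }
  assert (B : forall m, 0 < z (xi m)).
  { induction m; [now rewrite xi0|]. apply (A m); trivial. specialize (xiS m). lra. }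
  intros t Ht.
  assert (X : exists m, t < xi m).
  { apply is_lim_seq_spec in xiL. destruct (xiL t) as [N HN]. exists N. now apply HN. }
  assert (Y : forall m, t < xi m -> 0 < z t).
  { induction m; intros Hm; [lra|]. destruct (Rlt_dec t (xi m)); [auto|]. apply (A m); [apply B|lra]. }
  destruct X as [m Hm]. now apply (Y m).
Qed.

(** * Off-diagonal estimate *)

Lemma CInt_parts (f : R -> C) (a b : R) : (forall t, Ccont f t) ->
  CInt f a b = (RInt (fun s => Re (f s)) a b, RInt (fun s => Im (f s)) a b).
Proof.
  intros Hf. unfold CInt. apply (is_RInt_unique (V := C_R_CompleteNormedModule)).
  apply (is_RInt_fct_extend_pair (U := R_NormedModule) (V := R_NormedModule));
  apply (RInt_correct (V := R_CompleteNormedModule)), ex_RInt_cont; intros t; apply (Hf t).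
Qed.

Lemma Cmod_cexp z : Cmod (cexp z) = exp (Re z).
Proof.
  rewrite Cmod_sqrt. unfold cexp; simpl.
  replace (_ + _) with (exp (Re z) * exp (Re z) * ((sin (Im z))² + (cos (Im z))²)) by (unfold Rsqr; ring).
  rewrite sin2_cos2, Rmult_1_r. apply sqrt_square. left; apply exp_pos.
Qed.

Lemma Cder_cexp w t a : Cder w t a -> Cder (fun s => cexp (w s)) t (Cmult a (cexp (w t))).
Proof.
  intros [H1 H2]. split; simpl.
  - eapply is_derive_eq.
    + apply is_derive_Rmult; [apply is_derive_Rexp, H1|].
      apply (is_derive_comp cos (fun s => Im (w s))); [apply is_derive_cos|exact H2].
    + req. unfold scal, mult; simpl. unfold mult; simpl. unfold Re, Im. ring.
  - eapply is_derive_eq.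
    + apply is_derive_Rmult; [apply is_derive_Rexp, H1|].
      apply (is_derive_comp sin (fun s => Im (w s))); [apply is_derive_sin|exact H2].
    + req. unfold scal, mult; simpl. unfold mult; simpl. unfold Re, Im. ring.
Qed.

Lemma Re_mult_le (c z : C) : Re (Cmult (Cconj c) z) <= Cmod c * Cmod z.
Proof.
  eapply Rle_trans; [apply Rle_abs|]. eapply Rle_trans; [apply re_le_Cmod|].
  rewrite Cmod_mult, Cmod_conj. lra.
Qed.

Lemma Cmod_sqr_Re (z : C) : Re (Cmult (Cconj z) z) = Cmod z * Cmod z.
Proof.
  rewrite Cmod_sqrt, sqrt_sqrt; [simpl; unfold Re, Im; ring|]. nra.
Qed.

(* Integrating factor [exp (int (s + g))]; the part [delta] of the forcing controlled by [s] costs at most [D]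
   because [int s exp (int s)] is exact. *)
Lemma damped_bound (t0 T : R) (g x delta r d : R -> C) (s : R -> R) (D : R) :
  t0 <= T -> (forall t, Ccont g t) -> (forall t, continuous s t) -> (forall t, Ccont r t) ->
  (forall t, t0 <= t <= T -> 0 <= s t) ->
  (forall t, t0 <= t <= T -> Cder x t (Cplus (Cplus (Copp (Cmult (Cplus (RtoC (s t)) (g t)) (x t))) (delta t)) (r t))) ->
  (forall t, t0 <= t <= T -> Cmod (delta t) <= Cmod (d t) * s t) ->
  Cmod (x t0) <= Cmod (d t0) ->
  (forall t, t0 <= t <= T -> exp (RInt (fun u => Re (g u)) t0 t) * Cmod (d t) <= D) ->
  Cmod (x T) <= exp (- RInt (fun u => Re (g u)) t0 T) *
     (D + RInt (fun u => exp (RInt (fun u => Re (g u)) t0 u) * Cmod (r u)) t0 T).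
Proof.
  intros HT cg cs cr Hs dx Hdelta x0 HD.
  set (rho := fun t => RInt (fun u => Re (g u)) t0 t) in *.
  assert (crho : forall t, continuous rho t) by (intros; apply cont_RInt; auto with cont).
  set (J := fun t => RInt (fun u => exp (rho u) * Cmod (r u)) t0 t).
  change (Cmod (x T) <= exp (- rho T) * (D + J T)).
  set (S := fun t => RInt s t0 t).
  set (th := fun t => (rho t, RInt (fun u => Im (g u)) t0 t) : C).
  assert (dS : forall t, is_derive S t (s t)) by (intros; now apply derive_RInt_cont).
  assert (dth : forall t, Cder th t (g t)).
  { intros t. split; [apply (derive_RInt_cont (fun u => Re (g u)))|apply (derive_RInt_cont (fun u => Im (g u)))]; auto with cont. }
  assert (dJ : forall t, is_derive J t (exp (rho t) * Cmod (r t))).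
  { intros t. apply (derive_RInt_cont (fun u => exp (rho u) * Cmod (r u))). auto with cont. }
  (* A complex integrating factor: it cancels the phase due to [Im g] as well, while its modulus is
     [exp (rho + S)]. *)
  set (eta := fun t => cexp (Cplus (th t) (RtoC (S t)))).
  assert (Meta : forall t, Cmod (eta t) = exp (rho t) * exp (S t)).
  { intros t. unfold eta. rewrite Cmod_cexp. simpl. apply exp_plus. }
  assert (deta : forall t, Cder eta t (Cmult (Cplus (g t) (RtoC (s t))) (eta t))).
  { intros t. apply (Cder_cexp (fun t => Cplus (th t) (RtoC (S t)))).
    apply Cder_plus; [apply dth|apply (Cder_RtoC S), dS]. }
  assert (dbeta : forall t, t0 <= t <= T -> Cder (fun t => Cmult (x t) (eta t)) t (Cmult (Cplus (delta t) (r t)) (eta t))).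
  { intros t Ht. eapply Cder_eq; [apply Cder_mult; [now apply dx|apply deta]|]. ring. }
  assert (rho0 : rho t0 = 0) by exact (RInt_cont_point (fun u => Re (g u)) t0).
  assert (S0 : S t0 = 0) by exact (RInt_cont_point s t0).
  assert (J0 : J t0 = 0) by exact (RInt_cont_point (fun u => exp (rho u) * Cmod (r u)) t0).
  assert (Jpos : forall t, t0 <= t -> 0 <= J t).
  { intros t Ht. rewrite <- J0. apply (nondecreasing_of_deriv J (fun t => exp (rho t) * Cmod (r t))); trivial.
    intros. apply Rmult_le_pos; [left; apply exp_pos|apply Cmod_ge_0]. }
  (* Projecting on the fixed direction [bT] avoids differentiating a modulus that may vanish; at [T]
     the projection equals [|bT|^2]. *)
  set (bT := Cmult (x T) (eta T)).
  set (kd := fun t => (exp (rho t) * Cmod (r t)) * exp (S t) + (D + J t) * (s t * exp (S t))).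
  assert (M := nondecreasing_of_deriv
    (fun t => Cmod bT * ((D + J t) * exp (S t)) - Re (Cmult (Cconj bT) (Cmult (x t) (eta t))))
    (fun t => Cmod bT * kd t - Re (Cmult (Cconj bT) (Cmult (Cplus (delta t) (r t)) (eta t)))) t0 T HT).
  cbv beta in M.
  assert (N := M ltac:(
    intros t Ht; apply is_derive_Rminus;
    [ apply is_derive_scal; eapply is_derive_eq;
      [apply is_derive_Rmult; [apply (is_derive_plus (fun _ => D)); [apply is_derive_Rconst|apply dJ]|apply is_derive_Rexp, dS]
      |unfold kd; req; unfold plus; simpl; ring]
    | eapply is_derive_eq; [exact (proj1 (Cder_mult _ _ t _ _ (Cder_const (Cconj bT) t) (dbeta t Ht)))|simpl; ring] ])).
  clear M.
  assert (K : 0 <= Cmod bT * ((D + J T) * exp (S T)) - Cmod bT * Cmod bT).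
  { rewrite <- (Cmod_sqr_Re bT). eapply Rle_trans; [|apply N].
    - rewrite J0, S0, exp_0. assert (L := Re_mult_le bT (Cmult (x t0) (eta t0))).
      rewrite Cmod_mult, Meta, rho0, S0, exp_0 in L.
      assert (L2 := HD t0 ltac:(lra)). rewrite rho0, exp_0 in L2.
      assert (0 <= Cmod bT) by apply Cmod_ge_0. nra.
    - intros t Ht.
      assert (L := Re_mult_le bT (Cmult (Cplus (delta t) (r t)) (eta t))).
      rewrite Cmod_mult, Meta in L.
      assert (L1 := Cmod_triangle (delta t) (r t)). assert (L2 := Hdelta t Ht). assert (L3 := HD t Ht).
      assert (P1 := exp_pos (rho t)). assert (P2 := exp_pos (S t)). assert (P3 := Jpos t ltac:(lra)).
      assert (P4 := Hs t Ht). assert (P5 : 0 <= Cmod bT) by apply Cmod_ge_0.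
      assert (Q : Cmod (Cplus (delta t) (r t)) * (exp (rho t) * exp (S t)) <= kd t).
      { unfold kd. apply Rle_trans with ((Cmod (d t) * s t + Cmod (r t)) * (exp (rho t) * exp (S t))).
        - apply Rmult_le_compat_r; [nra|lra].
        - assert (exp (rho t) * Cmod (d t) * (s t * exp (S t)) <= (D + J t) * (s t * exp (S t))).
          { apply Rmult_le_compat_r; [nra|lra]. }
          nra. }
      assert (Cmod bT * (Cmod (Cplus (delta t) (r t)) * (exp (rho t) * exp (S t))) <= Cmod bT * kd t)
        by (apply Rmult_le_compat_l; trivial).
      lra. }
  assert (D0 : 0 <= D).
  { eapply Rle_trans; [|apply (HD T); lra]. apply Rmult_le_pos; [left; apply exp_pos|apply Cmod_ge_0]. }
  assert (L : Cmod bT <= (D + J T) * exp (S T)).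
  { assert (P3 := Jpos T HT). assert (P2 := exp_pos (S T)).
    destruct (Cmod_ge_0 bT) as [P|P]; [nra|]. rewrite <- P. apply Rmult_le_pos; lra. }
  unfold bT in L. rewrite Cmod_mult, Meta in L.
  assert (P1 := exp_pos (rho T)). assert (P2 := exp_pos (S T)).
  assert (L4 : Cmod (x T) * exp (rho T) <= D + J T).
  { apply Rmult_le_reg_r with (exp (S T)); trivial. lra. }
  rewrite exp_Ropp. apply Rmult_le_reg_l with (exp (rho T)); trivial.
  rewrite <- Rmult_assoc, Rinv_r, Rmult_1_l by lra. lra.
Qed.

(** * The running maximum and the kernel *)

Definition running_sup (t0 : R) (f : R -> R) (t : R) : R :=
  real (Lub_Rbar (fun x => exists tau, t0 <= tau <= t /\ x = f tau)).

Section RunningSup.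
Variables (t0 : R) (f : R -> R).
Hypothesis cf : forall t, continuous f t.

Lemma running_sup_lub t : t0 <= t ->
  is_lub_Rbar (fun x => exists tau, t0 <= tau <= t /\ x = f tau) (Finite (running_sup t0 f t)).
Proof.
  intros Ht. unfold running_sup.
  set (E := fun x => exists tau, t0 <= tau <= t /\ x = f tau).
  assert (H := Lub_Rbar_correct E).
  destruct (continuity_ab_maj f t0 t Ht) as [m [Hm Hmt]].
  { intros c _. apply continuity_pt_filterlim, cf. }
  assert (E0 : E (f t0)) by (exists t0; split; [lra|reflexivity]).
  destruct (Lub_Rbar E) as [l| |] eqn:El; simpl; trivial; exfalso.
  - assert (B : is_ub_Rbar E (Finite (f m))) by (intros x [tau [Htau ->]]; simpl; now apply Hm).
    exact (proj2 H _ B).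
  - exact (proj1 H _ E0).
Qed.

Lemma running_sup_ge t tau : t0 <= tau <= t -> f tau <= running_sup t0 f t.
Proof. intros H. apply (proj1 (running_sup_lub t ltac:(lra))). now exists tau. Qed.

Lemma running_sup_le t B : t0 <= t -> (forall tau, t0 <= tau <= t -> f tau <= B) -> running_sup t0 f t <= B.
Proof.
  intros Ht H. apply (proj2 (running_sup_lub t Ht) (Finite B)). intros x [tau [Htau ->]]. now apply H.
Qed.

(** Clamped because to the left of [t0] the set is empty and [real] returns the default 0. On a
    short interval the supremum grows by at most the oscillation of [f] there. *)
Lemma running_sup_continuous t : continuous (fun s => running_sup t0 f (Rmax t0 s)) t.
Proof.
  apply continuous_eps. intros eps He. set (u := Rmax t0 t).
  destruct (proj1 (continuous_eps f u) (cf u) (eps / 4) ltac:(lra)) as [d [Hd Hs]].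
  exists d; split; trivial. intros s Hst.
  set (w := Rmax t0 s).
  assert (Hu : t0 <= u) by apply Rmax_l. assert (Hw : t0 <= w) by apply Rmax_l.
  assert (Hwu : Rabs (w - u) < d).
  { eapply Rle_lt_trans; [|apply Hst]. unfold w, u, Rmax. repeat destruct Rle_dec; unfold Rabs; repeat destruct Rcase_abs; lra. }
  assert (X : forall a b, t0 <= a <= b -> (forall c, a <= c <= b -> Rabs (c - u) < d) ->
     running_sup t0 f a <= running_sup t0 f b <= running_sup t0 f a + eps / 2).
  { intros a b Hab Hc. split.
    - apply running_sup_le; [lra|]. intros tau Htau. apply running_sup_ge; lra.
    - apply running_sup_le; [lra|]. intros tau Htau. destruct (Rle_dec tau a).
      + assert (A := running_sup_ge a tau ltac:(lra)). lra.
      + assert (A := running_sup_ge a a ltac:(lra)).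
        assert (A1 := Hs tau (Hc tau ltac:(lra))). assert (A2 := Hs a (Hc a ltac:(lra))).
        apply Rabs_def2 in A1. apply Rabs_def2 in A2. lra. }
  apply Rabs_def2 in Hwu.
  destruct (Rle_dec w u).
  - destruct (X w u) as [A B]; [lra| |apply Rabs_def1; lra]. intros c Hc. apply Rabs_def1; lra.
  - destruct (X u w) as [A B]; [lra| |apply Rabs_def1; lra]. intros c Hc. apply Rabs_def1; lra.
Qed.
End RunningSup.

Section Kernel.
Variables (t0 : R) (p11 p22 : R -> C).
Hypothesis c11 : forall t, Ccont p11 t.
Hypothesis c22 : forall t, Ccont p22 t.

Definition damping (t : R) : R := RInt (fun u => Re (Cplus (Cconj (p11 u)) (p22 u))) t0 t.

Lemma damping_continuous t : continuous damping t.
Proof. apply cont_RInt. auto with cont. Qed.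

(** The modulus sees only the real part of the exponent, so the kernel splits into a factor in [t]
    and one in [tau]. This identifies the bracket squared in chi with the bound of
    [damped_bound]. *)
Lemma Cmod_Ekern tau t w : Cmod (Cmult (Ekern p11 p22 tau t) w) = exp (- damping t) * (exp (damping tau) * Cmod w).
Proof.
  rewrite Cmod_mult. unfold Ekern. rewrite Cmod_cexp, CInt_parts by auto with cont. simpl.
  rewrite <- Rmult_assoc, <- exp_plus. f_equal. f_equal.
  unfold damping. rewrite (RInt_cont_Chasles _ t0 tau t); [simpl; ring|].
  intros s. apply (cont_Re (fun u => Cplus (Cconj (p11 u)) (p22 u))). auto with cont.
Qed.

Lemma Mfrak_eq p12 p21 t : (forall t, Ccont p12 t) -> (forall t, Ccont p21 t) -> t0 <= t ->
  Mfrak t0 p11 p12 p21 p22 t = exp (- damping t) *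
    running_sup t0 (fun tau => exp (damping tau) * Cmod (Cminus (p12 tau) (Cconj (p21 tau)))) t.
Proof.
  intros c12 c21 Ht. set (f := fun tau => exp (damping tau) * Cmod (Cminus (p12 tau) (Cconj (p21 tau)))).
  assert (cf : forall t, continuous f t).
  { intros s. apply cont_Rmult; [apply cont_Rexp, damping_continuous|]. auto with cont. }
  unfold Mfrak.
  rewrite (is_lub_Rbar_unique _ (Finite (exp (- damping t) * running_sup t0 f t))); trivial.
  assert (P := exp_pos (- damping t)).
  split.
  - intros x [tau [Htau ->]]. rewrite Cmod_Ekern. simpl. apply Rmult_le_compat_l; [lra|].
    now apply (running_sup_ge t0 f cf).
  - intros b Hb. destruct b as [b| |]; simpl; trivial.
    + apply Rmult_le_reg_l with (/ exp (- damping t)); [now apply Rinv_0_lt_compat|].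
      rewrite <- Rmult_assoc, Rinv_l, Rmult_1_l by lra.
      apply (running_sup_le t0 f cf); trivial. intros tau Htau.
      apply Rmult_le_reg_l with (exp (- damping t)); trivial.
      rewrite <- Rmult_assoc, Rinv_r, Rmult_1_l by lra.
      apply (Hb (exp (- damping t) * f tau)). exists tau; split; trivial. now rewrite Cmod_Ekern.
    + apply (Hb (exp (- damping t) * f t)). exists t; split; [lra|]. now rewrite Cmod_Ekern.
Qed.

Lemma RInt_Ekern r t : (forall t, Ccont r t) ->
  RInt (fun tau => Cmod (Cmult (Ekern p11 p22 tau t) (r tau))) t0 t =
  exp (- damping t) * RInt (fun tau => exp (damping tau) * Cmod (r tau)) t0 t.
Proof.
  intros cr. rewrite <- RInt_cont_scal.
  - apply (RInt_ext (V := R_CompleteNormedModule)). intros tau _. apply Cmod_Ekern.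
  - intros s. apply cont_Rmult; [apply cont_Rexp, damping_continuous|auto with cont].
Qed.
End Kernel.

Lemma cond4_ext t0 p p' chi chi' : (forall t, t0 <= t -> p t = p' t) -> (forall t, t0 <= t -> chi t = chi' t) ->
  cond4 t0 p chi -> cond4 t0 p' chi'.
Proof.
  intros Ep Echi [xi [xi0 [xiS [xiL H]]]]. exists xi. split; [exact xi0|split; [exact xiS|split; [exact xiL|]]].
  assert (xi_t0 : forall m, t0 <= xi m).
  { induction m; [lra|]. specialize (xiS m). lra. }
  assert (EI : forall m s, xi m <= s -> Itil p chi (xi m) s = Itil p' chi' (xi m) s).
  { intros m s Hs. specialize (xi_t0 m). unfold Itil. apply (RInt_ext (V := R_CompleteNormedModule)).
    rewrite Rmin_left, Rmax_right by lra. intros tau Htau. rewrite Echi by lra. f_equal. f_equal. f_equal.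
    apply (RInt_ext (V := R_CompleteNormedModule)). rewrite Rmin_left, Rmax_right by lra.
    intros u Hu. rewrite Ep by lra. reflexivity. }
  intros m t Ht. eapply Rle_trans; [right|apply (H m t Ht)]. symmetry.
  assert (Hm := xi_t0 m). apply (RInt_ext (V := R_CompleteNormedModule)).
  rewrite Rmin_left, Rmax_right by lra. intros tau Htau. rewrite Echi by lra. f_equal. f_equal.
  apply (RInt_ext (V := R_CompleteNormedModule)). rewrite Rmin_left, Rmax_right by lra.
  intros s Hs. rewrite Ep, EI by lra. reflexivity.
Qed.

(** * Global Hermitian solutions of the Riccati equation *)

Lemma Lip_RtoC (f : R -> (nat -> C) -> R) (K : R) : 0 <= K ->
  (forall x, (forall i t, Ccont (fun s => x s i) t) -> forall t, continuous (fun s => f s (x s)) t) ->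
  (forall t x y d, (forall j, Cmod (Cminus (x j) (y j)) <= d) -> Rabs (f t x - f t y) <= K * d) ->
  Lip (fun t x => RtoC (f t x)).
Proof.
  intros HK Hc HL. split; [auto with cont|].
  intros T. exists K; split; trivial. intros t x y d _ Hd.
  rewrite <- RtoC_minus, Cmod_R. auto.
Qed.

Lemma Bdd_RtoC (f : R -> (nat -> C) -> R) (b : R -> R) : (forall t, continuous b t) ->
  (forall t x, Rabs (f t x) <= Rabs (b t)) -> Bdd (fun t x => RtoC (f t x)).
Proof.
  intros Hb H T. destruct (cont_bounded b T Hb) as [M HM]. exists (Rabs M); split; [apply Rabs_pos|].
  intros t x Ht. rewrite Cmod_R. eapply Rle_trans; [apply H|]. eapply Rle_trans; [now apply HM|apply Rle_abs].
Qed.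

Lemma Rabs_Rmax_le a b c : Rabs (Rmax a b - Rmax a c) <= Rabs (b - c).
Proof. unfold Rmax; repeat destruct Rle_dec; unfold Rabs; repeat destruct Rcase_abs; lra. Qed.
Lemma Rabs_Rmin_le a b c : Rabs (Rmin a b - Rmin a c) <= Rabs (b - c).
Proof. unfold Rmin; repeat destruct Rle_dec; unfold Rabs; repeat destruct Rcase_abs; lra. Qed.

Lemma Cmod_reverse_triangle (z w : C) : Rabs (Cmod z - Cmod w) <= Cmod (Cminus z w).
Proof.
  apply Rabs_le. split.
  - assert (H := Cmod_triangle (Cminus w z) z). replace (Cplus (Cminus w z) z) with w in H by ring.
    replace (Cminus w z) with (Copp (Cminus z w)) in H by ring. rewrite Cmod_opp in H. lra.
  - assert (H := Cmod_triangle (Cminus z w) w). replace (Cplus (Cminus z w) w) with z in H by ring. lra.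
Qed.

(** * Truncations *)

Definition clip (k r : R) : R := Rmax 0 (Rmin k r).
Definition shrink (rho : R) (a : C) : R := rho / Rmax rho (Cmod a).

(** The last bound lets the truncated square replace [z^2] in the differential inequality that
    yields positivity of [z]. *)
Lemma clip_bounds k r : 0 <= clip k r /\ clip k r <= Rabs k /\ clip k r * clip k r <= r * r.
Proof. unfold clip, Rmax, Rmin, Rabs; repeat destruct Rle_dec; destruct Rcase_abs; repeat split; nra. Qed.
Lemma clip_id k r : 0 <= r <= k -> clip k r = r.
Proof. intros H. unfold clip. rewrite Rmin_right, Rmax_right; lra. Qed.
Lemma shrink_bounds rho a : 1 <= rho -> 0 < shrink rho a <= 1 /\ shrink rho a * Cmod a <= rho.
Proof.
  intros H. unfold shrink. assert (M1 := Rmax_l rho (Cmod a)). assert (M2 := Rmax_r rho (Cmod a)).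
  assert (P : 0 < / Rmax rho (Cmod a)) by (apply Rinv_0_lt_compat; lra).
  assert (E : / Rmax rho (Cmod a) * Rmax rho (Cmod a) = 1) by (apply Rinv_l; lra).
  unfold Rdiv. repeat split; [nra| |].
  - rewrite <- E, Rmult_comm. apply Rmult_le_compat_l; lra.
  - rewrite Rmult_assoc. apply Rle_trans with (rho * 1); [|lra].
    apply Rmult_le_compat_l; [lra|]. rewrite <- E. apply Rmult_le_compat_l; lra.
Qed.
Lemma shrink_id rho a : 0 < rho -> Cmod a <= rho -> shrink rho a = 1.
Proof. intros H0 H. unfold shrink. rewrite Rmax_left by lra. field. lra. Qed.

(** The denominator is essential: multiplied by [|a|], the right-hand side is still at most
    [|a - b|]. Hence [shrink rho a * a], the radial projection of [a] onto the disc of radius [rho],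
    is Lipschitz. *)
Lemma shrink_lip rho a b : 1 <= rho -> Rabs (shrink rho a - shrink rho b) <= Cmod (Cminus a b) / Rmax rho (Cmod a).
Proof.
  intros H. unfold shrink.
  set (m := Rmax rho (Cmod a)). set (n := Rmax rho (Cmod b)).
  assert (M1 : rho <= m) by apply Rmax_l. assert (M2 : rho <= n) by apply Rmax_l.
  assert (L : Rabs (n - m) <= Cmod (Cminus a b)).
  { eapply Rle_trans; [apply Rabs_Rmax_le|]. rewrite Rabs_minus_sym. apply Cmod_reverse_triangle. }
  replace (rho / m - rho / n) with ((n - m) * (rho / n) * / m) by (field; lra).
  rewrite !Rabs_mult, (Rabs_pos_eq (/ m)) by (left; apply Rinv_0_lt_compat; lra).
  apply Rmult_le_compat_r; [left; apply Rinv_0_lt_compat; lra|].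
  assert (Q : 0 <= rho / n <= 1).
  { unfold Rdiv. assert (P : 0 < / n) by (apply Rinv_0_lt_compat; lra).
    assert (E : / n * n = 1) by (apply Rinv_l; lra). split; nra. }
  rewrite (Rabs_pos_eq (rho / n)) by lra. generalize (Rabs_pos (n - m)). intros. nra.
Qed.

Lemma Lip_clip k i : (forall t, continuous k t) -> Lip (fun t x => RtoC (clip (k t) (Re (x i)))).
Proof.
  intros Hk. apply (Lip_RtoC (fun t x => clip (k t) (Re (x i))) 1); [lra| |].
  - intros x Hx t. unfold clip. auto with cont.
  - intros t x y d Hd. rewrite Rmult_1_l. unfold clip.
    eapply Rle_trans; [apply Rabs_Rmax_le|]. eapply Rle_trans; [apply Rabs_Rmin_le|].
    eapply Rle_trans; [apply (re_le_Cmod (Cminus (x i) (y i)))|apply Hd].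
Qed.
Lemma Bdd_clip k i : (forall t, continuous k t) -> Bdd (fun t x => RtoC (clip (k t) (Re (x i)))).
Proof.
  intros Hk. apply (Bdd_RtoC (fun t x => clip (k t) (Re (x i))) k Hk). intros t x.
  destruct (clip_bounds (k t) (Re (x i))) as [A [B _]]. rewrite Rabs_pos_eq; trivial.
Qed.
Lemma Lip_minmod M w i : (forall t, continuous M t) -> (forall t, Ccont w t) ->
  Lip (fun t x => RtoC (Rmin (M t) (Cmod (Cplus (x i) (w t))))).
Proof.
  intros HM Hw. apply (Lip_RtoC (fun t x => Rmin (M t) (Cmod (Cplus (x i) (w t)))) 1); [lra| |].
  - intros x Hx t. auto with cont.
  - intros t x y d Hd. rewrite Rmult_1_l.
    eapply Rle_trans; [apply Rabs_Rmin_le|]. eapply Rle_trans; [apply Cmod_reverse_triangle|].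
    replace (Cminus (Cplus (x i) (w t)) (Cplus (y i) (w t))) with (Cminus (x i) (y i)) by ring. apply Hd.
Qed.
Lemma Bdd_minmod M w i : (forall t, continuous M t) -> Bdd (fun t x => RtoC (Rmin (M t) (Cmod (Cplus (x i) (w t))))).
Proof.
  intros HM. apply (Bdd_RtoC (fun t x => Rmin (M t) (Cmod (Cplus (x i) (w t)))) M HM). intros t x.
  assert (P := Cmod_ge_0 (Cplus (x i) (w t))).
  unfold Rmin, Rabs; destruct Rle_dec; repeat destruct Rcase_abs; lra.
Qed.
Lemma shrink_continuous rho a t : continuous rho t -> Ccont a t -> 1 <= rho t -> continuous (fun s => shrink (rho s) (a s)) t.
Proof.
  intros Hr Ha H. unfold shrink. apply cont_Rmult; trivial. apply cont_Rinv; [auto with cont|].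
  assert (M1 := Rmax_l (rho t) (Cmod (a t))). lra.
Qed.
Lemma Lip_shrink rho i : (forall t, continuous rho t) -> (forall t, 1 <= rho t) ->
  Lip (fun t x => RtoC (shrink (rho t) (x i))).
Proof.
  intros Hr H1. apply (Lip_RtoC (fun t x => shrink (rho t) (x i)) 1); [lra| |].
  - intros x Hx t. apply (shrink_continuous rho (fun s => x s i)); auto.
  - intros t x y d Hd. rewrite Rmult_1_l. eapply Rle_trans; [now apply shrink_lip|].
    eapply Rle_trans; [|apply (Hd i)].
    assert (M1 := Rmax_l (rho t) (Cmod (x i))). specialize (H1 t).
    rewrite <- (Rmult_1_r (Cmod (Cminus (x i) (y i)))) at 2. unfold Rdiv.
    apply Rmult_le_compat_l; [apply Cmod_ge_0|]. rewrite <- Rinv_1. apply Rinv_le_contravar; lra.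
Qed.
Lemma Bdd_shrink rho i : (forall t, 1 <= rho t) -> Bdd (fun t x => RtoC (shrink (rho t) (x i))).
Proof.
  intros H1. apply (Bdd_RtoC (fun t x => shrink (rho t) (x i)) (fun _ => 1)); [auto with cont|].
  intros t x. destruct (shrink_bounds (rho t) (x i) (H1 t)) as [A _]. rewrite !Rabs_pos_eq; lra.
Qed.
Lemma Lip_shrunk rho i : (forall t, continuous rho t) -> (forall t, 1 <= rho t) ->
  Lip (fun t x => Cmult (RtoC (shrink (rho t) (x i))) (x i)).
Proof.
  intros Hr H1. split.
  - intros x Hx t. apply Ccont_mult; trivial. apply Ccont_RtoC.
    apply (shrink_continuous rho (fun s => x s i)); auto.
  - intros T. exists 2; split; [lra|]. intros t x y d _ Hd.
    replace (Cminus _ _) with (Cplus (Cmult (RtoC (shrink (rho t) (y i))) (Cminus (x i) (y i)))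
      (Cmult (Cminus (RtoC (shrink (rho t) (x i))) (RtoC (shrink (rho t) (y i)))) (x i))) by ring.
    eapply Rle_trans; [apply Cmod_triangle|].
    rewrite <- RtoC_minus, !Cmod_mult, !Cmod_R.
    destruct (shrink_bounds (rho t) (y i) (H1 t)) as [A _]. rewrite (Rabs_pos_eq (shrink _ _)) by lra.
    assert (L := shrink_lip (rho t) (x i) (y i) (H1 t)). specialize (H1 t).
    assert (Hd' := Hd i).
    assert (M1 := Rmax_l (rho t) (Cmod (x i))). assert (M2 := Rmax_r (rho t) (Cmod (x i))).
    set (m := Rmax (rho t) (Cmod (x i))) in *.
    assert (P0 := Cmod_ge_0 (Cminus (x i) (y i))). assert (P1 := Cmod_ge_0 (x i)).
    assert (Q : Rabs (shrink (rho t) (x i) - shrink (rho t) (y i)) * Cmod (x i) <= Cmod (Cminus (x i) (y i))).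
    { apply Rle_trans with (Cmod (Cminus (x i) (y i)) / m * m).
      - apply Rmult_le_compat; trivial. apply Rabs_pos.
      - right. field. lra. }
    nra.
Qed.
Lemma Bdd_shrunk rho i : (forall t, continuous rho t) -> (forall t, 1 <= rho t) ->
  Bdd (fun t x => Cmult (RtoC (shrink (rho t) (x i))) (x i)).
Proof.
  intros Hr H1 T. destruct (cont_bounded rho T Hr) as [M HM]. exists (Rabs M); split; [apply Rabs_pos|].
  intros t x Ht. rewrite Cmod_mult, Cmod_R.
  destruct (shrink_bounds (rho t) (x i) (H1 t)) as [A B]. rewrite Rabs_pos_eq by lra.
  eapply Rle_trans; [apply B|]. eapply Rle_trans; [|apply Rle_abs]. eapply Rle_trans; [apply Rle_abs|]. now apply HM.
Qed.
Lemma Lip_Re i : Lip (fun _ x => RtoC (Re (x i))).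
Proof.
  apply (Lip_RtoC (fun _ x => Re (x i)) 1); [lra| |].
  - intros x Hx t. auto with cont.
  - intros t x y d Hd. rewrite Rmult_1_l. eapply Rle_trans; [apply (re_le_Cmod (Cminus (x i) (y i)))|apply Hd].
Qed.

Section HermitianRiccati.
Variables (t0 : R) (P Q : R -> M2) (d12 d21 : R -> C).
Hypothesis P_continuous : forall t, Mcont P t.
Hypothesis Q_continuous : forall t, Mcont Q t.
Hypothesis d12_continuous : forall t, Ccont d12 t.
Hypothesis d21_continuous : forall t, Ccont d21 t.
Hypothesis Q_hermitian : forall t, t0 <= t -> M2adj (Q t) = Q t.
Let p11 t := e11 (P t).
Let p12 t := e12 (P t).
Let p21 t := e21 (P t).
Let p22 t := e22 (P t).
Let q11 t := e11 (Q t).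
Let q12 t := e12 (Q t).
Let q22 t := e22 (Q t).
Hypothesis p12_deriv : forall t, t0 <= t -> Cder p12 t (d12 t).
Hypothesis p21_deriv : forall t, t0 <= t -> Cder p21 t (d21 t).
Hypothesis cond_p11 : cond4 t0 p11 (chi3 t0 p11 p12 p21 p22 d21 q11 q12).
Hypothesis cond_p22 : cond4 t0 p22 (chi4 t0 p11 p12 p21 p22 d12 q12 q22).

(** With [a = z12 + conj p21], the off-diagonal entry of the Riccati equation reads
    [a' = - (z11 + z22 + g) a - z11 d + r3], and for [b = a + d = z12 + p12] it reads
    [b' = - (z11 + z22 + g) b + z22 d + r4]. *)
Let g t := Cplus (Cconj (p11 t)) (p22 t).
Let d t := Cminus (p12 t) (Cconj (p21 t)).
Let r3 t := Cplus (Cplus (Cconj (d21 t)) (Cmult (Cconj (p21 t)) (g t))) (q12 t).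
Let r4 t := Cplus (Cplus (d12 t) (Cmult (p12 t) (g t))) (q12 t).
Let rho := damping t0 p11 p22.
Let sup t := running_sup t0 (fun tau => exp (rho tau) * Cmod (d tau)) (Rmax t0 t).
Let envelope (r : R -> C) t := exp (- rho t) * (sup t + RInt (fun tau => exp (rho tau) * Cmod (r tau)) t0 t).
Let twice_Re (p : R -> C) t := 2 * Re (p t).
(** The solution, with value 1 at [t0], of the diagonal equation without its two squares; a majorant
    of the diagonal entry, hence the level at which it is clipped. *)
Let upper (p p' : R -> C) (qq : R -> C) t := exp (- RInt (twice_Re p) t0 t) +
  RInt (fun tau => exp (- RInt (twice_Re p) tau t) * (Cmod (p' tau) ^ 2 + Re (qq tau))) t0 t.
Let k1 := upper p11 p21 q11.
Let k2 := upper p22 p12 q22.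
Let radius t := Rmax 0 (envelope r3 t) + 1.

Lemma p11_continuous : forall t, Ccont p11 t. Proof. intros t; apply (P_continuous t). Qed.
Lemma p12_continuous : forall t, Ccont p12 t. Proof. intros t; apply (P_continuous t). Qed.
Lemma p21_continuous : forall t, Ccont p21 t. Proof. intros t; apply (P_continuous t). Qed.
Lemma p22_continuous : forall t, Ccont p22 t. Proof. intros t; apply (P_continuous t). Qed.
Lemma q11_continuous : forall t, Ccont q11 t. Proof. intros t; apply (Q_continuous t). Qed.
Lemma q12_continuous : forall t, Ccont q12 t. Proof. intros t; apply (Q_continuous t). Qed.
Lemma q22_continuous : forall t, Ccont q22 t. Proof. intros t; apply (Q_continuous t). Qed.
#[local] Hint Resolve p11_continuous p12_continuous p21_continuous p22_continuous q11_continuous q12_continuous q22_continuous : cont.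
Lemma g_continuous : forall t, Ccont g t. Proof. intros t; unfold g; auto with cont. Qed.
#[local] Hint Resolve g_continuous : cont.
Lemma d_continuous : forall t, Ccont d t. Proof. intros t; unfold d; auto with cont. Qed.
Lemma r3_continuous : forall t, Ccont r3 t. Proof. intros t; unfold r3; auto with cont. Qed.
Lemma r4_continuous : forall t, Ccont r4 t. Proof. intros t; unfold r4; auto with cont. Qed.
Lemma rho_continuous : forall t, continuous rho t. Proof. intros t; apply damping_continuous; auto with cont. Qed.
#[local] Hint Resolve g_continuous d_continuous r3_continuous r4_continuous rho_continuous : cont.
Lemma weighted_defect_continuous : forall t, continuous (fun tau => exp (rho tau) * Cmod (d tau)) t.
Proof. intros t. apply cont_Rmult; [apply cont_Rexp, rho_continuous|apply cont_Cmod, d_continuous]. Qed.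
Lemma envelope_continuous : forall r, (forall t, Ccont r t) -> forall t, continuous (envelope r) t.
Proof.
  intros r cr t. unfold envelope. apply cont_Rmult; [apply cont_Rexp, cont_Ropp, rho_continuous|].
  apply cont_Rplus; [apply (running_sup_continuous t0 _ weighted_defect_continuous)|].
  apply cont_RInt. intros s. apply cont_Rmult; [apply cont_Rexp, rho_continuous|apply cont_Cmod, cr].
Qed.
Lemma twice_Re_continuous : forall p, (forall t, Ccont p t) -> forall t, continuous (twice_Re p) t.
Proof. intros p cp t. unfold twice_Re. auto with cont. Qed.
Lemma forcing_continuous : forall p qq : R -> C, (forall t, Ccont p t) -> (forall t, Ccont qq t) ->
  forall t, continuous (fun tau => Cmod (p tau) ^ 2 + Re (qq tau)) t.
Proof.
  intros p qq cp cq t. apply cont_Rplus; [|auto with cont].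
  apply cont_ext with (fun s => Cmod (p s) * Cmod (p s)); [intros; ring|auto with cont].
Qed.
#[local] Hint Resolve twice_Re_continuous forcing_continuous : cont.
Lemma upper_deriv : forall p p' qq, (forall t, Ccont p t) -> (forall t, Ccont p' t) -> (forall t, Ccont qq t) ->
  forall t, is_derive (upper p p' qq) t (- twice_Re p t * upper p p' qq t + (Cmod (p' t) ^ 2 + Re (qq t))).
Proof.
  intros p p' qq cp cp' cqq t. unfold upper. eapply is_derive_eq.
  - apply is_derive_Rplus.
    + apply is_derive_Rexp, is_derive_Ropp. apply (derive_RInt_cont (twice_Re p)). auto with cont.
    + apply (damped_integral_deriv (twice_Re p) (fun tau => Cmod (p' tau) ^ 2 + Re (qq tau)) t0); auto with cont.
  - req. ring.
Qed.
Lemma envelope_nonneg : forall r, (forall t, Ccont r t) -> forall t, t0 <= t -> 0 <= envelope r t.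
Proof.
  intros r cr t Ht. unfold envelope. apply Rmult_le_pos; [left; apply exp_pos|]. apply Rplus_le_le_0_compat.
  - unfold sup. rewrite Rmax_right by trivial.
    eapply Rle_trans; [|apply (running_sup_ge t0 _ weighted_defect_continuous t t0); lra].
    apply Rmult_le_pos; [left; apply exp_pos|apply Cmod_ge_0].
  - set (f := fun tau => exp (rho tau) * Cmod (r tau)).
    rewrite <- (RInt_cont_point f t0).
    apply (nondecreasing_of_deriv (fun t => RInt f t0 t) f); trivial.
    + intros s _. apply derive_RInt_cont. intros u. apply cont_Rmult; [apply cont_Rexp, rho_continuous|apply cont_Cmod, cr].
    + intros s _. apply Rmult_le_pos; [left; apply exp_pos|apply Cmod_ge_0].
Qed.

(* Unknowns [z11], [z22] (real parts of components 0, 1) and [a = z12 + conj p21] (component 2).  Replacing [|a|] by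
   [min (envelope, |a|)] makes the bounds on [z11], [z22] independent of [a], and the factor [shrink] multiplies
   [z11 + z22] consistently in the equations of [a] and of [a + d = z12 + p12], so that both are bounded by their
   envelopes unconditionally; the truncations are then inactive. *)
Definition truncated (i : nat) (t : R) (x : nat -> C) : C :=
  let c1 := RtoC (clip (k1 t) (Re (x 0%nat))) in
  let c2 := RtoC (clip (k2 t) (Re (x 1%nat))) in
  let kap := RtoC (shrink (radius t) (x 2%nat)) in
  let n3 := RtoC (Rmin (envelope r3 t) (Cmod (Cplus (x 2%nat) 0))) in
  let n4 := RtoC (Rmin (envelope r4 t) (Cmod (Cplus (x 2%nat) (d t)))) in
  match i with
  | 0%nat => Cplus (Copp (Cplus (Cplus (Cmult c1 c1) (Cmult (RtoC (twice_Re p11 t)) (RtoC (Re (x 0%nat))))) (Cmult n3 n3)))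
               (RtoC (Cmod (p21 t) ^ 2 + Re (q11 t)))
  | 1%nat => Cplus (Copp (Cplus (Cplus (Cmult c2 c2) (Cmult (RtoC (twice_Re p22 t)) (RtoC (Re (x 1%nat))))) (Cmult n4 n4)))
               (RtoC (Cmod (p12 t) ^ 2 + Re (q22 t)))
  | 2%nat => Cplus (Copp (Cplus (Cplus (Cmult (Cmult kap (x 2%nat)) (Cplus c1 c2)) (Cmult (d t) (Cmult kap c1)))
                             (Cmult (g t) (x 2%nat)))) (r3 t)
  | _ => RtoC 0
  end.

Lemma radius_continuous : forall t, continuous radius t.
Proof. intros t. unfold radius. auto using envelope_continuous with cont. Qed.
Lemma radius_ge1 : forall t, 1 <= radius t.
Proof. intros t. unfold radius. assert (H := Rmax_l 0 (envelope r3 t)). lra. Qed.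

Lemma truncated_system : system 3 truncated.
Proof.
  assert (ck1 : forall t, continuous k1 t).
  { intros t. eapply continuous_of_derive. apply upper_deriv; auto with cont. }
  assert (ck2 : forall t, continuous k2 t).
  { intros t. eapply continuous_of_derive. apply upper_deriv; auto with cont. }
  assert (L1 := Lip_clip k1 0 ck1). assert (B1 := Bdd_clip k1 0 ck1).
  assert (L2 := Lip_clip k2 1 ck2). assert (B2 := Bdd_clip k2 1 ck2).
  assert (LK := Lip_shrink radius 2 radius_continuous radius_ge1). assert (BK := Bdd_shrink radius 2 radius_ge1).
  (* The unknown [x 2] is not bounded, but its product with the shrinking factor is, so this product
     is handled as one term. *)
  assert (LA := Lip_shrunk radius 2 radius_continuous radius_ge1). assert (BA := Bdd_shrunk radius 2 radius_continuous radius_ge1).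
  assert (L3 := Lip_minmod (envelope r3) (fun _ => RtoC 0) 2 (envelope_continuous r3 r3_continuous) (fun t => Ccont_const _ t)).
  assert (B3 := Bdd_minmod (envelope r3) (fun _ => RtoC 0) 2 (envelope_continuous r3 r3_continuous)).
  assert (L4 := Lip_minmod (envelope r4) d 2 (envelope_continuous r4 r4_continuous) d_continuous).
  assert (B4 := Bdd_minmod (envelope r4) d 2 (envelope_continuous r4 r4_continuous)).
  split.
  - intros [|[|[|i]]].
    + apply Lip_plus; [apply Lip_opp, Lip_plus; [apply Lip_plus|]|].
      * exact (Lip_mult _ _ L1 L1 B1 B1).
      * apply (Lip_scal (fun t => RtoC (twice_Re p11 t))); [auto with cont|apply Lip_Re].
      * exact (Lip_mult _ _ L3 L3 B3 B3).
      * apply (Lip_coef (fun t => RtoC (Cmod (p21 t) ^ 2 + Re (q11 t)))). intros t. apply Ccont_RtoC, forcing_continuous; auto with cont.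
    + apply Lip_plus; [apply Lip_opp, Lip_plus; [apply Lip_plus|]|].
      * exact (Lip_mult _ _ L2 L2 B2 B2).
      * apply (Lip_scal (fun t => RtoC (twice_Re p22 t))); [auto with cont|apply Lip_Re].
      * exact (Lip_mult _ _ L4 L4 B4 B4).
      * apply (Lip_coef (fun t => RtoC (Cmod (p12 t) ^ 2 + Re (q22 t)))). intros t. apply Ccont_RtoC, forcing_continuous; auto with cont.
    + apply Lip_plus; [apply Lip_opp, Lip_plus; [apply Lip_plus|]|].
      * exact (Lip_mult _ _ LA (Lip_plus _ _ L1 L2) BA (Bdd_plus _ _ B1 B2)).
      * exact (Lip_scal d _ d_continuous (Lip_mult _ _ LK L1 BK B1)).
      * exact (Lip_scal g _ g_continuous (Lip_proj 2)).
      * exact (Lip_coef r3 r3_continuous).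
    + exact (Lip_coef (fun _ => RtoC 0) (fun t => Ccont_const _ t)).
  - intros [|[|[|i]]] t x Hi; [lia|lia|lia|reflexivity].
Qed.

Lemma chi3_envelope t : t0 <= t -> chi3 t0 p11 p12 p21 p22 d21 q11 q12 t = envelope r3 t ^ 2 - Cmod (p21 t) ^ 2 - Re (q11 t).
Proof.
  intros Ht.
  assert (E : Mfrak t0 p11 p12 p21 p22 t + RInt (fun tau => Cmod (Cmult (Ekern p11 p22 tau t) (r3 tau))) t0 t = envelope r3 t).
  { rewrite (Mfrak_eq t0 p11 p22 p11_continuous p22_continuous p12 p21 t p12_continuous p21_continuous Ht), (RInt_Ekern t0 p11 p22 p11_continuous p22_continuous r3 t r3_continuous).
    unfold envelope, sup. rewrite (Rmax_right t0 t) by trivial. symmetry. apply Rmult_plus_distr_l. }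
  rewrite <- E. reflexivity.
Qed.
Lemma chi4_envelope t : t0 <= t -> chi4 t0 p11 p12 p21 p22 d12 q12 q22 t = envelope r4 t ^ 2 - Cmod (p12 t) ^ 2 - Re (q22 t).
Proof.
  intros Ht.
  assert (E : Mfrak t0 p11 p12 p21 p22 t + RInt (fun tau => Cmod (Cmult (Ekern p11 p22 tau t) (r4 tau))) t0 t = envelope r4 t).
  { rewrite (Mfrak_eq t0 p11 p22 p11_continuous p22_continuous p12 p21 t p12_continuous p21_continuous Ht), (RInt_Ekern t0 p11 p22 p11_continuous p22_continuous r4 t r4_continuous).
    unfold envelope, sup. rewrite (Rmax_right t0 t) by trivial. symmetry. apply Rmult_plus_distr_l. }
  rewrite <- E. reflexivity.
Qed.

(** The bounds [c^2 <= z^2] and [n^2 <= M^2] give [z' >= - z^2 - 2 Re p z - chi], hence positivity;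
    discarding both squares gives the upper bound. Nothing else about [n] is used, so the
    off-diagonal unknown need not be controlled beforehand. *)
Lemma diagonal_bounds (p p' qq : R -> C) (chi M z c n : R -> R) :
  (forall t, Ccont p t) -> (forall t, Ccont p' t) -> (forall t, Ccont qq t) -> (forall t, continuous M t) ->
  cond4 t0 p chi -> (forall t, t0 <= t -> chi t = M t ^ 2 - Cmod (p' t) ^ 2 - Re (qq t)) ->
  (forall t, is_derive z t (- (c t * c t + twice_Re p t * z t + n t * n t) + (Cmod (p' t) ^ 2 + Re (qq t)))) ->
  (forall t, c t * c t <= z t * z t) -> (forall t, t0 <= t -> n t * n t <= M t * M t) -> z t0 = 1 ->
  forall t, t0 <= t -> 0 < z t <= upper p p' qq t.
Proof.
  intros cp cp' cqq cM Hc Echi dz Hcz Hn z0 t Ht. split.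
  - assert (cchi : forall t, continuous (fun t => M t * M t - (Cmod (p' t) ^ 2 + Re (qq t))) t).
    { intros s. apply cont_Rminus; [auto with cont|]. now apply forcing_continuous. }
    refine (cond4_positive t0 p _ z _ cp cchi _ dz _ _ t Ht).
    + apply (cond4_ext t0 p p chi); trivial. intros s Hs. rewrite Echi by trivial. ring.
    + rewrite z0; lra.
    + intros s Hs. specialize (Hcz s). specialize (Hn s Hs). unfold twice_Re. lra.
  - set (G := fun t => RInt (twice_Re p) t0 t).
    assert (dG : forall t, is_derive G t (twice_Re p t)) by (intros; apply derive_RInt_cont; auto with cont).
    assert (X := nondecreasing_of_deriv (fun s => exp (G s) * (upper p p' qq s - z s))
      (fun s => exp (G s) * (c s * c s + n s * n s)) t0 t Ht).
    assert (Y : exp (G t0) * (upper p p' qq t0 - z t0) <= exp (G t) * (upper p p' qq t - z t)).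
    { apply X.
      - intros s _. eapply is_derive_eq.
        + apply is_derive_Rmult; [apply is_derive_Rexp, dG|apply is_derive_Rminus; [apply upper_deriv; trivial|apply dz]].
        + req. ring.
      - intros s _. apply Rmult_le_pos; [left; apply exp_pos|]. nra. }
    assert (E : upper p p' qq t0 = 1).
    { unfold upper. rewrite (RInt_cont_point (twice_Re p) t0), Ropp_0, exp_0.
      rewrite (RInt_cont_point (fun tau => exp (- RInt (twice_Re p) tau t0) * (Cmod (p' tau) ^ 2 + Re (qq tau))) t0). ring. }
    rewrite E, z0 in Y. assert (W := exp_pos (G t)). nra.
Qed.

Lemma min_sqr_le a b : 0 <= a -> 0 <= b -> Rmin a b * Rmin a b <= a * a.
Proof. intros. unfold Rmin; destruct Rle_dec; nra. Qed.

Lemma offdiagonal_bound (r x delta : R -> C) (s : R -> R) T :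
  (forall t, Ccont r t) -> (forall t, continuous s t) -> t0 <= T ->
  (forall t, t0 <= t -> 0 <= s t) ->
  (forall t, t0 <= t -> Cder x t (Cplus (Cplus (Copp (Cmult (Cplus (RtoC (s t)) (g t)) (x t))) (delta t)) (r t))) ->
  (forall t, t0 <= t -> Cmod (delta t) <= Cmod (d t) * s t) ->
  Cmod (x t0) <= Cmod (d t0) -> Cmod (x T) <= envelope r T.
Proof.
  intros cr cs HT Hs dx Hdelta x0. unfold envelope, sup. rewrite Rmax_right by trivial.
  refine (damped_bound t0 T g x delta r d s _ HT g_continuous cs cr _ _ _ x0 _).
  - intros; apply Hs; lra.
  - intros; apply dx; lra.
  - intros; apply Hdelta; lra.
  - intros t Ht. exact (running_sup_ge t0 _ weighted_defect_continuous T t Ht).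
Qed.

Theorem hermitian_riccati_global : exists Z : R -> M2,
  (forall t, t0 <= t -> M2adj (Z t) = Z t) /\ (forall t, t0 <= t -> Mder Z t (ric (P t) (Q t) (Z t))).
Proof.
  (* The value 1 matches [upper] at [t0], and [a = 0] makes both [a] and [a + d] at most [|d|] in
     modulus there. *)
  destruct (C_ode 3 truncated t0 (fun i => match i with 2%nat => RtoC 0 | _ => RtoC 1 end) truncated_system)
    as [x [x0 dx]].
  set (z1 := fun t => Re (x t 0%nat)). set (z2 := fun t => Re (x t 1%nat)). set (a := fun t => x t 2%nat).
  set (c1 := fun t => clip (k1 t) (z1 t)). set (c2 := fun t => clip (k2 t) (z2 t)).
  set (kap := fun t => shrink (radius t) (a t)).
  assert (dz1 : forall t, is_derive z1 t (- (c1 t * c1 t + twice_Re p11 t * z1 t +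
     Rmin (envelope r3 t) (Cmod (Cplus (a t) 0)) * Rmin (envelope r3 t) (Cmod (Cplus (a t) 0))) + (Cmod (p21 t) ^ 2 + Re (q11 t)))).
  { intros t. eapply is_derive_eq; [exact (proj1 (dx 0%nat t))|]. unfold truncated. simpl. unfold c1, z1, a. ring. }
  assert (dz2 : forall t, is_derive z2 t (- (c2 t * c2 t + twice_Re p22 t * z2 t +
     Rmin (envelope r4 t) (Cmod (Cplus (a t) (d t))) * Rmin (envelope r4 t) (Cmod (Cplus (a t) (d t)))) + (Cmod (p12 t) ^ 2 + Re (q22 t)))).
  { intros t. eapply is_derive_eq; [exact (proj1 (dx 1%nat t))|]. unfold truncated. simpl. unfold c2, z2, a. ring. }
  assert (da : forall t, Cder a t (Cplus (Copp (Cplus (Cplus (Cmult (Cmult (RtoC (kap t)) (a t)) (Cplus (RtoC (c1 t)) (RtoC (c2 t))))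
     (Cmult (d t) (Cmult (RtoC (kap t)) (RtoC (c1 t))))) (Cmult (g t) (a t)))) (r3 t))) by (intros t; exact (dx 2%nat t)).
  assert (cx : forall i t, Ccont (fun s => x s i) t) by (intros i t; eapply Ccont_of_der, dx).
  assert (cz1 : forall t, continuous z1 t) by (intros; eapply continuous_of_derive, dz1).
  assert (cz2 : forall t, continuous z2 t) by (intros; eapply continuous_of_derive, dz2).
  assert (ca : forall t, Ccont a t) by (intros; eapply Ccont_of_der, da).
  assert (ck1 : forall t, continuous k1 t) by (intros t; eapply continuous_of_derive; apply upper_deriv; auto with cont).
  assert (ck2 : forall t, continuous k2 t) by (intros t; eapply continuous_of_derive; apply upper_deriv; auto with cont).
  assert (cc1 : forall t, continuous c1 t) by (intros t; unfold c1, clip; auto with cont).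
  assert (cc2 : forall t, continuous c2 t) by (intros t; unfold c2, clip; auto with cont).
  assert (ckap : forall t, continuous kap t) by (intros t; apply shrink_continuous; auto using radius_continuous, radius_ge1).
  assert (Z1 : forall t, t0 <= t -> 0 < z1 t <= k1 t).
  { apply (diagonal_bounds p11 p21 q11 _ (envelope r3) z1 c1 _ p11_continuous p21_continuous q11_continuous (envelope_continuous r3 r3_continuous) cond_p11 chi3_envelope dz1).
    - intros t. apply clip_bounds.
    - intros t Ht. apply min_sqr_le; [exact (envelope_nonneg r3 r3_continuous t Ht)|apply Cmod_ge_0].
    - unfold z1. now rewrite x0. }
  assert (Z2 : forall t, t0 <= t -> 0 < z2 t <= k2 t).
  { apply (diagonal_bounds p22 p12 q22 _ (envelope r4) z2 c2 _ p22_continuous p12_continuous q22_continuous (envelope_continuous r4 r4_continuous) cond_p22 chi4_envelope dz2).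
    - intros t. apply clip_bounds.
    - intros t Ht. apply min_sqr_le; [exact (envelope_nonneg r4 r4_continuous t Ht)|apply Cmod_ge_0].
    - unfold z2. now rewrite x0. }
  set (s := fun t => kap t * (c1 t + c2 t)).
  assert (Hc : forall t, 0 <= c1 t /\ 0 <= c2 t /\ 0 < kap t).
  { intros t. split; [apply clip_bounds|split; [apply clip_bounds|]]. apply shrink_bounds, radius_ge1. }
  assert (cs : forall t, continuous s t) by (intros t; unfold s; auto with cont).
  assert (Hs : forall t, t0 <= t -> 0 <= s t).
  { intros t _. destruct (Hc t) as [? [? ?]]. unfold s. nra. }
  assert (a0 : a t0 = 0) by (unfold a; now rewrite x0).
  assert (Ba : forall t, t0 <= t -> Cmod (a t) <= envelope r3 t).
  { intros T HT. apply (offdiagonal_bound r3 a (fun t => Copp (Cmult (RtoC (kap t * c1 t)) (d t))) s); auto using r3_continuous.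
    - intros t Ht. eapply Cder_eq; [apply da|]. unfold s. rewrite !RtoC_mult, RtoC_plus. ring.
    - intros t Ht. rewrite Cmod_opp, Cmod_mult, Cmod_R. destruct (Hc t) as [? [? ?]].
      rewrite Rabs_pos_eq by nra. unfold s. rewrite Rmult_comm. apply Rmult_le_compat_l; [apply Cmod_ge_0|nra].
    - rewrite a0, Cmod_0. apply Cmod_ge_0. }
  assert (Bb : forall t, t0 <= t -> Cmod (Cplus (a t) (d t)) <= envelope r4 t).
  (* Passing from [a] to [a + d] turns the forcing [- kap c1 d] into [kap c2 d] with the same
     damping [s = kap (c1 + c2)]; this works because [kap] multiplies every occurrence of [c1] and
     [c2]. *)
  { intros T HT. apply (offdiagonal_bound r4 (fun t => Cplus (a t) (d t)) (fun t => Cmult (RtoC (kap t * c2 t)) (d t)) s); auto using r4_continuous.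
    - intros t Ht. eapply Cder_eq.
      + apply Cder_plus; [apply da|]. unfold d at 1. apply Cder_minus; [now apply p12_deriv|]. apply Cder_conj. now apply p21_deriv.
      + unfold s, r3, r4. rewrite !RtoC_mult, RtoC_plus. unfold d. ring.
    - intros t Ht. rewrite Cmod_mult, Cmod_R. destruct (Hc t) as [? [? ?]].
      rewrite Rabs_pos_eq by nra. unfold s. rewrite Rmult_comm. apply Rmult_le_compat_l; [apply Cmod_ge_0|nra].
    - rewrite a0. replace (Cplus 0 (d t0)) with (d t0) by ring. lra. }
  assert (e1 : forall t, t0 <= t -> c1 t = z1 t) by (intros t Ht; apply clip_id; specialize (Z1 t Ht); lra).
  assert (e2 : forall t, t0 <= t -> c2 t = z2 t) by (intros t Ht; apply clip_id; specialize (Z2 t Ht); lra).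
  assert (ek : forall t, t0 <= t -> kap t = 1).
  { intros t Ht. apply shrink_id; [specialize (radius_ge1 t); lra|]. eapply Rle_trans; [now apply Ba|].
    unfold radius. assert (U := Rmax_r 0 (envelope r3 t)). lra. }
  assert (sq : forall z : C, RtoC (Cmod z * Cmod z) = Cmult z (Cconj z)).
  { intros z. apply C_ext; [rewrite Cmod_sqrt; simpl; rewrite sqrt_sqrt by nra; unfold Re, Im; ring|simpl; ring]. }
  assert (sq2 : forall z : C, RtoC (Cmod z ^ 2) = Cmult z (Cconj z)).
  { intros z. rewrite <- sq. f_equal. ring. }
  assert (re2 : forall z : C, RtoC (2 * Re z) = Cplus z (Cconj z)).
  { intros z. apply C_ext; simpl; unfold Re; ring. }
  exists (fun t => mkM2 (RtoC (z1 t)) (Cminus (a t) (Cconj (p21 t))) (Cconj (Cminus (a t) (Cconj (p21 t)))) (RtoC (z2 t))).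
  split.
  - intros t _. m2unfold. cconj. reflexivity.
  - intros t Ht.
    assert (h := Q_hermitian t Ht).
    assert (h11 : Cconj (q11 t) = q11 t) by exact (f_equal e11 h).
    assert (h21 : e21 (Q t) = Cconj (q12 t)) by (symmetry; exact (f_equal e21 h)).
    assert (h22 : Cconj (q22 t) = q22 t) by exact (f_equal e22 h).
    assert (eP : P t = mkM2 (p11 t) (p12 t) (p21 t) (p22 t)) by (unfold p11, p12, p21, p22; now destruct (P t)).
    assert (eQ : Q t = mkM2 (q11 t) (q12 t) (Cconj (q12 t)) (q22 t)) by (rewrite <- h21; unfold q11, q12, q22; now destruct (Q t)).
    rewrite eP, eQ.
    apply C_real in h11. apply C_real in h22.
    assert (d12z : Cder (fun t => Cminus (a t) (Cconj (p21 t))) t (e12 (ric (mkM2 (p11 t) (p12 t) (p21 t) (p22 t)) (mkM2 (q11 t) (q12 t) (Cconj (q12 t)) (q22 t))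
      (mkM2 (RtoC (z1 t)) (Cminus (a t) (Cconj (p21 t))) (Cconj (Cminus (a t) (Cconj (p21 t)))) (RtoC (z2 t)))))).
    { eapply Cder_eq; [apply Cder_minus; [apply da|apply Cder_conj; now apply p21_deriv]|].
      rewrite e1, e2, ek by trivial. unfold ric. m2unfold. unfold r3, g, d. ring. }
    msplit.
    + eapply Cder_eq; [apply (Cder_RtoC z1), dz1|]. rewrite e1 by trivial.
      replace (Cplus (a t) 0) with (a t) by ring. rewrite Rmin_right by now apply Ba.
      unfold ric. m2unfold.
      rewrite RtoC_plus, RtoC_opp, !RtoC_plus, sq, sq2, <- h11, !RtoC_mult. unfold twice_Re. rewrite re2. cconj. ring.
    + exact d12z.
    + eapply Cder_eq; [apply (Cder_conj _ _ _ d12z)|]. unfold ric. m2unfold. cconj. ring.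
    + eapply Cder_eq; [apply (Cder_RtoC z2), dz2|]. rewrite e2 by trivial.
      rewrite Rmin_right by now apply Bb.
      unfold ric. m2unfold.
      rewrite RtoC_plus, RtoC_opp, !RtoC_plus, sq, sq2, <- h22, !RtoC_mult. unfold twice_Re, d. rewrite re2. cconj. ring.
Qed.
End HermitianRiccati.

(** * Extension to the real line *)

Lemma cont_on_spec t0 f t : cont_on t0 f -> t0 <= t -> forall eps, 0 < eps -> exists d, 0 < d /\
  forall s, t0 <= s -> Rabs (s - t) < d -> Rabs (Re (f s) - Re (f t)) < eps /\ Rabs (Im (f s) - Im (f t)) < eps.
Proof.
  intros H Ht eps He.
  destruct (proj1 (filterlim_locally (F := within (fun s => t0 <= s) (locally t)) f (f t)) (H t Ht) (mkposreal eps He))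
    as [d Hd].
  exists d; split; [apply cond_pos|]. intros s Hs Hst. exact (Hd s Hst Hs).
Qed.

Lemma deriv_on_spec t0 f f' t : deriv_on t0 f f' -> t0 <= t -> forall eps, 0 < eps -> exists d, 0 < d /\
  forall s, t0 <= s -> s <> t -> Rabs (s - t) < d ->
    Rabs ((Re (f s) - Re (f t)) / (s - t) - Re (f' t)) < eps /\ Rabs ((Im (f s) - Im (f t)) / (s - t) - Im (f' t)) < eps.
Proof.
  intros H Ht eps He.
  destruct (proj1 (filterlim_locally (F := within (fun s => t0 <= s /\ s <> t) (locally t)) _ (f' t)) (H t Ht) (mkposreal eps He))
    as [d Hd].
  exists d; split; [apply cond_pos|]. intros s Hs Hne Hst. destruct (Hd s Hst (conj Hs Hne)) as [H1 H2].
  change (Rabs (Re (Cmult (Cminus (f s) (f t)) (RtoC (/ (s - t)))) - Re (f' t)) < eps) in H1.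
  change (Rabs (Im (Cmult (Cminus (f s) (f t)) (RtoC (/ (s - t)))) - Im (f' t)) < eps) in H2.
  split.
  - replace ((Re (f s) - Re (f t)) / (s - t)) with (Re (Cmult (Cminus (f s) (f t)) (RtoC (/ (s - t))))); trivial.
    simpl. unfold Rdiv, Re, Im. ring.
  - replace ((Im (f s) - Im (f t)) / (s - t)) with (Im (Cmult (Cminus (f s) (f t)) (RtoC (/ (s - t))))); trivial.
    simpl. unfold Rdiv, Re, Im. ring.
Qed.

Lemma is_derive_quotient (h : R -> R) (t l : R) : is_derive h t l -> forall eps, 0 < eps -> exists d, 0 < d /\
  forall s, s <> t -> Rabs (s - t) < d -> Rabs ((h s - h t) / (s - t) - l) < eps.
Proof.
  intros H eps He. apply is_derive_Reals in H. destruct (H eps He) as [d Hd].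
  exists d; split; [apply cond_pos|]. intros s Hs Hst.
  specialize (Hd (s - t) ltac:(lra) Hst). now replace (t + (s - t)) with s in Hd by ring.
Qed.

Lemma quotient_is_derive (h : R -> R) (t l : R) : (forall eps, 0 < eps -> exists d, 0 < d /\
  forall s, s <> t -> Rabs (s - t) < d -> Rabs ((h s - h t) / (s - t) - l) < eps) -> is_derive h t l.
Proof.
  intros H. apply is_derive_Reals. intros eps He. destruct (H eps He) as [d [Hd Hs]].
  exists (mkposreal d Hd). intros k Hk Hkd. specialize (Hs (t + k) ltac:(lra)).
  replace (t + k - t) with k in Hs by ring. now apply Hs.
Qed.

Lemma deriv_on_of_Cder t0 f f' : (forall t, t0 <= t -> Cder f t (f' t)) -> deriv_on t0 f f'.
Proof.
  intros H t Ht. destruct (H t Ht) as [H1 H2].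
  apply (filterlim_locally (F := within (fun s => t0 <= s /\ s <> t) (locally t))). intros eps.
  destruct (is_derive_quotient _ _ _ H1 eps (cond_pos eps)) as [d1 [Hd1 Q1]].
  destruct (is_derive_quotient _ _ _ H2 eps (cond_pos eps)) as [d2 [Hd2 Q2]].
  assert (Hd : 0 < Rmin d1 d2) by (apply Rmin_pos; trivial).
  exists (mkposreal _ Hd). intros s Hs [_ Hne].
  assert (K1 : Rabs (s - t) < d1) by (eapply Rlt_le_trans; [apply Hs|apply Rmin_l]).
  assert (K2 : Rabs (s - t) < d2) by (eapply Rlt_le_trans; [apply Hs|apply Rmin_r]).
  specialize (Q1 s Hne K1). specialize (Q2 s Hne K2).
  split.
  - change (Rabs (Re (Cmult (Cminus (f s) (f t)) (RtoC (/ (s - t)))) - Re (f' t)) < eps).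
    replace (Re (Cmult (Cminus (f s) (f t)) (RtoC (/ (s - t))))) with ((Re (f s) - Re (f t)) / (s - t)); trivial.
    simpl. unfold Rdiv, Re, Im. ring.
  - change (Rabs (Im (Cmult (Cminus (f s) (f t)) (RtoC (/ (s - t)))) - Im (f' t)) < eps).
    replace (Im (Cmult (Cminus (f s) (f t)) (RtoC (/ (s - t))))) with ((Im (f s) - Im (f t)) / (s - t)); trivial.
    simpl. unfold Rdiv, Re, Im. ring.
Qed.

Lemma M2deriv_on_of_Mder t0 X X' : (forall t, t0 <= t -> Mder X t (X' t)) -> M2deriv_on t0 X X'.
Proof. intros H. msplit; apply deriv_on_of_Cder; intros t Ht; apply (H t Ht). Qed.

Definition ext {T : Type} (t0 : R) (f : R -> T) (t : R) : T := f (Rmax t0 t).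
(* Affine on the left of [t0], so that one-sided derivatives at [t0] become two-sided ones. *)
Definition extD (t0 : R) (f f' : R -> C) (t : R) : C := Cplus (f (Rmax t0 t)) (Cmult (RtoC (Rmin 0 (t - t0))) (f' t0)).
Definition extMD (t0 : R) (X X' : R -> M2) (t : R) : M2 :=
  M2add (X (Rmax t0 t)) (M2scal (RtoC (Rmin 0 (t - t0))) (X' t0)).

Lemma ext_eq {T : Type} t0 (f : R -> T) t : t0 <= t -> ext t0 f t = f t.
Proof. intros; unfold ext; now rewrite Rmax_right. Qed.
Lemma extD_eq t0 f f' t : t0 <= t -> extD t0 f f' t = f t.
Proof. intros; unfold extD. rewrite Rmax_right, Rmin_left by lra. ring. Qed.
Lemma extMD_eq t0 X X' t : t0 <= t -> extMD t0 X X' t = X t.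
Proof. intros; unfold extMD. rewrite Rmax_right, Rmin_left by lra. generalize (X t) (X' t0). m2. Qed.

Lemma ext_Ccont t0 f : cont_on t0 f -> forall t, Ccont (ext t0 f) t.
Proof.
  intros H t.
  assert (X : forall eps, 0 < eps -> exists d, 0 < d /\ forall s, Rabs (s - t) < d ->
     Rabs (Re (ext t0 f s) - Re (ext t0 f t)) < eps /\ Rabs (Im (ext t0 f s) - Im (ext t0 f t)) < eps).
  { intros eps He. destruct (cont_on_spec t0 f (Rmax t0 t) H (Rmax_l _ _) eps He) as [d [Hd Hs]].
    exists d; split; trivial. intros s Hst. apply Hs; [apply Rmax_l|].
    eapply Rle_lt_trans; [apply Rabs_Rmax_le|exact Hst]. }
  split; apply continuous_eps; intros eps He; destruct (X eps He) as [d [Hd Hs]]; exists d; split; trivial;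
  intros s Hst; now apply Hs.
Qed.

Lemma extD_Cder t0 f f' : deriv_on t0 f f' -> forall t, t0 <= t -> Cder (extD t0 f f') t (f' t).
Proof.
  intros H t Ht.
  assert (X : forall eps, 0 < eps -> exists d, 0 < d /\ forall s, s <> t -> Rabs (s - t) < d ->
     Rabs ((Re (extD t0 f f' s) - Re (extD t0 f f' t)) / (s - t) - Re (f' t)) < eps /\
     Rabs ((Im (extD t0 f f' s) - Im (extD t0 f f' t)) / (s - t) - Im (f' t)) < eps).
  { intros eps He. destruct (deriv_on_spec t0 f f' t H Ht eps He) as [d [Hd Hs]].
    destruct (Req_dec t t0) as [->|Hne].
    - exists d; split; trivial. intros s Hst Hsd.
      destruct (Rle_dec t0 s).
      + rewrite !extD_eq by lra. now apply Hs.
      + rewrite (extD_eq t0 f f' t0) by lra. unfold extD. rewrite Rmax_left, Rmin_right by lra.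
        split.
        * replace (_ - _) with 0; [rewrite Rabs_R0; trivial|]. simpl. unfold Re. field. lra.
        * replace (_ - _) with 0; [rewrite Rabs_R0; trivial|]. simpl. unfold Im. field. lra.
    - exists (Rmin d (t - t0)). split; [apply Rmin_pos; lra|]. intros s Hst Hsd.
      assert (K1 : Rabs (s - t) < d) by (eapply Rlt_le_trans; [apply Hsd|apply Rmin_l]).
      assert (K2 : Rabs (s - t) < t - t0) by (eapply Rlt_le_trans; [apply Hsd|apply Rmin_r]).
      apply Rabs_def2 in K2. rewrite !extD_eq by lra. apply Hs; trivial. lra. }
  split; apply quotient_is_derive; intros eps He; destruct (X eps He) as [d [Hd Hs]]; exists d; split; trivial;
  intros s Hne Hst; now apply Hs.
Qed.

Lemma Ccont_ext (f f' : R -> C) t : (forall s, f s = f' s) -> Ccont f t -> Ccont f' t.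
Proof.
  intros E [H1 H2]. split; [refine (cont_ext _ _ _ _ H1)|refine (cont_ext _ _ _ _ H2)]; intros s; simpl; now rewrite E.
Qed.

Lemma extD_Ccont t0 f f' : deriv_on t0 f f' -> forall t, Ccont (extD t0 f f') t.
Proof.
  intros H t. unfold extD. apply Ccont_plus.
  - apply Ccont_ext with (fun s => extD t0 f f' (Rmax t0 s)); [intros; apply extD_eq, Rmax_l|].
    apply (clamp_Ccont (extD t0 f f') t0). intros s Hs. eapply Ccont_of_der, extD_Cder; trivial.
  - apply Ccont_mult; [apply Ccont_RtoC|apply Ccont_const].
    apply cont_Rmin; [apply cont_Rconst|apply cont_Rminus; [apply continuous_id|apply cont_Rconst]].
Qed.

Lemma ext_Mcont t0 X : M2cont_on t0 X -> forall t, Mcont (ext t0 X) t.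
Proof.
  intros [H1 [H2 [H3 H4]]] t. msplit.
  - exact (ext_Ccont t0 _ H1 t).
  - exact (ext_Ccont t0 _ H2 t).
  - exact (ext_Ccont t0 _ H3 t).
  - exact (ext_Ccont t0 _ H4 t).
Qed.
Lemma extMD_Mcont t0 X X' : M2deriv_on t0 X X' -> forall t, Mcont (extMD t0 X X') t.
Proof.
  intros [H1 [H2 [H3 H4]]] t. msplit.
  - exact (extD_Ccont t0 _ _ H1 t).
  - exact (extD_Ccont t0 _ _ H2 t).
  - exact (extD_Ccont t0 _ _ H3 t).
  - exact (extD_Ccont t0 _ _ H4 t).
Qed.
Lemma extMD_Mder t0 X X' : M2deriv_on t0 X X' -> forall t, t0 <= t -> Mder (extMD t0 X X') t (X' t).
Proof.
  intros [H1 [H2 [H3 H4]]] t Ht. msplit.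
  - exact (extD_Cder t0 _ _ H1 t Ht).
  - exact (extD_Cder t0 _ _ H2 t Ht).
  - exact (extD_Cder t0 _ _ H3 t Ht).
  - exact (extD_Cder t0 _ _ H4 t Ht).
Qed.

(** Difference quotients from the right already determine the derivative. This covers the endpoint
    [t0], to the left of which the extended functions are arbitrary. *)
Lemma deriv_zero_right (h : R -> R) (t l : R) : is_derive h t l -> (forall s, t <= s -> h s = 0) -> l = 0.
Proof.
  intros H H0. apply NNPP. intros Hl.
  destruct (is_derive_quotient h t l H (Rabs l) (Rabs_pos_lt l Hl)) as [d [Hd Hs]].
  specialize (Hs (t + d / 2) ltac:(lra)). rewrite !H0 in Hs by lra.
  replace ((0 - 0) / (t + d / 2 - t) - l) with (- l) in Hs by (field; lra). rewrite Rabs_Ropp in Hs.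
  assert (Rabs l < Rabs l); [|lra]. apply Hs. rewrite Rabs_pos_eq; lra.
Qed.
Lemma Cder_zero_right f t l : Cder f t l -> (forall s, t <= s -> f s = RtoC 0) -> l = RtoC 0.
Proof.
  intros [H1 H2] H0. apply C_ext; simpl.
  - apply (deriv_zero_right _ _ _ H1). intros s Hs. now rewrite H0.
  - apply (deriv_zero_right _ _ _ H2). intros s Hs. now rewrite H0.
Qed.
Lemma Mder_zero_right X t D : Mder X t D -> (forall s, t <= s -> X s = M2zero) -> D = M2zero.
Proof.
  intros [H1 [H2 [H3 H4]]] H0. apply M2_ext.
  - apply (Cder_zero_right _ _ _ H1). intros s Hs. now rewrite H0.
  - apply (Cder_zero_right _ _ _ H2). intros s Hs. now rewrite H0.
  - apply (Cder_zero_right _ _ _ H3). intros s Hs. now rewrite H0.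
  - apply (Cder_zero_right _ _ _ H4). intros s Hs. now rewrite H0.
Qed.

Lemma M2psd_tr X : M2psd X -> 0 <= Re (M2tr X).
Proof.
  intros [_ H]. assert (A := H 1 0). assert (B := H 0 1). destruct X as [[a a'] b c [e e']].
  cbv [e11 e12 e21 e22 M2tr] in *. simpl in *. lra.
Qed.

(** * Independence of values before [t0] *)

Section ChiExt.
Variables (t0 : R) (p11 p12 p21 p22 p11' p12' p21' p22' : R -> C).
Hypothesis E11 : forall t, t0 <= t -> p11 t = p11' t.
Hypothesis E12 : forall t, t0 <= t -> p12 t = p12' t.
Hypothesis E21 : forall t, t0 <= t -> p21 t = p21' t.
Hypothesis E22 : forall t, t0 <= t -> p22 t = p22' t.

Lemma Ekern_ext tau t : t0 <= tau <= t -> Ekern p11 p22 tau t = Ekern p11' p22' tau t.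
Proof.
  intros H. unfold Ekern, CInt. do 2 f_equal. apply (RInt_ext (V := C_R_CompleteNormedModule)).
  rewrite Rmin_left, Rmax_right by lra. intros s Hs. rewrite E11, E22 by lra. reflexivity.
Qed.
Lemma Mfrak_ext t : Mfrak t0 p11 p12 p21 p22 t = Mfrak t0 p11' p12' p21' p22' t.
Proof.
  unfold Mfrak. f_equal. apply Lub_Rbar_eqset. intros x.
  split; intros [tau [H ->]]; exists tau; (split; [exact H|]); rewrite Ekern_ext, E12, E21 by lra; reflexivity.
Qed.
Lemma chi3_ext d d' q11 q11' q12 q12' : (forall t, t0 <= t -> d t = d' t) -> (forall t, t0 <= t -> q11 t = q11' t) ->
  (forall t, t0 <= t -> q12 t = q12' t) -> forall t, t0 <= t ->
  chi3 t0 p11 p12 p21 p22 d q11 q12 t = chi3 t0 p11' p12' p21' p22' d' q11' q12' t.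
Proof.
  intros Ed Eq1 Eq2 t Ht. unfold chi3. rewrite Mfrak_ext, E21, Eq1 by trivial. do 4 f_equal.
  apply (RInt_ext (V := R_CompleteNormedModule)). rewrite Rmin_left, Rmax_right by lra.
  intros tau Htau. rewrite Ekern_ext, Ed, E21, E11, E22, Eq2 by lra. reflexivity.
Qed.
Lemma chi4_ext d d' q12 q12' q22 q22' : (forall t, t0 <= t -> d t = d' t) -> (forall t, t0 <= t -> q12 t = q12' t) ->
  (forall t, t0 <= t -> q22 t = q22' t) -> forall t, t0 <= t ->
  chi4 t0 p11 p12 p21 p22 d q12 q22 t = chi4 t0 p11' p12' p21' p22' d' q12' q22' t.
Proof.
  intros Ed Eq1 Eq2 t Ht. unfold chi4. rewrite Mfrak_ext, E12, Eq2 by trivial. do 4 f_equal.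
  apply (RInt_ext (V := R_CompleteNormedModule)). rewrite Rmin_left, Rmax_right by lra.
  intros tau Htau. rewrite Ekern_ext, Ed, E12, E11, E22, Eq1 by lra. reflexivity.
Qed.
End ChiExt.

(** * Non-oscillation of the Hamiltonian system *)

Theorem theorem3p4 (t0 : R) (A B Cm : R -> M2) (S dS F : R -> M2) (dp12 dp21 : R -> C) :
  M2cont_on t0 A -> M2cont_on t0 B -> M2cont_on t0 Cm ->
  (forall t, t0 <= t -> M2adj (B t) = B t /\ M2adj (Cm t) = Cm t) ->
  (* 1') B >= 0, S = sqrt B its nonnegative definite square root, S is C^1 *)
  (forall t, t0 <= t -> M2psd (B t)) ->
  (forall t, t0 <= t -> M2psd (S t) /\ M2mul (S t) (S t) = B t) ->
  M2deriv_on t0 S dS -> M2cont_on t0 dS ->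
  (* 2') *)
  M2cont_on t0 F ->
  (forall t, t0 <= t ->
     M2mul (S t) (M2mul (F t) (M2sub (M2mul (A t) (S t)) (dS t)))
     = M2sub (M2mul (A t) (S t)) (dS t)) ->
  let P := Pmat A S dS F in
  let Q := Qmat S Cm in
  let p11 := fun t => e11 (P t) in let p12 := fun t => e12 (P t) in
  let p21 := fun t => e21 (P t) in let p22 := fun t => e22 (P t) in
  let q11 := fun t => e11 (Q t) in let q12 := fun t => e12 (Q t) in
  let q22 := fun t => e22 (Q t) in
  (* 3') *)
  deriv_on t0 p12 dp12 -> cont_on t0 dp12 ->
  deriv_on t0 p21 dp21 -> cont_on t0 dp21 ->
  (* 4') *)
  cond4 t0 p11 (chi3 t0 p11 p12 p21 p22 dp21 q11 q12) ->
  cond4 t0 p22 (chi4 t0 p11 p12 p21 p22 dp12 q12 q22) ->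
  ham_nonoscillatory t0 A B Cm.
Proof.
  intros cA _ cC hBC _ hSB dS_ cdS cF EF P Q p11 p12 p21 p22 q11 q12 q22 D12 cD12 D21 cD21 C3 C4 Hosc.
  set (A' := ext t0 A). set (C' := ext t0 Cm). set (S' := extMD t0 S dS).
  set (P0 := fun t => M2mul (ext t0 F t) (M2sub (M2mul (A' t) (S' t)) (ext t0 dS t))).
  (* The off-diagonal entries get the affine extension, since they must have two-sided derivatives
     at [t0]; continuity suffices for the diagonal ones. *)
  set (P' := fun t => mkM2 (e11 (P0 t)) (extD t0 p12 dp12 t) (extD t0 p21 dp21 t) (e22 (P0 t))).
  set (Q' := fun t => M2mul (S' t) (M2mul (C' t) (S' t))).
  assert (cA' : forall t, Mcont A' t) by (apply ext_Mcont; trivial).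
  assert (cC' : forall t, Mcont C' t) by (apply ext_Mcont; trivial).
  assert (cS' : forall t, Mcont S' t) by (apply extMD_Mcont; trivial).
  assert (cP0 : forall t, Mcont P0 t).
  { intros t. unfold P0. apply Mcont_mul; [now apply ext_Mcont|]. apply Mcont_sub; [auto with cont|now apply ext_Mcont]. }
  assert (cP' : forall t, Mcont P' t).
  { intros t. msplit; [apply (cP0 t)|exact (extD_Ccont t0 _ _ D12 t)|exact (extD_Ccont t0 _ _ D21 t)|apply (cP0 t)]. }
  assert (cQ' : forall t, Mcont Q' t) by (intros t; unfold Q'; auto with cont).
  assert (eA : forall t, t0 <= t -> A' t = A t) by (intros; now apply ext_eq).
  assert (eC : forall t, t0 <= t -> C' t = Cm t) by (intros; now apply ext_eq).
  assert (eS : forall t, t0 <= t -> S' t = S t) by (intros; now apply extMD_eq).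
  assert (eP : forall t, t0 <= t -> P' t = P t).
  { intros t Ht. unfold P', P0. rewrite !ext_eq, !extD_eq, eA, eS by trivial.
    unfold p12, p21, P, Pmat. now destruct (M2mul (F t) (M2sub (M2mul (A t) (S t)) (dS t))). }
  assert (eQ : forall t, t0 <= t -> Q' t = Q t) by (intros t Ht; unfold Q'; now rewrite eS, eC).
  assert (hS : forall t, t0 <= t -> M2adj (S' t) = S' t).
  { intros t Ht. rewrite eS by trivial. apply (proj1 (hSB t Ht)). }
  assert (hC : forall t, t0 <= t -> M2adj (C' t) = C' t).
  { intros t Ht. rewrite eC by trivial. apply (hBC t Ht). }
  (* The factorization hypothesis says [S P = A S - S']. *)
  assert (EdS : forall t, t0 <= t -> dS t = M2sub (M2mul (A' t) (S' t)) (M2mul (S' t) (P' t))).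
  { intros t Ht. rewrite eP, eA, eS by trivial. unfold P, Pmat. rewrite EF by trivial.
    generalize (M2mul (A t) (S t)) (dS t). m2. }
  (* [S - S*] vanishes to the right of [t], hence so does its derivative; taking adjoints in [EdS]
     then gives the second expression for [S']. *)
  assert (hdS : forall t, t0 <= t -> M2adj (dS t) = dS t).
  { intros t Ht. symmetry. apply M2sub_zero.
    apply (Mder_zero_right (fun s => M2sub (S' s) (M2adj (S' s))) t).
    - apply Mder_sub; [|apply Mder_adj]; now apply extMD_Mder.
    - intros s Hs. rewrite hS by lra. generalize (S' s). m2. }
  assert (dS' : forall t, t0 <= t -> Mder S' t (M2sub (M2mul (A' t) (S' t)) (M2mul (S' t) (P' t)))).
  { intros t Ht. rewrite <- EdS by trivial. now apply extMD_Mder. }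
  assert (EdS' : forall t, t0 <= t -> M2sub (M2mul (A' t) (S' t)) (M2mul (S' t) (P' t)) =
     M2sub (M2mul (S' t) (M2adj (A' t))) (M2mul (M2adj (P' t)) (S' t))).
  { intros t Ht. rewrite <- EdS, <- hdS, EdS by trivial. madj. now rewrite hS. }
  assert (ep11 : forall t, t0 <= t -> p11 t = e11 (P' t)) by (intros t Ht; now rewrite eP).
  assert (ep12 : forall t, t0 <= t -> p12 t = e12 (P' t)) by (intros t Ht; now rewrite eP).
  assert (ep21 : forall t, t0 <= t -> p21 t = e21 (P' t)) by (intros t Ht; now rewrite eP).
  assert (ep22 : forall t, t0 <= t -> p22 t = e22 (P' t)) by (intros t Ht; now rewrite eP).
  assert (ed12 : forall t, t0 <= t -> dp12 t = ext t0 dp12 t) by (intros t Ht; now rewrite ext_eq).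
  assert (ed21 : forall t, t0 <= t -> dp21 t = ext t0 dp21 t) by (intros t Ht; now rewrite ext_eq).
  assert (eq11 : forall t, t0 <= t -> q11 t = e11 (Q' t)) by (intros t Ht; now rewrite eQ).
  assert (eq12 : forall t, t0 <= t -> q12 t = e12 (Q' t)) by (intros t Ht; now rewrite eQ).
  assert (eq22 : forall t, t0 <= t -> q22 t = e22 (Q' t)) by (intros t Ht; now rewrite eQ).
  destruct (hermitian_riccati_global t0 P' Q' (ext t0 dp12) (ext t0 dp21) cP' cQ') as [Z [hZ dZ]].
  - now apply ext_Ccont.
  - now apply ext_Ccont.
  - intros t Ht. unfold Q'. madj. rewrite hS, hC by trivial. apply M2mul_assoc.
  - intros t Ht. rewrite <- ed12 by trivial. now apply extD_Cder.
  - intros t Ht. rewrite <- ed21 by trivial. now apply extD_Cder.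
  - refine (cond4_ext t0 _ _ _ _ ep11 _ C3). now apply chi3_ext.
  - refine (cond4_ext t0 _ _ _ _ ep22 _ C4). now apply chi4_ext.
  - destruct (riccati_reduction t0 A' C' P' S' Z cA' cP' cS' hC hS) as [t1 [H1 [W [Y1 [hW [dW [hY1 W1]]]]]]]; trivial.
    { intros t Ht. rewrite eS by trivial. apply M2psd_tr, (hSB t Ht). }
    destruct (conjoined_of_riccati t0 t1 A' C' P' S' W Y1) as [Phi [Psi [dPhi [dPsi [Hconj Hdet]]]]]; trivial.
    destruct (Hosc Phi Psi) with t1 as [t [Ht [_ E]]].
    + exists (fun t => M2add (M2mul (A' t) (Phi t)) (M2mul (M2mul (S' t) (S' t)) (Psi t))),
        (fun t => M2sub (M2mul (C' t) (Phi t)) (M2mul (M2adj (A' t)) (Psi t))).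
      split; [|split].
      * now apply M2deriv_on_of_Mder.
      * now apply M2deriv_on_of_Mder.
      * intros t Ht. rewrite eA, eC, eS, (proj2 (hSB t Ht)) by trivial. split; reflexivity.
    + exact Hconj.
    + now apply (Hdet t).
Qed.
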